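(* Let $(A,\mathbb{N},\alpha)$ be a dynamical system in which every $\alpha_{n}:=\alpha^{n}$ extends to a strictly continuous endomorphism of the multiplier algebra $M(A)$ of $A$. Let $p=\overline{\pi}_{\alpha}(1_{M(A)})\in\mathcal{L}(\ell^{2}(\mathbb{N},A))$, let $\psi:(A\times_{\alpha}^{\mathrm{piso}}\mathbb{N},i_A,v)\to p\mathcal{T}_{\alpha}p$ be the isomorphism determined by $\psi(i_A(a))=\pi_\alpha(a)$ and $\psi(v_n)=pS_n^*p$, and let $\phi:A\times_{\alpha}^{\mathrm{piso}}\mathbb{N}\to A\times_{\alpha}^{\mathrm{iso}}\mathbb{N}$ be the natural surjection. Then $\psi$ takes the ideal $$\ker\phi=\overline{\operatorname{span}}\{v_{m}^{*}i_{A}(a)(1-v^{*}v)v_{n}:a\in A,\ m,n\in\mathbb{N}\}$$ of $A\times_{\alpha}^{\mathrm{piso}}\mathbb{N}$ isomorphically onto the full corner $p\,[\mathcal{K}(\ell^{2}(\mathbb{N},A))]\,p$ of $\mathcal{K}(\ell^{2}(\mathbb{N},A))$. So there is a short exact sequence of $C^*$-algebras $$0\longrightarrow p\,[\mathcal{K}(\ell^{2}(\mathbb{N},A))]\,p\stackrel{\Psi}{\longrightarrow}A\times_{\alpha}^{\mathrm{piso}}\mathbb{N}\stackrel{\phi}{\longrightarrow}A\times_{\alpha}^{\mathrm{iso}}\mathbb{N}\longrightarrow 0,$$ where $\Psi(pS_{m}\pi_{\alpha}(a)(1-SS^{*})S_{n}^{*}p)=v_{m}^{*}i_{A}(a)(1-v^{*}v)v_{n}$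 for $a\in A$, $m,n\in\mathbb{N}$.
   Context: $\mathbb{N}=\{0,1,2,\dots\}$ is the positive cone of $\mathbb{Z}$. The system $(A,\mathbb{N},\alpha)$ consists of a (not necessarily unital) $C^*$-algebra $A$ and the action of $\mathbb{N}$ by the powers $\alpha_n=\alpha^n$ of an endomorphism $\alpha$ of $A$; $\overline{\alpha}_n$ denotes the strictly continuous extension to $M(A)$ (possibly $\overline{\alpha}_n(1)\ne1$). A partial-isometric representation of $\mathbb{N}$ is a map $V$ with each $V_n$ a partial isometry and $V_mV_n=V_{m+n}$. A covariant partial-isometric representation of $(A,\mathbb{N},\alpha)$ on a Hilbert space (or in a $C^*$-algebra $B$, with $V$ taking values in $M(B)$) is a pair $(\pi,V)$ with $\pi$ a non-degenerate representation of $A$ and $V$ a partial-isometric representation of $\mathbb{N}$ such that $\pi(\alpha_n(a))=V_n\pi(a)V_n^*$ and $V_n^*V_n\pi(a)=\pi(a)V_n^*V_n$. The partial-isometric crossed product $(A\times_{\alpha}^{\mathrm{piso}}\mathbb{N},i_A,v)$ is the (unique up to isomorphism) $C^*$-algebra $B$ with a non-degenerate homomorphism $i_A:A\to B$ and partial-isometric representation $v:\mathbb{N}\to M(B)$ such that $(i_A,v)$ is covariant, every covariant partial-isometric representation $(\pi,V)$ on a Hilbert space yields a non-degenerate representation $\pi\times V$ of $B$ with $(\pi\times V)\circ i_A=\pi$, $\overline{(\pi\times V)}\circ v=V$, and $B=\overline{\operatorname{span}}\{v_m^*i_A(a)v_n\}$. Write $v:=v_1$, so $v_n=v^n$. A covariant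 isometric representation of $(A,\mathbb{N},\alpha)$ is a pair $(\pi,V)$ with $\pi$ non-degenerate, each $V_n$ an isometry, $V_mV_n=V_{m+n}$, and $\pi(\alpha_n(a))=V_n\pi(a)V_n^*$. The isometric crossed product $(A\times_{\alpha}^{\mathrm{iso}}\mathbb{N},j_A,T)$ is the $C^*$-algebra generated by a universal covariant isometric representation $(j_A,T)$ (closed span of $T_m^*j_A(a)T_n$); it may be zero. The natural surjection $\phi$ is given by $\phi(v_m^*i_A(a)v_n)=T_m^*j_A(a)T_n$. $\ell^2(\mathbb{N},A)$ is the Hilbert $A$-module of sequences $(x_n)$ in $A$ with $\sum x_n^*x_n$ norm convergent, with $(x_n)\cdot a=(x_na)$, $\langle(x_n),(y_n)\rangle=\sum x_n^*y_n$; $\mathcal{L}$ and $\mathcal{K}$ denote its adjointable and (generalized) compact operators. Put $\pi_\alpha(a)(x_n)=(\alpha_n(a)x_n)$, $S(x_0,x_1,\dots)=(0,x_0,x_1,\dots)$ and $S_n=S^n$. $\mathcal{T}_\alpha:=\overline{\operatorname{span}}\{S_m\pi_\alpha(a)S_n^*:a\in A,\ m,n\in\mathbb{N}\}$ is a $C^*$-subalgebra of $\mathcal{L}(\ell^2(\mathbb{N},A))$; $\pi_\alpha$ extends to a strictly continuous homomorphism $\overline{\pi}_\alpha:M(A)\to M(\mathcal{T}_\alpha)$, and $p=\overline{\pi}_\alpha(1_{M(A)})$ is the projection $p(x_n)=(\overline{\alpha}_n(1)x_n)$. It is known that the $\psi$ in the claim (extended to multiplier algebras where needed) is an isomorphism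 of $A\times_{\alpha}^{\mathrm{piso}}\mathbb{N}$ onto $p\mathcal{T}_\alpha p$. A corner $qCq$ of a $C^*$-algebra $C$ ($q\in M(C)$ a projection) is full if $\overline{\operatorname{span}}\,CqC=C$. *)

(* Defs.v *)
(* Everything is over the complex scalars R[i] of a realType R; norms take
   their (real, nonnegative) values in R[i]. *)
From HB Require Import structures.
From mathcomp Require Import all_boot all_order all_algebra.
From mathcomp Require Import complex.
From mathcomp Require Import all_classical all_reals all_analysis.

Set Implicit Arguments.
Unset Strict Implicit.
Unset Printing Implicit Defensive.

Import Order.TTheory GRing.Theory Num.Theory numFieldNormedType.Exports.

Local Open Scope classical_set_scope.
Local Open Scope ring_scope.

(** * C*-algebras and Hilbert spaces *)

(* No unit is required, and the zero algebra is allowed. *)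
HB.mixin Record isCStarAlgebra (R : realType) A
    of CompleteNormedModule R[i] A := {
  amul : A -> A -> A;
  astar : A -> A;
  amulA : forall a b c, amul a (amul b c) = amul (amul a b) c;
  amulPl : forall (k : R[i]) a b c,
    amul (k *: a + b) c = k *: amul a c + amul b c;
  amulPr : forall (k : R[i]) a b c,
    amul a (k *: b + c) = k *: amul a b + amul a c;
  astarK : forall a, astar (astar a) = a;
  astarP : forall (k : R[i]) a b,
    astar (k *: a + b) = Num.conj k *: astar a + astar b;
  astarM : forall a b, astar (amul a b) = amul (astar b) (astar a);
  anormM : forall a b, `|amul a b| <= `|a| * `|b|;
  anorm_star : forall a, `|amul (astar a) a| = `|a| ^+ 2
}.

#[short(type="cstarType")]
HB.structure Definition CStarAlgebra (R : realType) :=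
  {A of isCStarAlgebra R A & CompleteNormedModule R[i] A}.

(* As for Hilbert modules, the inner product is conjugate-linear in its first
   argument. *)
HB.mixin Record isHilbertSpace (R : realType) H
    of CompleteNormedModule R[i] H := {
  hip : H -> H -> R[i];
  hipP : forall (k : R[i]) x y z, hip x (k *: y + z) = k * hip x y + hip x z;
  hip_conj : forall x y, hip y x = Num.conj (hip x y);
  hip_norm : forall x, hip x x = `|x| ^+ 2
}.

#[short(type="hilbertType")]
HB.structure Definition HilbertSpace (R : realType) :=
  {H of isHilbertSpace R H & CompleteNormedModule R[i] H}.

Definition linear_span (R : realType) (E : lmodType R[i]) (G : set E) : set E :=
  [set x | exists (n : nat) (k : 'I_n -> R[i]) (g : 'I_n -> E),
     (forall i, G (g i)) /\ x = \sum_(i < n) k i *: g i].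

Definition closed_span (R : realType) (E : normedModType R[i]) (G : set E)
  : set E := closure (linear_span G).

(** * Adjointable operators *)

(* Common carrier of the three kinds of spaces on which operators act here:
   Hilbert spaces, a C*-algebra as a Hilbert module over itself, and
   l^2(N, A). The underlying space is the subset [dom] of [vec]; it carries the
   inner product [ip], which is irrelevant outside [dom]. *)
Record ipspace (R : realType) := IPSpace {
  vec :> lmodType R[i];
  val : normedZmodType R[i];
  dom : set vec;
  ip : vec -> vec -> val
}.

Definition hspace (R : realType) (H : hilbertType R) : ipspace R :=
  @IPSpace R H R[i] setT (@hip R H).

Definition selfmod (R : realType) (B : cstarType R) : ipspace R :=
  @IPSpace R B B setT (fun a b => amul (astar a) b).

Definition l2mod (R : realType) (A : cstarType R) : ipspace R :=
  @IPSpace R (nat -> A) A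
    [set x | cvgn (series (fun n => amul (astar (x n)) (x n)))]
    (fun x y => limn (series (fun n => amul (astar (x n)) (y n)))).

Section Operators.
Context {R : realType}.
Implicit Types (X : ipspace R).

Definition ipnorm X (x : X) : R[i] := sqrtC `|ip x x|.

(* A map on [dom X] is represented by its extension by 0 to all of [vec X];
   thus two operators on [dom X] are equal iff their representatives are. *)
Definition restr X (f : X -> X) : X -> X := patch (fun=> 0) (@dom R X) f.

Definition self_map X (T : X -> X) : Prop :=
  (forall x, dom x -> dom (T x)) /\ (forall x, ~ dom x -> T x = 0).

Definition is_adjoint X (T T' : X -> X) : Prop :=
  [/\ self_map T, self_map T' &
      forall x y, dom x -> dom y -> ip (T x) y = ip x (T' y)].

(* The algebra L(X); L(selfmod B) is the multiplier algebra M(B). *)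
Definition adjointable X : set (X -> X) :=
  [set T | exists T', is_adjoint T T'].
Arguments adjointable X _ : clear implicits.

(* The adjoint of an adjointable operator (it is unique). *)
Definition adj X (T : X -> X) : X -> X := xget 0 [set T' | is_adjoint T T'].

Definition idop X : X -> X := restr id.
Arguments idop X _ : clear implicits.

Definition partial_isometry X (V : X -> X) : Prop :=
  adjointable X V /\ V \o adj V \o V = V.

Definition isometry X (V : X -> X) : Prop :=
  adjointable X V /\ adj V \o V = idop X.

Definition projection X (P : X -> X) : Prop :=
  [/\ adjointable X P, P \o P = P & adj P = P].

(* Closed linear span in L(X) for the operator norm: the bound below says
   ||T - T0|| <= e. *)
Definition op_closed_span X (G : set (X -> X)) : set (X -> X) :=
  [set T | adjointable X T /\ forall e : R[i], 0 < e ->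
     exists2 T0, linear_span G T0 &
       forall x, dom x -> ipnorm (T x - T0 x) <= e * ipnorm x].

Definition rank_one X (act : X -> val X -> X) (x y : X) : X -> X :=
  restr (fun z => act x (ip y z)).

End Operators.

Arguments idop {R} X _.
Arguments adjointable {R} X _.

(** * Morphisms *)

(* Complex *-operations on a vector space, without axioms: this puts
   homomorphisms between C*-algebras and algebras of operators on one footing. *)
Record starOps (R : realType) := StarOps {
  ssort :> lmodType R[i];
  smul : ssort -> ssort -> ssort;
  sstar : ssort -> ssort
}.

Definition alg_ops (R : realType) (B : cstarType R) : starOps R :=
  @StarOps R B (@amul R B) (@astar R B).

Definition op_ops (R : realType) (X : ipspace R) : starOps R :=
  @StarOps R (X -> X) (fun T T' => T \o T') (@adj R X).

Section Morphisms.
Context {R : realType}.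

(* f is a *-homomorphism from the *-subalgebra P of S into Q. *)
Definition star_hom (S S' : starOps R) (P : set S) (Q : set S') (f : S -> S')
    : Prop :=
  [/\ forall x, P x -> Q (f x),
      forall (k : R[i]) x y, P x -> P y -> f (k *: x + y) = k *: f x + f y,
      forall x y, P x -> P y -> f (smul x y) = smul (f x) (f y) &
      forall x, P x -> f (sstar x) = sstar (f x)].

Definition star_iso (S S' : starOps R) (P : set S) (Q : set S') (f : S -> S')
    : Prop :=
  [/\ star_hom P Q f, {in P &, injective f} & f @` P = Q].

(* Concrete C*-algebras of operators: norm-closed *-subalgebras of L(X). *)
Definition cstar_subalgebra (X : ipspace R) (P : set (X -> X)) : Prop :=
  [/\ P `<=` adjointable X, op_closed_span P `<=` P,
      forall T T', P T -> P T' -> P (T \o T') &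
      forall T, P T -> P (adj T)].

Definition representation (A : cstarType R) (X : ipspace R)
    (pi : A -> X -> X) : Prop :=
  star_hom (S := alg_ops A) (S' := op_ops X) setT (adjointable X) pi.

(* span pi(A) X is dense in X *)
Definition nondegenerate (A : cstarType R) (X : ipspace R)
    (pi : A -> X -> X) : Prop :=
  forall x, dom x -> forall e : R[i], 0 < e ->
    exists2 y, linear_span [set z | exists a w, dom w /\ z = pi a w] y &
      ipnorm (x - y) <= e.

(* [T] is the image of the multiplier [m] of [B] under the extension of [rho] to
   M(B), i.e. rhobar(m) rho(b) = rho(m b); this determines [T] when [rho] is
   non-degenerate. For an isomorphism [rho] of [B] onto a corner p C p, it
   determines T p, hence T as soon as T = p T p. *)
Definition extension_at (B : cstarType R) (X : ipspace R)
    (rho : B -> X -> X) (m : B -> B) (T : X -> X) : Prop :=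
  adjointable X T /\ forall b, rho (m b) = T \o rho b.

End Morphisms.

(** * Multipliers *)

Section Multipliers.
Context {R : realType} (B : cstarType R).

(* An element of B as an element of M(B). *)
Definition lmul (b : B) : selfmod B -> selfmod B := fun c => amul b c.

Definition multiplier : set (selfmod B -> selfmod B) :=
  adjointable (selfmod B).

(* The product b m in B of b in B and m in M(B), namely (m^* b^* )^*; the
   product m b is just the value of m at b. *)
Definition rmul (b : B) (m : selfmod B -> selfmod B) : B :=
  astar (adj m (astar b)).

(* Basic neighbourhoods of m0 in M(B) for the strict topology, which is
   generated by the seminorms m |-> ||m b|| and m |-> ||m^* b|| = ||b^* m||. *)
Definition strict_ball (m0 : selfmod B -> selfmod B) (F : seq B) (e : R[i])
    : set (selfmod B -> selfmod B) :=
  [set m | multiplier m /\ forall b, b \in F ->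
     `|m b - m0 b| < e /\ `|adj m b - adj m0 b| < e].

Definition strictly_continuous
    (f : (selfmod B -> selfmod B) -> (selfmod B -> selfmod B)) : Prop :=
  forall m0, multiplier m0 -> forall (F : seq B) (e : R[i]), 0 < e ->
    exists (G : seq B) (d : R[i]), 0 < d /\
      forall m, strict_ball m0 G d m -> strict_ball (f m0) F e (f m).

(* [f] is a strictly continuous endomorphism of M(B) extending the
   endomorphism [g] of B; it is not assumed to be unital. *)
Definition strict_extension (g : B -> B)
    (f : (selfmod B -> selfmod B) -> (selfmod B -> selfmod B)) : Prop :=
  [/\ star_hom (S := op_ops (selfmod B)) (S' := op_ops (selfmod B))
        multiplier multiplier f,
      strictly_continuous f &
      forall b, f (lmul b) = lmul (g b)].

End Multipliers.

Arguments multiplier {R} B _.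

(** * Covariant representations and crossed products *)

Section CrossedProducts.
Context {R : realType} (A : cstarType R) (alpha : A -> A).

Definition covariant_piso (X : ipspace R) (pi : A -> X -> X)
    (V : nat -> X -> X) : Prop :=
  [/\ representation pi /\ nondegenerate pi,
      forall n, partial_isometry (V n),
      forall m n, V m \o V n = V (m + n)%N,
      forall n a, pi (iter n alpha a) = V n \o pi a \o adj (V n) &
      forall n a, adj (V n) \o V n \o pi a = pi a \o adj (V n) \o V n].

Definition covariant_iso (X : ipspace R) (pi : A -> X -> X)
    (V : nat -> X -> X) : Prop :=
  [/\ representation pi /\ nondegenerate pi,
      forall n, isometry (V n),
      forall m n, V m \o V n = V (m + n)%N &
      forall n a, pi (iter n alpha a) = V n \o pi a \o adj (V n)].

(* w_m^* i(a) w_n in B, for i : A -> B and w : N -> M(B) *)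
Definition monomial (B : cstarType R) (i : A -> B)
    (w : nat -> selfmod B -> selfmod B) (m : nat) (a : A) (n : nat) : B :=
  adj (w m) (rmul (i a) (w n)).

(* w_m^* i(a) (1 - w_1^* w_1) w_n in B *)
Definition defect_monomial (B : cstarType R) (i : A -> B)
    (w : nat -> selfmod B -> selfmod B) (m : nat) (a : A) (n : nat) : B :=
  adj (w m) (rmul (i a) ((idop (selfmod B) - (adj (w 1%N) \o w 1%N)) \o w n)).

(* (B, i, w) is universal for the class [cov] of covariant pairs: (i, w) is
   in the class, every pair in the class on a Hilbert space factors through it,
   and the elements w_m^* i(a) w_n span a dense subspace of B. *)
Definition universal_for
    (cov : forall X : ipspace R, (A -> X -> X) -> (nat -> X -> X) -> Prop)
    (B : cstarType R) (i : A -> B) (w : nat -> selfmod B -> selfmod B)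
    : Prop :=
  [/\ star_hom (S := alg_ops A) (S' := alg_ops B) setT setT i,
      cov (selfmod B) (fun a => lmul (i a)) w,
      forall (H : hilbertType R) (pi : A -> hspace H -> hspace H)
        (V : nat -> hspace H -> hspace H), cov (hspace H) pi V ->
        exists rho : B -> hspace H -> hspace H,
          [/\ representation rho, nondegenerate rho,
              forall a, rho (i a) = pi a &
              forall n, extension_at rho (w n) (V n)] &
      closed_span [set b | exists m a n, b = monomial i w m a n] = setT].

Definition piso_crossed_product (B : cstarType R) (iA : A -> B)
    (v : nat -> selfmod B -> selfmod B) : Prop :=
  universal_for covariant_piso iA v.

Definition iso_crossed_product (B : cstarType R) (jA : A -> B)
    (T : nat -> selfmod B -> selfmod B) : Prop :=
  universal_for covariant_iso jA T.

End CrossedProducts.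

(** * Operators on l^2(N, A) *)

Section L2.
Context {R : realType} (A : cstarType R).
Local Notation l2 := (l2mod A).

(* S(x_0, x_1, ...) = (0, x_0, x_1, ...) *)
Definition shift : l2 -> l2 :=
  restr (fun (x : l2) (n : nat) => if n is k.+1 then x k else 0).

Definition shiftn (n : nat) : l2 -> l2 := restr (iter n shift).

Definition pi_alpha (alpha : A -> A) (a : A) : l2 -> l2 :=
  restr (fun (x : l2) n => amul (iter n alpha a) (x n)).

(* The extension of pi_alpha to M(A), where [abar n] is the strictly continuous
   extension of alpha^n to M(A). *)
Definition pi_alpha_bar (abar : nat -> (selfmod A -> selfmod A) ->
    (selfmod A -> selfmod A)) (m : selfmod A -> selfmod A) : l2 -> l2 :=
  restr (fun (x : l2) n => abar n m (x n)).

Definition toeplitz (alpha : A -> A) : set (l2 -> l2) :=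
  op_closed_span [set T | exists m a n,
    T = shiftn m \o pi_alpha alpha a \o adj (shiftn n)].

(* x . a = (x_n a), so rank_one is z |-> x . <y, z> *)
Definition l2_act (x : l2) (a : A) : l2 := fun n => amul (x n) a.

Definition l2_compacts : set (l2 -> l2) :=
  op_closed_span [set T | exists x y : l2,
    [/\ dom x, dom y & T = rank_one l2_act x y]].

End L2.

Arguments shift {R} A _ _.
Arguments shiftn {R} A n _ _.
Arguments l2_compacts {R} A _.

(** * Corners and exact sequences *)

Section Corners.
Context {R : realType}.

Definition corner (X : ipspace R) (p : X -> X) (P : set (X -> X))
    : set (X -> X) := [set p \o T \o p | T in P].

(* p is a projection in L(X) multiplying P into itself, and span P p P is
   dense in P. *)
Definition full_corner (X : ipspace R) (p : X -> X) (P : set (X -> X))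
    : Prop :=
  [/\ projection p,
      forall T, P T -> P (p \o T) /\ P (T \o p) &
      op_closed_span [set T | exists T1 T2,
        [/\ P T1, P T2 & T = T1 \o p \o T2]] = P].

Definition ker (B D : cstarType R) (phi : B -> D) : set B :=
  [set b | phi b = 0].

(* 0 -> P -> B -> D -> 0, for a C*-algebra P of operators on X *)
Definition short_exact (X : ipspace R) (P : set (X -> X)) (B D : cstarType R)
    (Psi : (X -> X) -> B) (phi : B -> D) : Prop :=
  [/\ cstar_subalgebra P,
      star_hom (S := op_ops X) (S' := alg_ops B) P setT Psi /\
        star_hom (S := alg_ops B) (S' := alg_ops D) setT setT phi,
      {in P &, injective Psi},
      Psi @` P = ker phi &
      phi @` setT = setT].

End Corners.

(* Main.v *)
(* Write [e_mn(a)] for the operator on l^2(N, A) that sends [x] to the sequence with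
   the single entry [a x_n], at index [m]. The covariance relations give
     v_m^* i(a) (1 - v^* v) v_n = v_m^* i(a) v_n - v_(m+1)^* i(alpha a) v_(n+1),
   so these elements are killed by [phi], and [psi] maps them to [p e_mn(a) p]. As
   [K(l^2(N, A))] is the closed span of the [e_mn(a)] and [psi] is isometric, the
   closed span [I] of these elements is the preimage under [psi] of the corner
   [p K p]; in particular it is an ideal. Conversely, if [b] is not in [I], there is
   a positive functional on [B] that vanishes on [I] but not at [b^* b]
   (Hahn-Banach). Since [1 - v^* v] maps [B] into [I], its GNS representation
   turns [v] into an isometry; it therefore factors through [phi], so that
   [phi b] is not zero. The corner is full because [e_mn(bc) = e_m0(b) p e_0n(c)]. *)

(* Two obstacles shape the argument. First, positivity, contractivity of representations, isometry
   of injective ones and closedness of images are obtained from norms and square roots, with no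
   spectrum: an iteration gives square roots, the estimate ||h (1 - h)^n|| <= 1/n gives approximate
   units, [cut] plays the role of a spectral projection, and quotients by ideals become estimates
   modulo the ideal ([quot_bound]). Second, the data are known only in part: [psi] is described at
   [v n] but not at its adjoint, and [abar n] is just some strictly continuous extension of alpha^n,
   with no stated relation between different [n]. Both gaps are closed by approximate units: strict
   continuity makes alpha^n(u) b approach abar_n(1) b, so that the products [pi_alpha alpha u \o T]
   with all [u] determine [p \o T]. *)
Require Import Defs.
From HB Require Import structures.
From mathcomp Require Import all_boot all_order all_algebra.
From mathcomp Require Import complex.
From mathcomp Require Import all_classical all_reals all_analysis.
From mathcomp Require Import ring lra.

Set Implicit Arguments.
Unset Strict Implicit.
Unset Printing Implicit Defensive.

Import Order.TTheory GRing.Theory Num.Theory numFieldNormedType.Exports.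

Local Open Scope classical_set_scope.
Local Open Scope ring_scope.

(** * Reflexive normalization of noncommutative polynomials *)

(* [ring] applies to commutative rings only. *)
Section NonCommutativeExpressions.
Variables (K : comNzRingType) (U : algType K).

Inductive ncexpr :=
  | NCvar of nat | NC0 | NC1 | NCadd of ncexpr & ncexpr | NCopp of ncexpr
  | NCmul of ncexpr & ncexpr | NCscale of K & ncexpr.

Fixpoint nceval (env : seq U) (e : ncexpr) : U :=
  match e with
  | NCvar i => nth 0 env i
  | NC0 => 0
  | NC1 => 1
  | NCadd a b => nceval env a + nceval env b
  | NCopp a => - nceval env a
  | NCmul a b => nceval env a * nceval env b
  | NCscale k a => k *: nceval env a
  end.

(** The comparison and the list operations are spelled out again so that the tactic can name them in
    its [cbv] list and leave the coefficients to [ring]. *)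
Fixpoint nceqb (m1 m2 : seq nat) : bool :=
  match m1, m2 with
  | [::], [::] => true
  | i :: m1', j :: m2' => if Nat.eqb i j then nceqb m1' m2' else false
  | _, _ => false
  end.

Fixpoint ncapp T (l1 l2 : seq T) : seq T :=
  if l1 is a :: l then a :: ncapp l l2 else l2.

Fixpoint ncmap T T' (f : T -> T') (l : seq T) : seq T' :=
  if l is a :: l' then f a :: ncmap f l' else [::].

Fixpoint ncprod (l1 l2 : seq (K * seq nat)) : seq (K * seq nat) :=
  if l1 is p :: l then
    ncapp (ncmap (fun q => (p.1 * q.1, ncapp p.2 q.2)) l2) (ncprod l l2)
  else [::].

Fixpoint ncnorm (e : ncexpr) : seq (K * seq nat) :=
  match e with
  | NCvar i => [:: (1, [:: i])]
  | NC0 => [::]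
  | NC1 => [:: (1, [::])]
  | NCadd a b => ncapp (ncnorm a) (ncnorm b)
  | NCopp a => ncmap (fun p => (- p.1, p.2)) (ncnorm a)
  | NCmul a b => ncprod (ncnorm a) (ncnorm b)
  | NCscale k a => ncmap (fun p => (k * p.1, p.2)) (ncnorm a)
  end.

Fixpoint nccoef (m : seq nat) (l : seq (K * seq nat)) : K :=
  if l is p :: l' then
    if nceqb p.2 m then p.1 + nccoef m l' else nccoef m l'
  else 0.

Fixpoint nccheck (l0 l : seq (K * seq nat)) : Prop :=
  if l is p :: l' then nccoef p.2 l0 = 0 /\ nccheck l0 l' else True.

Let mon (env : seq U) (m : seq nat) : U := \prod_(i <- m) nth 0 env i.
Let evl (env : seq U) (l : seq (K * seq nat)) : U :=
  \sum_(p <- l) p.1 *: mon env p.2.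

Let nceqbE m1 m2 : nceqb m1 m2 = (m1 == m2).
Proof.
elim: m1 m2 => [|i m1 IH] [|j m2] //=.
rewrite eqseq_cons -IH; case: PeanoNat.Nat.eqb_spec => [->|].
  by rewrite eqxx.
by move=> /eqP/negPf ->.
Qed.

Let ncappE T (l1 l2 : seq T) : ncapp l1 l2 = l1 ++ l2.
Proof. by elim: l1 => //= a l ->. Qed.

Let ncmapE T T' (f : T -> T') (l : seq T) : ncmap f l = map f l.
Proof. by elim: l => //= a l ->. Qed.

Let evlE env e : nceval env e = evl env (ncnorm e).
Proof.
elim: e => [i|||a IHa b IHb|a IH|a IHa b IHb|k a IH] /=.
- by rewrite /evl/mon !big_cons !big_nil /= scale1r mulr1 addr0.
- by rewrite /evl big_nil.
- by rewrite /evl/mon big_cons !big_nil scale1r addr0.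
- by rewrite ncappE /evl big_cat IHa IHb.
- rewrite ncmapE /evl big_map IH -sumrN.
  by apply: eq_bigr => p _; rewrite scaleNr.
- rewrite IHa IHb; elim: (ncnorm a) => [|p l IH] /=.
    by rewrite /evl big_nil mul0r.
  rewrite ncappE ncmapE /evl big_cat /= big_map big_cons mulrDl.
  congr (_ + _); last exact: IH.
  rewrite mulr_sumr; apply: eq_bigr => q _ /=.
  by rewrite ncappE /mon big_cat -scalerAl -scalerAr scalerA.
- rewrite ncmapE /evl big_map IH scaler_sumr.
  by apply: eq_bigr => p _; rewrite scalerA.
Qed.

Let nccoefE m l : nccoef m l = \sum_(p <- l | p.2 == m) p.1.
Proof.
elim: l => [|p l IH] /=; first by rewrite big_nil.
by rewrite big_cons nceqbE IH.
Qed.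

Let nccheckP l0 l p : nccheck l0 l -> p \in l -> nccoef p.2 l0 = 0.
Proof.
elim: l => [|q l IH] //= [h1 h2]; rewrite inE => /orP[/eqP ->//|].
exact: IH.
Qed.

(** The expanded difference is regrouped by monomials; only those that occur in it are tested, so
    the check is a finite conjunction of scalar identities. *)
Lemma nceval_eq env e1 e2 :
  nccheck (ncnorm (NCadd e1 (NCopp e2))) (ncnorm (NCadd e1 (NCopp e2))) ->
  nceval env e1 = nceval env e2.
Proof.
move=> h; apply/eqP; rewrite -subr_eq0; apply/eqP.
rewrite -[LHS]/(nceval env (NCadd e1 (NCopp e2))) evlE.
move: (ncnorm _) h => l h; rewrite /evl.
pose s := undup [seq p.2 | p <- l].
transitivity (\sum_(m <- s) nccoef m l *: mon env m).
  transitivity (\sum_(m <- s) \sum_(p <- l | p.2 == m) p.1 *: mon env p.2).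
    rewrite (exchange_big_dep xpredT) //= big_seq [RHS]big_seq.
    apply: eq_bigr => p pl.
    rewrite -big_filter (_ : [seq m <- s | p.2 == m] = [:: p.2]).
      by rewrite big_seq1.
    rewrite (eq_filter (a2 := pred1 p.2)); last by move=> m /=; rewrite eq_sym.
    by rewrite filter_pred1_uniq ?undup_uniq// mem_undup; apply/mapP; exists p.
  apply: eq_bigr => m _; rewrite nccoefE scaler_suml.
  by apply: eq_bigr => p /eqP ->.
rewrite big_seq big1// => m; rewrite mem_undup => /mapP[p pl ->].
by rewrite (nccheckP h pl) scale0r.
Qed.

End NonCommutativeExpressions.

Ltac nc_find x l :=
  lazymatch l with
  | x :: _ => constr:(0%N)
  | _ :: ?l' => let n := nc_find x l' in constr:(S n)
  end.
Ltac nc_mem x l :=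
  lazymatch l with
  | nil => false
  | x :: _ => true
  | _ :: ?l' => nc_mem x l'
  end.
Ltac nc_vars U l t :=
  lazymatch t with
  | @GRing.add _ ?a ?b => let l1 := nc_vars U l a in nc_vars U l1 b
  | @GRing.opp _ ?a => nc_vars U l a
  | @GRing.mul _ ?a ?b => let l1 := nc_vars U l a in nc_vars U l1 b
  | @GRing.scale _ _ _ ?a => nc_vars U l a
  | @GRing.zero _ => l
  | @GRing.one _ => l
  | _ => lazymatch nc_mem t l with
         | true => l
         | false => constr:(@cons U t l)
         end
  end.
Ltac nc_reify K l t :=
  lazymatch t with
  | @GRing.add _ ?a ?b =>
      let x := nc_reify K l a in let y := nc_reify K l b in
      constr:(@NCadd K x y)
  | @GRing.opp _ ?a => let x := nc_reify K l a in constr:(@NCopp K x)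
  | @GRing.mul _ ?a ?b =>
      let x := nc_reify K l a in let y := nc_reify K l b in
      constr:(@NCmul K x y)
  | @GRing.scale _ _ ?k ?a =>
      let x := nc_reify K l a in constr:(@NCscale K k x)
  | @GRing.zero _ => constr:(@NC0 K)
  | @GRing.one _ => constr:(@NC1 K)
  | _ => let n := nc_find t l in constr:(@NCvar K n)
  end.
Ltac ncring_with K U T :=
  lazymatch goal with
  | |- @eq _ ?a ?b =>
      let l1 := nc_vars T (@nil T) a in
      let l := nc_vars T l1 b in
      let x := nc_reify K l a in
      let y := nc_reify K l b in
      refine (@nceval_eq K U l x y _);
      cbv [nccheck ncnorm ncapp ncmap ncprod nccoef nceqb fst snd Nat.eqb];
      repeat split; ring
  end.

(** * Linear identities over a module *)

Section LinearExpressions.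
Variables (K : comNzRingType) (V : lmodType K).

Inductive linexpr :=
  | Lvar of nat | L0 | Ladd of linexpr & linexpr | Lopp of linexpr
  | Lscale of K & linexpr.

Fixpoint lineval (env : seq V) (e : linexpr) : V :=
  match e with
  | Lvar i => nth 0 env i
  | L0 => 0
  | Ladd a b => lineval env a + lineval env b
  | Lopp a => - lineval env a
  | Lscale k a => k *: lineval env a
  end.

Fixpoint lincoef (i : nat) (e : linexpr) : K :=
  match e with
  | Lvar j => if Nat.eqb i j then 1 else 0
  | L0 => 0
  | Ladd a b => lincoef i a + lincoef i b
  | Lopp a => - lincoef i a
  | Lscale k a => k * lincoef i a
  end.

Fixpoint lincheck (n : nat) (e : linexpr) : Prop :=
  if n is n'.+1 then lincoef n' e = 0 /\ lincheck n' e else True.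

Lemma lineval_eq env e1 e2 :
  lincheck (size env) (Ladd e1 (Lopp e2)) -> lineval env e1 = lineval env e2.
Proof.
move=> h; apply/eqP; rewrite -subr_eq0; apply/eqP.
rewrite -[LHS]/(lineval env (Ladd e1 (Lopp e2))).
move: (Ladd _ _) h => e h.
have -> : lineval env e = \sum_(i < size env) lincoef i e *: nth 0 env i.
  elim: e {h} => [j||a IHa b IHb|a IH|k a IH] /=.
  - have E (i : nat) : (if Nat.eqb i j then 1 else 0 : K) = (i == j)%:R.
      by case: PeanoNat.Nat.eqb_spec => [->|/eqP/negPf ->] //; rewrite eqxx.
    under eq_bigr do rewrite E.
    have [jlt|jge] := ltnP j (size env).
      rewrite (bigD1 (Ordinal jlt)) //= eqxx scale1r big1 ?addr0// => i.
      by rewrite -val_eqE /= => /negPf ->; rewrite scale0r.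
    rewrite nth_default// big1// => i _.
    by rewrite (ltn_eqF (leq_trans (ltn_ord i) jge)) scale0r.
  - by rewrite big1// => i _; rewrite scale0r.
  - by rewrite IHa IHb -big_split; apply: eq_bigr => i _; rewrite scalerDl.
  - by rewrite IH -sumrN; apply: eq_bigr => i _; rewrite scaleNr.
  - by rewrite IH scaler_sumr; apply: eq_bigr => i _; rewrite scalerA.
have hk n : lincheck n e -> forall i, (i < n)%N -> lincoef i e = 0.
  elim: n => // n IH [h1 h2] i; rewrite ltnS leq_eqVlt => /orP[/eqP ->//|].
  exact: IH.
by rewrite big1// => i _; rewrite (hk _ h) // scale0r.
Qed.

End LinearExpressions.

Ltac lin_vars V l t :=
  lazymatch t with
  | @GRing.add _ ?a ?b => let l1 := lin_vars V l a in lin_vars V l1 b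
  | @GRing.opp _ ?a => lin_vars V l a
  | @GRing.scale _ _ _ ?a => lin_vars V l a
  | @GRing.zero _ => l
  | _ => lazymatch nc_mem t l with
         | true => l
         | false => constr:(@cons V t l)
         end
  end.
Ltac lin_reify K l t :=
  lazymatch t with
  | @GRing.add _ ?a ?b =>
      let x := lin_reify K l a in let y := lin_reify K l b in
      constr:(@Ladd K x y)
  | @GRing.opp _ ?a => let x := lin_reify K l a in constr:(@Lopp K x)
  | @GRing.scale _ _ ?k ?a =>
      let x := lin_reify K l a in constr:(@Lscale K k x)
  | @GRing.zero _ => constr:(@L0 K)
  | _ => let n := nc_find t l in constr:(@Lvar K n)
  end.
Ltac linring_with K V T :=
  lazymatch goal with
  | |- @eq _ ?a ?b =>
      let l1 := lin_vars T (@nil T) a in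
      let l := lin_vars T l1 b in
      let x := lin_reify K l a in
      let y := lin_reify K l b in
      refine (@lineval_eq K V l x y _);
      cbv [lincheck lincoef size Nat.eqb];
      repeat split; ring
  end.

Ltac ncring R U := ncring_with (R[i] : comNzRingType) U (U : Type).
Ltac linring R V := linring_with (R[i] : comNzRingType) V (V : Type).

(** * Real-valued norms and convergence of sequences *)

Section RealNorm.
Context {R : realType}.
Local Open Scope complex_scope.

(** Norms are complex numbers here; their real parts live in an ordered field, where [lra] and [nra]
    apply. *)
Definition cabs (k : R[i]) : R := complex.Re `|k|.

Lemma cabsE (k : R[i]) : `|k| = (cabs k)%:C.
Proof. by rewrite RRe_real// normr_real. Qed.

Lemma cabs_ge0 k : 0 <= cabs k.
Proof. by rewrite -ler0c -cabsE. Qed.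

Lemma cabsR (r : R) : cabs r%:C = `|r|.
Proof. by rewrite /cabs normc_def /= expr0n addr0 sqrtr_sqr. Qed.

Lemma cabsM k l : cabs (k * l) = cabs k * cabs l.
Proof. by apply: (@complexI R); rewrite rmorphM /= -!cabsE normrM. Qed.

Lemma cabsD k l : cabs (k + l) <= cabs k + cabs l.
Proof. by rewrite -lecR rmorphD /= -!cabsE ler_normD. Qed.

Lemma cabs0 : cabs 0 = 0.
Proof. by rewrite /cabs normr0. Qed.

Lemma cabs0_eq0 k : cabs k = 0 -> k = 0.
Proof. by move=> h; apply/normr0_eq0; rewrite cabsE h. Qed.

Lemma cabsJ (k : R[i]) : cabs (Num.conj k) = cabs k.
Proof. by rewrite /cabs norm_conjC. Qed.

Lemma cabsN (k : R[i]) : cabs (- k) = cabs k.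
Proof. by rewrite /cabs normrN. Qed.

Lemma normc_gt0E (e : R[i]) : 0 < e -> exists2 r : R, 0 < r & e = r%:C.
Proof.
by rewrite ltcE => /andP[/eqP/= h1 h2]; exists (complex.Re e) => //; case: e h1 h2 => a b /= ->.
Qed.

Lemma conjE (k : R[i]) : Num.conj k = (k^*)%C.
Proof. by []. Qed.

Lemma conjR (r : R) : Num.conj r%:C = r%:C :> R[i].
Proof. by rewrite conjE conjc_real. Qed.

Lemma conji : Num.conj ('i : R[i]) = - 'i.
Proof. exact: conjCi. Qed.

Section Norm.
Context {V : normedModType R[i]}.
Implicit Types x y : V.

Definition nrm (x : V) : R := complex.Re `|x|.

Lemma nrmE x : `|x| = (nrm x)%:C.
Proof. by rewrite RRe_real// normr_real. Qed.

Lemma nrm_ge0 x : 0 <= nrm x.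
Proof. by rewrite -ler0c -nrmE. Qed.

Lemma nrmD x y : nrm (x + y) <= nrm x + nrm y.
Proof. by rewrite -lecR rmorphD /= -!nrmE ler_normD. Qed.

Lemma nrmN x : nrm (- x) = nrm x.
Proof. by rewrite /nrm normrN. Qed.

Lemma nrmB x y : nrm (x - y) <= nrm x + nrm y.
Proof. by rewrite -(nrmN y) nrmD. Qed.

Lemma nrm_distC x y : nrm (x - y) = nrm (y - x).
Proof. by rewrite -nrmN opprB. Qed.

Lemma nrm_tri z x y : nrm (x - y) <= nrm (x - z) + nrm (z - y).
Proof. by rewrite (_ : x - y = (x - z) + (z - y)) ?nrmD// addrA subrK. Qed.

Lemma nrmZ (k : R[i]) x : nrm (k *: x) = cabs k * nrm x.
Proof. by apply: (@complexI R); rewrite rmorphM /= -!nrmE -cabsE normrZ. Qed.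

Lemma nrm0 : nrm (0 : V) = 0.
Proof. by rewrite /nrm normr0. Qed.

Lemma nrm0_eq0 x : nrm x = 0 -> x = 0.
Proof. by move=> h; apply/normr0_eq0; rewrite nrmE h. Qed.

Lemma nrm_small x : (forall e : R, 0 < e -> nrm x <= e) -> x = 0.
Proof.
move=> h; apply: nrm0_eq0; apply/eqP; rewrite eq_le nrm_ge0 andbT.
by apply/ler_addgt0Pr => e e0; rewrite add0r h.
Qed.

Lemma closure_nrm (S : set V) x :
  closure S x <-> forall e : R, 0 < e -> exists2 y, S y & nrm (x - y) <= e.
Proof.
split=> [cx e e0|h].
  have /(_ (ball_ Num.norm x e%:C)) [] := cx.
    by rewrite ball_normE; apply: nbhsx_ballx; rewrite ltcR.
  move=> y [Sy] /=; rewrite nrmE ltcR => xy; exists y => //; exact: ltW.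
move=> B /nbhs_ballP[e /normc_gt0E[r r0 ->]] hB.
have [|y Sy hy] := h (r / 2); first by rewrite divr_gt0.
exists y; split=> //; apply: hB; rewrite -ball_normE /= nrmE ltcR.
by apply: le_lt_trans hy _; rewrite ltr_pdivrMr// ltr_pMr// ltr1n.
Qed.

End Norm.

(** The function [N] is arbitrary: the same notion serves norms, moduli of scalars, the norm [unorm]
    of an algebra without topology, and seminorms. *)
Definition cvto (V : zmodType) (N : V -> R) (u : nat -> V) (l : V) :=
  forall e : R, 0 < e -> exists n0, forall n, (n0 <= n)%N -> N (u n - l) < e.

Definition cauchyto (V : zmodType) (N : V -> R) (u : nat -> V) :=
  forall e : R, 0 < e -> exists n0, forall m n, (n0 <= m)%N -> (n0 <= n)%N ->
    N (u m - u n) < e.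

Lemma cvto_cvg (V : normedModType R[i]) (u : nat -> V) l :
  u @ \oo --> l <-> cvto nrm u l.
Proof.
split=> [/cvgrPdist_lt h e e0|h].
  have := h e%:C; rewrite ltcR => /(_ e0) [n0 _ hn0]; exists n0 => n n0n.
  by have := hn0 n n0n; rewrite /= nrmE ltcR nrm_distC.
apply/cvgrPdist_lt => _ /normc_gt0E[e e0 ->].
have [n0 hn0] := h e e0; exists n0 => // n /= n0n.
by rewrite nrmE ltcR nrm_distC hn0.
Qed.

Lemma nrm_complete (V : completeNormedModType R[i]) (u : nat -> V) :
  cauchyto nrm u -> exists l, cvto nrm u l.
Proof.
move=> h; have : cvgn u.
  apply/cauchy_cvgP/cauchy_ballP => _ /normc_gt0E[e e0 ->].
  have [n0 hn0] := h e e0.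
  exists (u @` [set n | (n0 <= n)%N], u @` [set n | (n0 <= n)%N]).
    by split; exists n0 => // n hn; exists n.
  move=> [_ _] [/= [m hm <-] [n hn <-]]; rewrite -ball_normE /= nrmE ltcR.
  exact: hn0.
by move=> /cvg_ex[l /cvto_cvg ul]; exists l.
Qed.

Lemma cvto_cauchy (V : normedModType R[i]) (u : nat -> V) l :
  cvto nrm u l -> cauchyto nrm u.
Proof.
move=> h e e0; have [|n0 hn0] := h (e / 2); first by rewrite divr_gt0.
exists n0 => m n /hn0 hm /hn0 hn.
apply: le_lt_trans (nrm_tri l _ _) _.
rewrite [e]splitr ltrD// nrm_distC//.
Qed.

Lemma cvto_unique (V : normedModType R[i]) (u : nat -> V) l l' :
  cvto nrm u l -> cvto nrm u l' -> l = l'.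
Proof.
move=> h h'; apply/eqP; rewrite -subr_eq0; apply/eqP/nrm_small => e e0.
have e2 : 0 < e / 2 by rewrite divr_gt0.
have [n0 hn0] := h _ e2; have [n1 hn1] := h' _ e2.
have h1 := hn0 (maxn n0 n1) (leq_maxl _ _).
have h2 := hn1 (maxn n0 n1) (leq_maxr _ _).
apply: le_trans (nrm_tri (u (maxn n0 n1)) _ _) _.
by rewrite nrm_distC [e]splitr lerD// ltW.
Qed.

Lemma cvto_lim (V : completeNormedModType R[i]) (u : nat -> V) l :
  cvto nrm u l -> limn u = l.
Proof. by move/cvto_cvg; apply: cvg_lim. Qed.

Lemma nondecreasing_cauchy (r : nat -> R) M :
  (forall n, r n <= r n.+1) -> (forall n, r n <= M) ->
  forall e : R, 0 < e -> exists n0, forall m n, (n0 <= m)%N -> (m <= n)%N ->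
    r n - r m < e.
Proof.
move=> hr hM e e0.
have mono m n : (m <= n)%N -> r m <= r n.
  by move=> /subnK <-; elim: (n - m)%N => //= k IH; rewrite addSn (le_trans IH).
have hs : has_sup (range r).
  by split; [exists (r 0%N), 0%N | exists M => _ [n _ <-]].
have [_ [n0 _ <-] hn0] := sup_adherent e0 hs.
exists n0 => m n n0m mn; have h1 := mono _ _ n0m.
have h2 : r n <= sup (range r) by apply: ub_le_sup; [case: hs | exists n].
lra.
Qed.

End RealNorm.

(** * Unital C*-algebras and positivity without spectra *)

HB.mixin Record isUnitalCStar (R : realType) U of GRing.Algebra R[i] U := {
  ustar : U -> U;
  unorm : U -> R;
  ustarK : forall a, ustar (ustar a) = a;
  ustarP : forall (k : R[i]) a b,
    ustar (k *: a + b) = Num.conj k *: ustar a + ustar b;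
  ustarM : forall a b, ustar (a * b) = ustar b * ustar a;
  unormD : forall a b, unorm (a + b) <= unorm a + unorm b;
  unormZ : forall (k : R[i]) a, unorm (k *: a) = cabs k * unorm a;
  unorm0_eq0 : forall a, unorm a = 0 -> a = 0;
  unormM : forall a b, unorm (a * b) <= unorm a * unorm b;
  unorm_star : forall a, unorm (ustar a * a) = unorm a ^+ 2;
  unorm_complete : forall u : nat -> U,
    cauchyto unorm u -> exists l, cvto unorm u l
}.

#[short(type="ucstarType")]
HB.structure Definition UnitalCStar (R : realType) :=
  {U of isUnitalCStar R U & GRing.Algebra R[i] U}.

Section UnitalCStarTheory.
Context {R : realType} {U : ucstarType R}.
Local Open Scope complex_scope.
Implicit Types (x y z h a b c d k w : U) (r s t : R).

Definition selfadj x := ustar x = x.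

Lemma ustarD x y : ustar (x + y) = ustar x + ustar y.
Proof. by have := ustarP 1 x y; rewrite !scale1r rmorph1 scale1r. Qed.

Lemma ustar0 : ustar (0 : U) = 0.
Proof. by apply: (addrI (ustar 0)); rewrite -ustarD !addr0. Qed.

Lemma ustarZ (l : R[i]) x : ustar (l *: x) = Num.conj l *: ustar x.
Proof. by have := ustarP l x 0; rewrite ustar0 !addr0. Qed.

Lemma ustarZr r x : ustar (r%:C *: x) = r%:C *: ustar x.
Proof. by rewrite ustarZ conjR. Qed.

Lemma ustarN x : ustar (- x) = - ustar x.
Proof. by rewrite -scaleN1r ustarZ rmorphN1 scaleN1r. Qed.

Lemma ustarB x y : ustar (x - y) = ustar x - ustar y.
Proof. by rewrite ustarD ustarN. Qed.

Lemma ustar1 : ustar (1 : U) = 1.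
Proof. by have := ustarM (ustar 1 : U) 1; rewrite mulr1 ustarK mulr1 => <-. Qed.

Lemma selfadjD x y : selfadj x -> selfadj y -> selfadj (x + y).
Proof. by rewrite /selfadj ustarD => -> ->. Qed.

Lemma selfadjN x : selfadj x -> selfadj (- x).
Proof. by rewrite /selfadj ustarN => ->. Qed.

Lemma selfadjB x y : selfadj x -> selfadj y -> selfadj (x - y).
Proof. by rewrite /selfadj ustarB => -> ->. Qed.

Lemma selfadjZ r x : selfadj x -> selfadj (r%:C *: x).
Proof. by rewrite /selfadj ustarZr => ->. Qed.

Lemma selfadj1 : selfadj 1. Proof. exact: ustar1. Qed.

Lemma selfadjA r : selfadj (r%:C%:A).
Proof. exact/selfadjZ/selfadj1. Qed.

Lemma selfadj_starM x : selfadj (ustar x * x).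
Proof. by rewrite /selfadj ustarM ustarK. Qed.

Lemma selfadj_sq x : selfadj x -> selfadj (x * x).
Proof. by rewrite /selfadj ustarM => ->. Qed.

Lemma selfadjM x y : selfadj x -> selfadj y -> GRing.comm x y ->
  selfadj (x * y).
Proof. by rewrite /selfadj ustarM => -> -> ->. Qed.

Lemma unormZr r x : unorm (r%:C *: x) = `|r| * unorm x.
Proof. by rewrite unormZ cabsR. Qed.

Lemma unorm0 : unorm (0 : U) = 0.
Proof. by rewrite -(scale0r (0 : U)) unormZ cabs0 mul0r. Qed.

Lemma unormN x : unorm (- x) = unorm x.
Proof. by rewrite -scaleN1r unormZ cabsN -[1]/(1%:C) cabsR normr1 mul1r. Qed.

Lemma unorm_ge0 x : 0 <= unorm x.
Proof. by have := unormD x (- x); rewrite subrr unorm0 unormN; lra. Qed.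

Lemma unormB x y : unorm (x - y) <= unorm x + unorm y.
Proof. by rewrite -(unormN y) unormD. Qed.

Lemma unorm_distC x y : unorm (x - y) = unorm (y - x).
Proof. by rewrite -unormN opprB. Qed.

Lemma unorm_tri z x y : unorm (x - y) <= unorm (x - z) + unorm (z - y).
Proof. by rewrite (_ : x - y = (x - z) + (z - y)) ?unormD// addrA subrK. Qed.

Lemma unorm_le0 x : unorm x <= 0 -> x = 0.
Proof.
by move=> h; apply: unorm0_eq0; apply/eqP; rewrite eq_le unorm_ge0 andbT.
Qed.

Lemma unorm_small x : (forall e : R, 0 < e -> unorm x <= e) -> x = 0.
Proof.
by move=> h; apply: unorm_le0; apply/ler_addgt0Pr => e e0; rewrite add0r h.
Qed.

Lemma unormS x : unorm (ustar x) = unorm x.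
Proof.
suff h y : unorm y <= unorm (ustar y).
  by apply/eqP; rewrite eq_le h -{2}[x]ustarK h.
have h := unormM (ustar y) y; rewrite unorm_star in h.
have := unorm_ge0 y; rewrite le_eqVlt => /orP[/eqP<-|y0]; first exact: unorm_ge0.
by rewrite -(ler_pM2r y0) -expr2.
Qed.

Lemma unorm_sq x : selfadj x -> unorm (x * x) = unorm x ^+ 2.
Proof. by move=> h; rewrite -unorm_star h. Qed.

Lemma unorm1 : unorm (1 : U) = 1.
Proof.
have h : unorm (1 : U) != 0.
  by apply/eqP => /unorm0_eq0/eqP; rewrite oner_eq0.
apply: (mulfI h); rewrite mulr1 -expr2 -unorm_sq ?mulr1//; exact: selfadj1.
Qed.

Lemma unormA r : unorm (r%:C%:A : U) = `|r|.
Proof. by rewrite unormZr unorm1 mulr1. Qed.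

Lemma ucvto_le (u : nat -> U) l M : cvto unorm u l ->
  (forall n, unorm (u n) <= M) -> unorm l <= M.
Proof.
move=> ul h; apply/ler_addgt0Pr => e e0; have [n0 hn] := ul e e0.
have := hn n0 (leqnn _); have := h n0; have := unormD (l - u n0) (u n0).
by rewrite subrK unorm_distC; lra.
Qed.

Lemma commZ (l : R[i]) x y : GRing.comm x y -> GRing.comm x (l *: y).
Proof. by move=> h; rewrite /GRing.comm -scalerAl -scalerAr h. Qed.

Lemma commA (l : R[i]) x : GRing.comm x (l%:A).
Proof. exact/commZ/commr1. Qed.

Lemma comm_lim (u : nat -> U) l z : cvto unorm u l ->
  (forall n, GRing.comm z (u n)) -> GRing.comm z l.
Proof.
move=> ul h; apply/eqP; rewrite -subr_eq0; apply/eqP/unorm_small => e e0.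
pose M := unorm z + 1; have M0 : 0 < M by have := unorm_ge0 z; rewrite /M; lra.
have [n0 /(_ n0 (leqnn _)) hn] := ul (e / (2 * M)) ltac:(by rewrite divr_gt0// mulr_gt0).
have -> : z * l - l * z = (u n0 - l) * z - z * (u n0 - l).
  by rewrite mulrBl mulrBr (h n0); ncring R U.
rewrite ltr_pdivlMr ?mulr_gt0// in hn.
apply: le_trans (unormB _ _) _.
have := unormM (u n0 - l) z; have := unormM z (u n0 - l).
have := unorm_ge0 z; have := unorm_ge0 (u n0 - l); rewrite /M in hn; nra.
Qed.

(* The iteration [e <- (x + e^2) / 2] converges to [1 - sqrt (1 - x)] even when
   [unorm x = 1], since its increments are dominated by those of the same
   iteration for the real number [1]. *)
Lemma sqrt_one_sub x : selfadj x -> unorm x <= 1 ->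
  exists s : U, [/\ selfadj s, s * s = 1 - x, unorm (1 - s) <= 1 &
    forall z, GRing.comm z x -> GRing.comm z s].
Proof.
move=> sx x1.
pose e n := iter n (fun e : U => (2^-1)%:C *: (x + e * e)) 0.
pose r n := iter n (fun r : R => 2^-1 * (1 + r * r)) 0.
have rS n : r n.+1 = 2^-1 * (1 + r n * r n) by [].
have eS n : e n.+1 = (2^-1)%:C *: (x + e n * e n) by [].
have half0 : `|2^-1 : R| = 2^-1 by rewrite ger0_norm// invr_ge0.
have r01 n : 0 <= r n <= 1.
  by elim: n => [|n IH]; [rewrite lexx ler01 | rewrite rS; nra].
have rmono n : r n <= r n.+1 by have := sqr_ge0 (1 - r n); rewrite rS; nra.
have er n : unorm (e n) <= r n.
  elim: n => [|n IH]; first by rewrite unorm0.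
  rewrite eS rS unormZr half0 ler_pM2l ?invr_gt0//.
  apply: le_trans (unormD _ _) _; apply: lerD => //.
  apply: le_trans (unormM _ _) _; have := unorm_ge0 (e n); nra.
have ecomm z n : GRing.comm z x -> GRing.comm z (e n).
  move=> zx; elim: n => [|n IH]; first exact: commr0.
  by rewrite eS; apply/commZ/commrD => //; exact: commrM.
have eself n : selfadj (e n).
  elim: n => [|n IH]; first exact: ustar0.
  by rewrite eS; apply/selfadjZ/selfadjD => //; exact: selfadj_sq.
have einc n : unorm (e n.+1 - e n) <= r n.+1 - r n.
  elim: n => [|n IH].
    rewrite eS rS /= !mulr0 !addr0 !subr0 unormZr half0.
    by rewrite ler_pM2l ?invr_gt0.
  (* The iterates commute with each other because they commute with [x]; hence the difference of
     squares factors exactly as it does for [r]. *)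
  have ee : GRing.comm (e n) (e n.+1) by apply/ecomm/commr_sym/ecomm.
  have -> : e n.+2 - e n.+1 = (2^-1)%:C *: ((e n.+1 - e n) * (e n.+1 + e n)).
    rewrite (eS n.+1) [X in _ - X](eS n) mulrDr 2!mulrBl -{1}ee.
    by ncring R U.
  rewrite unormZr half0 rS {2}rS.
  have -> : 2^-1 * (1 + r n.+1 * r n.+1) - 2^-1 * (1 + r n * r n) =
     2^-1 * ((r n.+1 - r n) * (r n.+1 + r n)) by ring.
  rewrite ler_pM2l ?invr_gt0//; apply: le_trans (unormM _ _) _.
  apply: ler_pM => //; try exact: unorm_ge0.
  by apply: le_trans (unormD _ _) _; exact: lerD.
have edist m n : (m <= n)%N -> unorm (e n - e m) <= r n - r m.
  move=> /subnK <-; elim: (n - m)%N => [|k IH]; first by rewrite !subrr unorm0.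
  rewrite addSn; apply: le_trans (unorm_tri (e (k + m)%N) _ _) _.
  have := einc (k + m)%N; lra.
have ecauchy : cauchyto unorm e.
  move=> d d0.
  have [n0 hn0] := nondecreasing_cauchy rmono (fun n => proj2 (andP (r01 n))) d0.
  exists n0 => m n hm hn; have [mn|nm] := leqP m n.
    rewrite unorm_distC; apply: le_lt_trans (edist _ _ mn) _; exact: hn0.
  apply: le_lt_trans (edist _ _ (ltnW nm)) _; apply: hn0 => //; exact: ltnW.
have [l el] := unorm_complete e ecauchy.
have l1 : unorm l <= 1.
  by apply: (ucvto_le el) => n; apply: le_trans (er n) _; case/andP: (r01 n).
have lself : selfadj l.
  apply/eqP; rewrite -subr_eq0; apply/eqP/unorm_small => d d0.
  have [n0 /(_ n0 (leqnn _)) hn] := el (d / 2) ltac:(by rewrite divr_gt0).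
  have := unorm_tri (e n0) (ustar l) l.
  by rewrite -{1}(eself n0) -ustarB unormS (unorm_distC l); lra.
have lfix : l = (2^-1)%:C *: (x + l * l).
  apply/eqP; rewrite -subr_eq0; apply/eqP/unorm_small => d d0.
  have [n0 hn] := el (d / 2) ltac:(by rewrite divr_gt0).
  have h1 := hn _ (leqnn _); have h2 := hn _ (leqnSn _).
  apply: le_trans (unorm_tri (e n0.+1) _ _) _.
  rewrite unorm_distC {2}eS -scalerBr unormZr half0.
  have -> : x + e n0 * e n0 - (x + l * l) =
      e n0 * (e n0 - l) + (e n0 - l) * l by ncring R U.
  have := unormD (e n0 * (e n0 - l)) ((e n0 - l) * l).
  have := unormM (e n0) (e n0 - l); have := unormM (e n0 - l) l.
  have := unorm_ge0 (e n0 - l); have := unorm_ge0 (e n0); have := er n0.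
  by have /andP[] := r01 n0; nra.
exists (1 - l); split.
- by apply: selfadjB => //; exact: selfadj1.
- have -> : (1 - l) * (1 - l) = 1 - 2%:C *: l + l * l by ncring R U.
  rewrite {1}lfix scalerA -rmorphM /= divff ?pnatr_eq0// scale1r.
  by ncring R U.
- by rewrite opprB subrKC.
- move=> z zx; apply: commrB; first exact: commr1.
  by apply: (comm_lim el) => n; exact: ecomm.
Qed.

(** For self-adjoint [h] the inequality places the spectrum in [0, 2t]; this is positivity expressed
    by the norm alone. *)
Definition pos h :=
  selfadj h /\ exists2 t : R, 0 <= t & unorm (t%:C%:A - h) <= t.

Lemma pos_selfadj h : pos h -> selfadj h. Proof. by case. Qed.

Lemma pos0 : pos 0.
Proof. by split; [exact: ustar0 | exists 0 => //; rewrite scale0r subrr unorm0]. Qed.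

Lemma posD a b : pos a -> pos b -> pos (a + b).
Proof.
move=> [sa [s s0 hs]] [sb [t t0 ht]]; split; first exact: selfadjD.
exists (s + t); first exact: addr_ge0.
have -> : (s + t)%:C%:A - (a + b) = (s%:C%:A - a) + (t%:C%:A - b) by ncring R U.
by apply: le_trans (unormD _ _) (lerD hs ht).
Qed.

Lemma posZ r a : 0 <= r -> pos a -> pos (r%:C *: a).
Proof.
move=> r0 [sa [s s0 hs]]; split; first exact: selfadjZ.
exists (r * s); first exact: mulr_ge0.
have -> : (r * s)%:C%:A - r%:C *: a = r%:C *: (s%:C%:A - a) by ncring R U.
by rewrite unormZr ger0_norm// ler_wpM2l.
Qed.

Lemma pos_sub h t : selfadj h -> unorm h <= t -> pos (t%:C%:A - h).
Proof.
move=> sh ht; split; first by apply: selfadjB => //; exact: selfadjA.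
exists t; first exact: le_trans (unorm_ge0 h) ht.
by rewrite subKr.
Qed.

Lemma pos_scalar r : 0 <= r -> pos r%:C%:A.
Proof.
move=> r0; rewrite -[X in pos X]subr0; apply: pos_sub; first exact: ustar0.
by rewrite unorm0.
Qed.

Lemma pos_scalar_ge0 r : pos r%:C%:A -> 0 <= r.
Proof.
move=> [_ [t t0]]; rewrite -scalerBl -rmorphB unormA ler_norml; lra.
Qed.

(** Dividing by [t] puts [1 - h/t] in the unit ball, where [sqrt_one_sub] applies; its bound on
    [1 - s] is what makes the root positive. *)
Lemma pos_sqrt h : pos h ->
  exists c, [/\ selfadj c, c * c = h, pos c &
    forall z, GRing.comm z h -> GRing.comm z c].
Proof.
move=> [sh [t t0 ht]].
move: t0; rewrite le_eqVlt => /orP[/eqP t0|t0].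
  move: ht; rewrite -t0 scale0r sub0r unormN => /unorm_le0 ->.
  by exists 0; split; rewrite ?mulr0//; [exact: ustar0 | exact: pos0].
have ti0 : 0 <= t^-1 by rewrite invr_ge0 ltW.
have sx : selfadj (1 - t^-1%:C *: h).
  by apply: selfadjB; [exact: selfadj1 | exact: selfadjZ].
have x1 : unorm (1 - t^-1%:C *: h) <= 1.
  have -> : 1 - t^-1%:C *: h = t^-1%:C *: (t%:C%:A - h).
    by rewrite scalerBr scalerA -rmorphM /= mulVf ?gt_eqF// scale1r.
  by rewrite unormZr ger0_norm// ler_pdivrMl// mulr1.
have [s [ss sq s1 sc]] := sqrt_one_sub sx x1.
exists ((Num.sqrt t)%:C *: s); split.
- exact: selfadjZ.
- rewrite -scalerAl -scalerAr scalerA -rmorphM /= -expr2 sqr_sqrtr ?ltW// sq subKr.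
  by rewrite scalerA -rmorphM /= divff ?gt_eqF// scale1r.
- split; first exact: selfadjZ.
  exists (Num.sqrt t); first exact: sqrtr_ge0.
  rewrite -scalerBr unormZr ger0_norm ?sqrtr_ge0//.
  by rewrite -[leRHS]mulr1 ler_wpM2l ?sqrtr_ge0.
- move=> z zh; apply/commZ/sc/commrB; first exact: commr1.
  exact: commZ.
Qed.

Lemma unorm_cartesian a b : selfadj a -> selfadj b ->
  let u := a + 'i *: b in unorm a <= unorm u /\ unorm b <= unorm u.
Proof.
move=> sa sb u.
have su : ustar u = a - 'i *: b.
  by rewrite /u ustarD ustarZ sa sb conji scaleNr.
have half : `|2^-1 : R| = 2^-1 by rewrite ger0_norm// invr_ge0.
have h2 : (2^-1)%:C * (1 + 1) = 1 :> R[i].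
  by rewrite fmorphV rmorph_nat -[1 + 1]/(2%:R) mulVf ?pnatr_eq0.
split.
  have -> : a = (2^-1)%:C *: (u + ustar u).
    have -> : u + ustar u = (1 + 1) *: a by rewrite su /u; ncring R U.
    by rewrite scalerA h2 scale1r.
  by rewrite unormZr half; have := unormD u (ustar u); rewrite unormS; lra.
have -> : b = (2^-1)%:C *: (- 'i *: (u - ustar u)).
  have -> : u - ustar u = ((1 + 1) * 'i) *: b by rewrite su /u; ncring R U.
  rewrite !scalerA (_ : _ * _ = (2^-1)%:C * (1 + 1) * - 'i ^+ 2); last by ring.
  by rewrite sqrCi opprK mulr1 h2 scale1r.
rewrite unormZr half unormZ cabsN.
have -> : cabs ('i : R[i]) = 1 by rewrite /cabs normCi.
by have := unormB u (ustar u); rewrite unormS; lra.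
Qed.

Lemma unorm_cartesian_comm a b : selfadj a -> selfadj b -> GRing.comm a b ->
  unorm (a + 'i *: b) ^+ 2 = unorm (a * a + b * b).
Proof.
move=> sa sb ab; rewrite -unorm_star; congr unorm.
rewrite ustarD ustarZ sa sb conji.
have h (i : R[i]) : (a + - i *: b) * (a + i *: b) =
    a * a + (- i ^+ 2) *: (b * b) + i *: (a * b - b * a) by ncring R U.
by rewrite h sqrCi opprK scale1r ab subrr scaler0 addr0.
Qed.

(** After scaling to norm 1, [y + i s] with [s^2 = 1 - y^2] is unitary. Its imaginary part [s]
    therefore has norm at most 1, and [1 - y^2 = s^2] is the estimate that [pos] asks for. *)
Lemma pos_sq k : selfadj k -> pos (k * k).
Proof.
move=> sk; have := unorm_ge0 k; rewrite le_eqVlt => /orP[/eqP/esym/unorm0_eq0 ->|].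
  by rewrite mulr0; exact: pos0.
set M := unorm k => M0.
pose y := M^-1%:C *: k.
have sy : selfadj y by exact: selfadjZ.
have y1 : unorm y <= 1.
  by rewrite unormZr gtr0_norm ?invr_gt0// -/M mulVf ?gt_eqF.
have yy1 : unorm (y * y) <= 1.
  by apply: le_trans (unormM _ _) _; have := unorm_ge0 y; nra.
have [s [ss sq s1 sc]] := sqrt_one_sub (selfadj_sq sy) yy1.
have ys : GRing.comm y s by apply: sc; exact: commrM.
have h := unorm_cartesian_comm sy ss ys.
rewrite sq subrKC unorm1 in h.
have [_ hs] := unorm_cartesian sy ss.
have {}hs : unorm s <= 1.
  by apply: le_trans hs _; have := unorm_ge0 (y + 'i *: s); nra.
split; first exact: selfadj_sq.
exists (M * M); first by rewrite mulr_ge0// ltW.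
have -> : (M * M)%:C%:A - k * k = (M * M)%:C *: (s * s).
  rewrite sq /y -scalerAl -scalerAr !scalerBr !scalerA -!rmorphM /=.
  by rewrite mulfK ?gt_eqF// divff ?gt_eqF// scale1r.
rewrite unormZr ger0_norm ?mulr_ge0 ?(ltW M0)//.
rewrite -[leRHS]mulr1 ler_pM2l ?mulr_gt0//.
by apply: le_trans (unormM _ _) _; have := unorm_ge0 s; nra.
Qed.

(** The commuting roots [c] of [a] and [d] of [t - a] satisfy ||c + i d||^2 = ||c^2 + d^2|| = t, and
    the real part [c] is no larger than the element. *)
Lemma pos_le_unorm a t : pos a -> pos (t%:C%:A - a) -> unorm a <= t.
Proof.
move=> pa pta; have t0 : 0 <= t.
  by apply: pos_scalar_ge0; rewrite -[X in pos X](subrK a); exact: posD.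
have [c [sc cc _ hc]] := pos_sqrt pa.
have [d [sd dd _ hd]] := pos_sqrt pta.
have cd : GRing.comm c d.
  apply: hd; apply: commrB; first exact: commA.
  by apply: commr_sym; rewrite -cc; apply: commr_sym; exact: commrM.
have h := unorm_cartesian_comm sc sd cd.
rewrite cc dd subrKC unormA ger0_norm// in h.
have [h1 _] := unorm_cartesian sc sd.
rewrite -cc; apply: le_trans (unormM _ _) _.
by rewrite -h; have := unorm_ge0 c; nra.
Qed.

Lemma pos_mono a b : pos a -> pos (b - a) -> unorm a <= unorm b.
Proof.
move=> pa pba; apply: pos_le_unorm => //.
have sb : selfadj b.
  by rewrite -(subrK a b); apply: selfadjD; exact: pos_selfadj.
have -> : (unorm b)%:C%:A - a = ((unorm b)%:C%:A - b) + (b - a).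
  by rewrite addrA subrK.
by apply: posD => //; exact: pos_sub.
Qed.

(* Kaplansky's argument: for [h = x^*x], [d = |h| - h] and [y = x d], the element
   [y^*y = - d |h| d] is negative while [y y^*] is positive, whence [d = 0]. *)
Lemma pos_starM x : pos (ustar x * x).
Proof.
set h := ustar x * x.
have sh : selfadj h by exact: selfadj_starM.
have [p [sp pp posp hp]] := pos_sqrt (pos_sq sh).
have hpC : GRing.comm h p by apply: hp; exact: commrM.
have [c [sc cc _ hc]] := pos_sqrt posp.
pose d := p - h.
have sd : selfadj d by exact: selfadjB.
have dp : GRing.comm d p.
  by apply: commr_sym; apply: commrB => //; exact: commr_sym.
have dc := hc _ dp.
have hd : h * d = - (p * d).
  by rewrite /d !mulrBr pp -hpC; ncring R U.
pose y := x * d; pose k := c * d * (c * d).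
have scd : selfadj (c * d) by apply: selfadjM => //; exact: commr_sym.
have kE : k = d * p * d.
  by rewrite /k -{1}dc -cc !mulrA.
have yy : ustar y * y = - k.
  rewrite /y ustarM sd -mulrA (mulrA (ustar x)) -/h hd kE.
  by rewrite mulrN mulrA.
have pk : pos k by exact: pos_sq.
pose m := y * ustar y.
(* Writing [y = a + i b] gives [y y^* + y^*y = 2 a^2 + 2 b^2], and [k = - y^*y] is positive. *)
have pm : pos m.
  pose a := (2^-1)%:C *: (y + ustar y).
  pose b := (2^-1)%:C *: ('i *: (ustar y - y)).
  have sa : selfadj a by rewrite /selfadj ustarZr ustarD ustarK addrC.
  have sb : selfadj b.
    rewrite /selfadj ustarZr ustarZ ustarB ustarK conji scaleNr.
    by rewrite -scalerN opprB.
  suff -> : m = (2%:C *: (a * a) + 2%:C *: (b * b)) + k.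
    by apply: posD => //; apply: posD; apply: posZ => //; exact: pos_sq.
  have h2 : (2^-1)%:C = 2^-1 :> R[i] by rewrite fmorphV rmorph_nat.
  have h3 : 2%:C = 2 :> R[i] by rewrite rmorph_nat.
  have -> : k = - (ustar y * y) by rewrite yy opprK.
  rewrite /m /a /b -!scalerAl -!scalerAr !scalerA h2 h3.
  have -> : 2 * (2^-1 * 'i) * (2^-1 * 'i) = - 2^-1 :> R[i].
    have := sqrCi (R[i]); rewrite expr2 => i2.
    rewrite (_ : _ * _ = 2 * 2^-1 * 2^-1 * ('i * 'i)); last by ring.
    by rewrite i2 divff ?pnatr_eq0// mul1r mulrN1.
  rewrite divff ?pnatr_eq0// mul1r.
  have -> : (2^-1 : R[i]) *: ((y + ustar y) * (y + ustar y)) +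
      - 2^-1 *: ((ustar y - y) * (ustar y - y)) - ustar y * y =
      (2^-1 + 2^-1 : R[i]) *: (y * ustar y + ustar y * y) - ustar y * y.
    by ncring R U.
  by rewrite -[2^-1 + 2^-1]mulr2n -[2^-1 *+ 2]mulr_natr mulVf ?pnatr_eq0// scale1r addrK.
have [_ [s s0 hs]] := pm.
(* That [y^*y = - k] and [y y^* = m] cannot have opposite signs unless they vanish is read off
   norms: this identity yields ||k (s + k)|| <= s ||k||, and completing the square turns it into
   (||k|| + s/2)^2 <= s ||k|| + s^2/4, so [k = 0]. *)
have key : k * (s%:C%:A + k) = - (ustar y * (s%:C%:A - m) * y).
  have -> : ustar y * (s%:C%:A - m) * y =
     s%:C *: (ustar y * y) - ustar y * y * (ustar y * y).
    by rewrite /m; ncring R U.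
  by rewrite yy; ncring R U.
have kle : unorm (k * (s%:C%:A + k)) <= unorm k * s.
  rewrite key unormN; apply: le_trans (unormM _ _) _.
  apply: le_trans (ler_wpM2r (unorm_ge0 _) (unormM _ _)) _.
  rewrite unormS -[unorm k]unormN -yy unorm_star expr2 mulrAC.
  by rewrite ler_wpM2l// mulr_ge0// unorm_ge0.
have pks : pos (k + (s / 2)%:C%:A).
  by apply: posD => //; apply: pos_scalar; rewrite divr_ge0.
have kge : unorm k + s / 2 <= unorm (k + (s / 2)%:C%:A).
  rewrite -lerBrDr; apply: pos_le_unorm => //.
  have -> : (unorm (k + (s / 2)%:C%:A) - s / 2)%:C%:A - k =
     (unorm (k + (s / 2)%:C%:A))%:C%:A - (k + (s / 2)%:C%:A) by ncring R U.
  by apply: pos_sub => //; exact: pos_selfadj.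
have ksq : unorm (k + (s / 2)%:C%:A) ^+ 2 <= unorm k * s + s ^+ 2 / 4.
  rewrite -unorm_sq; last exact: pos_selfadj.
  have -> : (k + (s / 2)%:C%:A) * (k + (s / 2)%:C%:A) =
     k * (s%:C%:A + k) + (s ^+ 2 / 4)%:C%:A.
    have -> : s%:C = (s / 2)%:C + (s / 2)%:C :> R[i].
      by rewrite -rmorphD /= -splitr.
    have -> : (s ^+ 2 / 4)%:C = (s / 2)%:C * (s / 2)%:C :> R[i].
      by rewrite -rmorphM; congr (_%:C); field.
    by ncring R U.
  apply: le_trans (unormD _ _) _; apply: lerD => //.
  by rewrite unormA ger0_norm// divr_ge0// sqr_ge0.
have k0 : k = 0.
  apply: unorm_le0; have k0 := unorm_ge0 k.
  have h1 : (unorm k + s / 2) ^+ 2 <= unorm k * s + s ^+ 2 / 4.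
    by apply: le_trans ksq; nra.
  have -> : unorm k = 0; last by [].
  nra.
have cd0 : c * d = 0.
  by apply: unorm0_eq0; apply/eqP; rewrite -sqrf_eq0 -unorm_sq// -/k k0 unorm0.
have pd0 : p * d = 0 by rewrite -cc -mulrA cd0 mulr0.
have d0 : d = 0.
  apply: unorm0_eq0; apply/eqP; rewrite -sqrf_eq0 -unorm_sq//.
  by rewrite {1}/d mulrBl hd pd0 oppr0 subrr unorm0.
by have -> : h = p by apply/eqP; rewrite eq_sym -subr_eq0; apply/eqP.
Qed.

Lemma pos_mulstar x : pos (x * ustar x).
Proof. by rewrite -{1}[x]ustarK; exact: pos_starM. Qed.

Lemma pos_conj a z : pos a -> pos (ustar z * a * z).
Proof.
move=> /pos_sqrt[c [sc <- _ _]].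
have -> : ustar z * (c * c) * z = ustar (c * z) * (c * z).
  by rewrite ustarM sc !mulrA.
exact: pos_starM.
Qed.

Lemma pos_conj_selfadj a z : selfadj z -> pos a -> pos (z * a * z).
Proof. by move=> sz pa; rewrite -{1}sz; exact: pos_conj. Qed.

Lemma pos_pow w n : pos w -> pos (w ^+ n).
Proof.
move=> /pos_sqrt[g [sg <- _ _]].
have -> : (g * g) ^+ n = g ^+ n * g ^+ n.
  by rewrite exprMn_comm.
apply: pos_sq; elim: n => [|n IH]; first by rewrite expr0; exact: selfadj1.
rewrite exprS; apply: selfadjM => //; exact: commrX.
Qed.

Lemma selfadj_pow w n : selfadj w -> selfadj (w ^+ n).
Proof.
move=> sw; elim: n => [|n IH]; first by rewrite expr0; exact: selfadj1.
rewrite exprS; apply: selfadjM => //; exact: commrX.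
Qed.

Lemma unorm_pow_le1 w n : unorm w <= 1 -> unorm (w ^+ n) <= 1.
Proof.
move=> w1; elim: n => [|n IH]; first by rewrite expr0 unorm1.
rewrite exprS; apply: le_trans (unormM _ _) _.
by have := unorm_ge0 w; have := unorm_ge0 (w ^+ n); nra.
Qed.

Lemma unorm_sub1 h : pos h -> unorm h <= 1 -> unorm (1 - h) <= 1.
Proof.
move=> ph h1; have := pos_sub (pos_selfadj ph) h1; rewrite rmorph1 scale1r => pw.
by apply: pos_le_unorm => //; rewrite rmorph1 scale1r subKr.
Qed.

(** The scalar inequality n t (1 - t)^n <= 1 without functional calculus: with [w = 1 - h], the
    element [1 - w^n - n h w^n] is positive by induction, its increment being [(n + 1) h w^n h]. *)
Lemma unorm_mul_pow h n : pos h -> unorm h <= 1 ->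
  n%:R * unorm (h * (1 - h) ^+ n) <= 1.
Proof.
move=> ph h1; have sh := pos_selfadj ph; pose w := 1 - h.
have pw : pos w by have := pos_sub sh h1; rewrite rmorph1 scale1r.
have [c [sc cc _ hc]] := pos_sqrt ph.
have cw : GRing.comm c w.
  by apply: commrB; [exact: commr1 | rewrite -cc; exact: commrM].
have phw m : pos (h * w ^+ m).
  have -> : h * w ^+ m = c * w ^+ m * c.
    by rewrite -cc -!mulrA; congr (c * _); exact: commrX.
  by apply: pos_conj_selfadj => //; exact: pos_pow.
have Q m : pos (1 - w ^+ m - m%:R%:C *: (h * w ^+ m)).
  elim: m => [|m IH].
    by rewrite expr0 rmorph0 scale0r subr0 subrr; exact: pos0.
  have hw : GRing.comm h (w ^+ m).
    by apply: commrX; apply: commrB; [exact: commr1 | exact: commr_refl].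
  have -> : 1 - w ^+ m.+1 - m.+1%:R%:C *: (h * w ^+ m.+1) =
     (1 - w ^+ m - m%:R%:C *: (h * w ^+ m)) + m.+1%:R%:C *: (h * w ^+ m * h).
    have -> : m.+1%:R%:C = m%:R%:C + 1 :> R[i].
      by rewrite -natr1 rmorphD rmorph1.
    have wS : w ^+ m.+1 = w ^+ m - h * w ^+ m.
      by rewrite exprSr {2}/w mulrBr mulr1 hw.
    by rewrite wS -(mulrA h _ h) -hw; ncring R U.
  by apply: posD => //; apply: posZ; [exact: ler0n | apply: pos_conj_selfadj => //; exact: pos_pow].
have p1 : pos (1%:C%:A - n%:R%:C *: (h * w ^+ n)).
  rewrite rmorph1 scale1r -[X in pos X](subrK (w ^+ n)).
  by apply: posD; [rewrite addrAC; exact: Q | exact: pos_pow].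
have := pos_le_unorm (posZ (ler0n R n) (phw n)) p1.
by rewrite unormZr normr_nat.
Qed.

(** A substitute for the spectral projection of [b^*b] onto the values above [r^2]: [d] is twice the
    negative part of [k], and [c] is the root of [|k|]. Since [k d = - |k| d], compressing
    [b^*b = r^2 - k] by [d] gives [r^2 d^2] plus the square [(c d)^2], while [d + k = |k|]. *)
Lemma pos_cut b r : exists d c, let k := (r * r)%:C%:A - ustar b * b in
  [/\ selfadj d, selfadj (c * d),
      d * (ustar b * b) * d = (r * r)%:C *: (d * d) + c * d * (c * d),
      pos (d + k) & (d + k) * (d + k) = k * k].
Proof.
pose k := (r * r)%:C%:A - ustar b * b.
have sk : selfadj k.
  by apply: selfadjB; [exact: selfadjA | exact: selfadj_starM].
have [p [sp pp posp hp]] := pos_sqrt (pos_sq sk).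
have kp : GRing.comm k p by apply: hp; exact: commrM.
have [c [sc cc _ hc]] := pos_sqrt posp.
exists (p - k), c => /=; rewrite -/k.
have kE : k = (r * r)%:C%:A - ustar b * b by [].
clearbody k.
have sd : selfadj (p - k) by exact: selfadjB.
have dp : GRing.comm (p - k) p.
  by apply: commr_sym; apply: commrB => //; exact: commr_sym.
have dc := hc _ dp.
split; rewrite ?subrK//.
  by apply: selfadjM => //; exact: commr_sym.
have kd : k * (p - k) = - (p * (p - k)).
  by rewrite !mulrBr pp kp; ncring R U.
move: (p - k) sd dp dc kd => d sd dp dc kd.
have -> : c * d * (c * d) = d * (p * d).
  by rewrite -{1}dc -cc !mulrA.
have -> : ustar b * b = (r * r)%:C%:A - k by rewrite kE subKr.
rewrite -mulrA mulrBl kd.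
by ncring R U.
Qed.

End UnitalCStarTheory.

(** * Arithmetic in a C*-algebra without unit *)

Section CStarBasics.
Context {R : realType} {A : cstarType R}.
Implicit Types (a b c x : A) (k : R[i]).
Local Open Scope complex_scope.

Lemma amulDl a b c : amul (a + b) c = amul a c + amul b c.
Proof. by have := amulPl 1 a b c; rewrite !scale1r. Qed.

Lemma amulDr a b c : amul a (b + c) = amul a b + amul a c.
Proof. by have := amulPr 1 a b c; rewrite !scale1r. Qed.

Lemma amul0l a : amul 0 a = 0.
Proof. by apply: (addrI (amul 0 a)); rewrite -amulDl !addr0. Qed.

Lemma amul0r a : amul a 0 = 0.
Proof. by apply: (addrI (amul a 0)); rewrite -amulDr !addr0. Qed.

Lemma amulZl k a b : amul (k *: a) b = k *: amul a b.
Proof. by have := amulPl k a 0 b; rewrite amul0l !addr0. Qed.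

Lemma amulZr k a b : amul a (k *: b) = k *: amul a b.
Proof. by have := amulPr k a b 0; rewrite amul0r !addr0. Qed.

Lemma amulNl a b : amul (- a) b = - amul a b.
Proof. by rewrite -scaleN1r amulZl scaleN1r. Qed.

Lemma amulNr a b : amul a (- b) = - amul a b.
Proof. by rewrite -scaleN1r amulZr scaleN1r. Qed.

Lemma amulBl a b c : amul (a - b) c = amul a c - amul b c.
Proof. by rewrite amulDl amulNl. Qed.

Lemma amulBr a b c : amul a (b - c) = amul a b - amul a c.
Proof. by rewrite amulDr amulNr. Qed.

Lemma amul_suml (I : Type) (r : seq I) (P : pred I) (F : I -> A) b :
  amul (\sum_(i <- r | P i) F i) b = \sum_(i <- r | P i) amul (F i) b.
Proof. by apply: (big_morph (fun x => amul x b)) => [x y|]; rewrite ?amulDl ?amul0l. Qed.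

Lemma amul_sumr (I : Type) (r : seq I) (P : pred I) (F : I -> A) b :
  amul b (\sum_(i <- r | P i) F i) = \sum_(i <- r | P i) amul b (F i).
Proof. by apply: (big_morph (fun x => amul b x)) => [x y|]; rewrite ?amulDr ?amul0r. Qed.

Lemma astarD a b : astar (a + b) = astar a + astar b.
Proof. by have := astarP 1 a b; rewrite rmorph1 !scale1r. Qed.

Lemma astar0 : astar (0 : A) = 0.
Proof. by apply: (addrI (astar 0)); rewrite -astarD !addr0. Qed.

Lemma astarZ k a : astar (k *: a) = Num.conj k *: astar a.
Proof. by have := astarP k a 0; rewrite astar0 !addr0. Qed.

Lemma astarN a : astar (- a) = - astar a.
Proof. by rewrite -scaleN1r astarZ rmorphN1 scaleN1r. Qed.

Lemma astarB a b : astar (a - b) = astar a - astar b.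
Proof. by rewrite astarD astarN. Qed.

Lemma astar_sum (I : Type) (r : seq I) (P : pred I) (F : I -> A) :
  astar (\sum_(i <- r | P i) F i) = \sum_(i <- r | P i) astar (F i).
Proof. by apply: (big_morph (@astar R A)) => [x y|]; rewrite ?astarD ?astar0. Qed.

Lemma nrmM a b : nrm (amul a b) <= nrm a * nrm b.
Proof. by rewrite -lecR rmorphM /= -!nrmE anormM. Qed.

Lemma nrm_star a : nrm (amul (astar a) a) = nrm a ^+ 2.
Proof. by apply: (@complexI R); rewrite rmorphXn /= -!nrmE anorm_star. Qed.

Lemma nrmS a : nrm (astar a) = nrm a.
Proof.
suff h b : nrm b <= nrm (astar b).
  by apply/eqP; rewrite eq_le h -{2}[a]astarK h.
have h := nrmM (astar b) b; rewrite nrm_star in h.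
have := nrm_ge0 b; rewrite le_eqVlt => /orP[/eqP<-|b0]; first exact: nrm_ge0.
by rewrite -(ler_pM2r b0) -expr2.
Qed.

Lemma nrm_mulstar a : nrm (amul a (astar a)) = nrm a ^+ 2.
Proof. by rewrite -{1}[a]astarK nrm_star nrmS. Qed.

Lemma amul_star_eq0 a : amul (astar a) a = 0 -> a = 0.
Proof.
by move=> h; apply: nrm0_eq0; apply/eqP; rewrite -sqrf_eq0 -nrm_star h nrm0.
Qed.

Lemma amul_eq0 a : (forall x, amul a x = 0) -> a = 0.
Proof.
by move=> h; rewrite -[a]astarK (@amul_star_eq0 (astar a)) ?astar0// astarK h.
Qed.

End CStarBasics.

(** * Completeness of the complex numbers *)

Section ComplexComplete.
Context {R : realType}.
Local Open Scope complex_scope.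

Lemma real_complete (u : nat -> R) : cauchyto (fun x : R => `|x|) u ->
  exists l, cvto (fun x : R => `|x|) u l.
Proof.
move=> h; have : cvgn u.
  apply/cauchy_cvgP/cauchy_ballP => e e0; have [n0 hn0] := h e e0.
  exists (u @` [set n | (n0 <= n)%N], u @` [set n | (n0 <= n)%N]).
    by split; exists n0 => // n hn; exists n.
  by move=> [_ _] [/= [m hm <-] [n hn <-]]; rewrite -ball_normE /=; exact: hn0.
move=> /cvg_ex[l /cvgrPdist_lt hl]; exists l => e e0.
by have [n0 _ hn] := hl e e0; exists n0 => n n0n; rewrite distrC; exact: hn.
Qed.

Lemma Re_le_cabs (k : R[i]) : `|complex.Re k| <= cabs k.
Proof. by rewrite -lecR -cabsE normc_ge_Re. Qed.

Lemma Im_le_cabs (k : R[i]) : `|complex.Im k| <= cabs k.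
Proof.
have <- : cabs ('i * k) = cabs k.
  by rewrite cabsM /cabs normCi mul1r.
have -> : complex.Im k = - complex.Re ('i * k) by rewrite mulrC -complexiE ReiNIm opprK.
by rewrite normrN Re_le_cabs.
Qed.

Lemma cabs_le_ReIm (k : R[i]) : cabs k <= `|complex.Re k| + `|complex.Im k|.
Proof.
rewrite {1}[k]complexE; apply: le_trans (cabsD _ _) _.
have hi : cabs ('i%C : R[i]) = 1 by rewrite complexiE /cabs normCi.
by rewrite cabsM !cabsR hi mul1r.
Qed.

Lemma cabs_complete (u : nat -> R[i]) : cauchyto cabs u ->
  exists l, cvto cabs u l.
Proof.
move=> h.
have [a ha] : exists a, cvto (fun x : R => `|x|) (fun n => complex.Re (u n)) a.
  apply: real_complete => e e0; have [n0 hn] := h e e0; exists n0 => m n hm hn'.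
  apply: le_lt_trans (hn m n hm hn').
  by rewrite -raddfB Re_le_cabs.
have [b hb] : exists b, cvto (fun x : R => `|x|) (fun n => complex.Im (u n)) b.
  apply: real_complete => e e0; have [n0 hn] := h e e0; exists n0 => m n hm hn'.
  apply: le_lt_trans (hn m n hm hn').
  by rewrite -raddfB Im_le_cabs.
exists (a +i* b) => e e0.
have e2 : 0 < e / 2 by rewrite divr_gt0.
have [n0 hn0] := ha _ e2; have [n1 hn1] := hb _ e2.
exists (maxn n0 n1) => n; rewrite geq_max => /andP[h0 h1].
apply: le_lt_trans (cabs_le_ReIm _) _; rewrite !raddfB /= [e]splitr.
by apply: ltrD; [exact: hn0 | exact: hn1].
Qed.

End ComplexComplete.

(** * Unitization *)

(** A name of its own, so that the module structure of the product is copied but not its norm. *)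
Definition unitz (R : realType) (A : cstarType R) : Type := (A * R[i]^o)%type.

HB.instance Definition _ (R : realType) (A : cstarType R) :=
  GRing.Lmodule.copy (unitz A) (A * R[i]^o)%type.

Section Unitization.
Context {R : realType} {A : cstarType R}.
Local Open Scope complex_scope.
Local Notation U := (unitz A).
Implicit Types (z w : U) (a b x : A).

Definition unitz_mul z w : U :=
  (amul z.1 w.1 + z.2 *: w.1 + (w.2 : R[i]) *: z.1, (z.2 : R[i]) * w.2).
Definition unitz_one : U := (0, 1).
Definition unitz_star z : U := (astar z.1, Num.conj (z.2 : R[i])).
Definition unitz_act z x : A := amul z.1 x + (z.2 : R[i]) *: x.

Lemma unitz_mulA : associative unitz_mul.
Proof.
move=> [a k] [b l] [c m]; rewrite /unitz_mul /=; congr (_, _); last exact: mulrA.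
rewrite !amulDl !amulDr !amulZl !amulZr amulA.
by linring R A.
Qed.

Lemma unitz_mul1l : left_id unitz_one unitz_mul.
Proof.
by move=> [a k]; rewrite /unitz_mul /= amul0l scale1r scaler0 add0r addr0 mul1r.
Qed.

Lemma unitz_mul1r : right_id unitz_one unitz_mul.
Proof.
by move=> [a k]; rewrite /unitz_mul /= amul0r scale1r scaler0 !add0r mulr1.
Qed.

Lemma unitz_mulDl : left_distributive unitz_mul +%R.
Proof.
move=> [a k] [b l] [c m]; congr (_, _); last exact: mulrDl.
rewrite /= amulDl; by linring R A.
Qed.

Lemma unitz_mulDr : right_distributive unitz_mul +%R.
Proof.
move=> [a k] [b l] [c m]; congr (_, _); last exact: mulrDr.
rewrite /= amulDr; by linring R A.
Qed.

Lemma unitz_one_neq0 : unitz_one != 0.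
Proof. by apply/eqP => -[/eqP]; rewrite oner_eq0. Qed.

HB.instance Definition _ := GRing.Zmodule_isNzRing.Build U
  unitz_mulA unitz_mul1l unitz_mul1r unitz_mulDl unitz_mulDr unitz_one_neq0.

Lemma unitz_scalerAl (k : R[i]) z w : k *: (z * w) = (k *: z) * w.
Proof.
case: z w => [a l] [b m]; congr (_, _); last exact: mulrA.
change (k *: (amul a b + (l : R[i]) *: b + (m : R[i]) *: a) =
  amul (k *: a) b + (k * l) *: b + (m : R[i]) *: (k *: a)).
by rewrite amulZl; linring R A.
Qed.

HB.instance Definition _ := GRing.Lmodule_isLalgebra.Build R[i] U unitz_scalerAl.

Lemma unitz_scalerAr (k : R[i]) z w : k *: (z * w) = z * (k *: w).
Proof.
case: z w => [a l] [b m]; congr (_, _); last exact: mulrCA.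
change (k *: (amul a b + (l : R[i]) *: b + (m : R[i]) *: a) =
  amul a (k *: b) + (l : R[i]) *: (k *: b) + (k * m) *: a).
by rewrite amulZr; linring R A.
Qed.

HB.instance Definition _ := GRing.Lalgebra_isAlgebra.Build R[i] U unitz_scalerAr.

Lemma unitz_fstM z w : (z * w).1 = amul z.1 w.1 + (z.2 : R[i]) *: w.1 + (w.2 : R[i]) *: z.1.
Proof. by []. Qed.

Lemma unitz_sndM z w : (z * w).2 = (z.2 : R[i]) * w.2.
Proof. by []. Qed.

Lemma unitz_fstZ (k : R[i]) z : (k *: z).1 = k *: z.1. Proof. by []. Qed.

Lemma unitz_sndZ (k : R[i]) z : (k *: z).2 = k * (z.2 : R[i]). Proof. by []. Qed.

Lemma unitz_actD z w x : unitz_act (z + w) x = unitz_act z x + unitz_act w x.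
Proof. by rewrite /unitz_act /= amulDl; linring R A. Qed.

Lemma unitz_actZ (k : R[i]) z x : unitz_act (k *: z) x = k *: unitz_act z x.
Proof.
by rewrite /unitz_act unitz_fstZ unitz_sndZ amulZl scalerDr scalerA.
Qed.

Lemma unitz_actM z w x : unitz_act (z * w) x = unitz_act z (unitz_act w x).
Proof.
rewrite /unitz_act unitz_fstM unitz_sndM !amulDl !amulDr !amulZl !amulZr -amulA.
by linring R A.
Qed.

Lemma unitz_actP z x y : amul (astar (unitz_act z x)) y =
  amul (astar x) (unitz_act (unitz_star z) y).
Proof.
rewrite /unitz_act /= astarD astarM astarZ amulDl amulDr amulZl amulZr.
by rewrite -amulA.
Qed.

Definition unitz_opnorms z : set R :=
  [set nrm (unitz_act z x) | x in [set x | nrm x <= 1]].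

Definition unitz_opnorm z : R := sup (unitz_opnorms z).

(** If [A] has a unit [e], the nonzero element [(-e, 1)] acts on [A] by 0. Taking the maximum with
    the modulus of the scalar part, which is a character, restores definiteness and keeps the
    C*-identity. *)
Definition unitz_norm z : R := Num.max (unitz_opnorm z) (cabs (z.2 : R[i])).

Lemma unitz_act_le z x : nrm (unitz_act z x) <= (nrm z.1 + cabs (z.2 : R[i])) * nrm x.
Proof.
apply: le_trans (nrmD _ _) _; rewrite nrmZ mulrDl lerD//; exact: nrmM.
Qed.

Lemma unitz_opnorms_sup z : has_sup (unitz_opnorms z).
Proof.
split; first by exists (nrm (unitz_act z 0)), 0 => //=; rewrite nrm0 ler01.
exists (nrm z.1 + cabs (z.2 : R[i])) => _ [x /= x1 <-].
apply: le_trans (unitz_act_le _ _) _; rewrite -[leRHS]mulr1 ler_wpM2l//.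
by rewrite addr_ge0 ?nrm_ge0 ?cabs_ge0.
Qed.

Lemma unitz_opnorm_ge0 z : 0 <= unitz_opnorm z.
Proof.
apply: le_trans (nrm_ge0 (unitz_act z 0)) _.
apply: ub_le_sup; first by case: (unitz_opnorms_sup z).
by exists 0 => //=; rewrite nrm0 ler01.
Qed.

Lemma unitz_opnormP z x : nrm (unitz_act z x) <= unitz_opnorm z * nrm x.
Proof.
have [x0|x0] := eqVneq (nrm x) 0.
  by rewrite x0 mulr0 (le_trans (unitz_act_le _ _))// x0 mulr0.
have xp : 0 < nrm x by rewrite lt_neqAle eq_sym x0 nrm_ge0.
rewrite -ler_pdivrMr//.
apply: ub_le_sup; first by case: (unitz_opnorms_sup z).
exists ((nrm x)^-1%:C *: x) => /=.
  by rewrite nrmZ cabsR gtr0_norm ?invr_gt0// mulVf.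
have -> : unitz_act z ((nrm x)^-1%:C *: x) = (nrm x)^-1%:C *: unitz_act z x.
  by rewrite /unitz_act amulZr; linring R A.
by rewrite nrmZ cabsR gtr0_norm ?invr_gt0// mulrC.
Qed.

Lemma unitz_opnorm_le z M : 0 <= M ->
  (forall x, nrm (unitz_act z x) <= M * nrm x) -> unitz_opnorm z <= M.
Proof.
move=> M0 h; apply: ge_sup; first by case: (unitz_opnorms_sup z).
by move=> _ [x /= x1 <-]; apply: le_trans (h x) _; rewrite -[leRHS]mulr1 ler_wpM2l.
Qed.

(** Testing the action on [astar z.1] recovers ||z.1||^2 up to the scalar part. This gives both
    definiteness and completeness of the norm. *)
Lemma unitz_opnorm_fst z : nrm z.1 <= unitz_opnorm z + cabs (z.2 : R[i]).
Proof.
have h := unitz_opnormP z (astar z.1); rewrite nrmS in h.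
have h1 : nrm z.1 ^+ 2 <= (unitz_opnorm z + cabs (z.2 : R[i])) * nrm z.1.
  rewrite -nrm_mulstar.
  have -> : amul z.1 (astar z.1) = unitz_act z (astar z.1) - (z.2 : R[i]) *: astar z.1.
    by rewrite /unitz_act addrK.
  by apply: le_trans (nrmB _ _) _; rewrite nrmZ nrmS mulrDl lerD.
have := nrm_ge0 z.1; rewrite le_eqVlt => /orP[/eqP <-|z0].
  by rewrite addr_ge0 ?cabs_ge0 ?unitz_opnorm_ge0.
by rewrite -(ler_pM2r z0) -expr2.
Qed.

Lemma unitz_norm_ge z : unitz_opnorm z <= unitz_norm z /\ cabs (z.2 : R[i]) <= unitz_norm z.
Proof. by split; rewrite /unitz_norm le_max lexx ?orbT. Qed.

Lemma unitz_norm_ge0 z : 0 <= unitz_norm z.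
Proof. by have [h _] := unitz_norm_ge z; exact: le_trans (unitz_opnorm_ge0 z) h. Qed.

Lemma unitz_norm_le z M : (forall x, nrm (unitz_act z x) <= M * nrm x) ->
  cabs (z.2 : R[i]) <= M -> unitz_norm z <= M.
Proof.
move=> h1 h2; rewrite /unitz_norm ge_max h2 andbT.
by apply: unitz_opnorm_le => //; exact: le_trans (cabs_ge0 _) h2.
Qed.

Lemma unitz_normP z x : nrm (unitz_act z x) <= unitz_norm z * nrm x.
Proof.
apply: le_trans (unitz_opnormP _ _) _; rewrite ler_wpM2r ?nrm_ge0//.
by case: (unitz_norm_ge z).
Qed.

Lemma unitz_norm_le_add z : unitz_norm z <= nrm z.1 + cabs (z.2 : R[i]).
Proof.
apply: unitz_norm_le; first exact: unitz_act_le.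
by rewrite lerDr nrm_ge0.
Qed.

Lemma unitz_fst_le z : nrm z.1 <= 2 * unitz_norm z.
Proof.
have := unitz_opnorm_fst z; have [] := unitz_norm_ge z; lra.
Qed.

Lemma unitz_normD z w : unitz_norm (z + w) <= unitz_norm z + unitz_norm w.
Proof.
have [_ hz] := unitz_norm_ge z; have [_ hw] := unitz_norm_ge w.
apply: unitz_norm_le => [x|]; last first.
  by apply: le_trans (cabsD _ _) _; exact: lerD.
rewrite unitz_actD; apply: le_trans (nrmD _ _) _.
by rewrite mulrDl lerD// unitz_normP.
Qed.

Lemma unitz_normM z w : unitz_norm (z * w) <= unitz_norm z * unitz_norm w.
Proof.
have [_ hz] := unitz_norm_ge z; have [_ hw] := unitz_norm_ge w.
apply: unitz_norm_le => [x|]; last first.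
  by rewrite unitz_sndM cabsM ler_pM ?cabs_ge0.
rewrite unitz_actM; apply: le_trans (unitz_normP _ _) _.
by rewrite -mulrA ler_wpM2l ?unitz_norm_ge0// unitz_normP.
Qed.

Lemma unitz_normZ_le (k : R[i]) z : unitz_norm (k *: z) <= cabs k * unitz_norm z.
Proof.
apply: unitz_norm_le => [x|].
  by rewrite unitz_actZ nrmZ -mulrA ler_wpM2l ?cabs_ge0// unitz_normP.
rewrite unitz_sndZ cabsM ler_wpM2l ?cabs_ge0//.
by case: (unitz_norm_ge z).
Qed.

Lemma cabsV (k : R[i]) : cabs k^-1 = (cabs k)^-1.
Proof. by apply: (@complexI R); rewrite fmorphV -!cabsE normfV. Qed.

Lemma unitz_normZ (k : R[i]) z : unitz_norm (k *: z) = cabs k * unitz_norm z.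
Proof.
have [->|k0] := eqVneq k 0.
  rewrite cabs0 mul0r; apply/eqP; rewrite eq_le unitz_norm_ge0 andbT.
  by apply: le_trans (unitz_normZ_le _ _) _; rewrite cabs0 mul0r.
apply/eqP; rewrite eq_le unitz_normZ_le /=.
have ck : 0 < cabs k.
  by rewrite lt_neqAle cabs_ge0 andbT; apply: contra k0 => /eqP/esym/cabs0_eq0 ->.
have := unitz_normZ_le k^-1 (k *: z).
by rewrite scalerA mulVf// scale1r cabsV ler_pdivlMl.
Qed.

Lemma unitz_norm0_eq0 z : unitz_norm z = 0 -> z = 0.
Proof.
move=> h; have [_] := unitz_norm_ge z; have := unitz_fst_le z; rewrite h mulr0.
case: z {h} => a k /= ha hk.
have -> : a = 0 by apply: nrm0_eq0; apply/eqP; rewrite eq_le ha nrm_ge0.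
suff -> : k = 0 by [].
by apply: cabs0_eq0; apply/eqP; rewrite eq_le hk cabs_ge0.
Qed.

Lemma unitz_starM z w : unitz_star (z * w) = unitz_star w * unitz_star z.
Proof.
case: z w => [a k] [b l]; congr (_, _); last by rewrite /= mulrC -rmorphM.
change (astar (amul a b + (k : R[i]) *: b + (l : R[i]) *: a) =
  amul (astar b) (astar a) + Num.conj (l : R[i]) *: astar a + Num.conj (k : R[i]) *: astar b).
by rewrite !astarD astarM !astarZ addrAC.
Qed.

Lemma unitz_starK z : unitz_star (unitz_star z) = z.
Proof. by case: z => a k; rewrite /unitz_star /= astarK conjCK. Qed.

Lemma unitz_starP (k : R[i]) z w :
  unitz_star (k *: z + w) = Num.conj k *: unitz_star z + unitz_star w.
Proof.
case: z w => [a l] [b m]; congr (_, _); first exact: astarP.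
by rewrite /= rmorphD rmorphM.
Qed.

Lemma unitz_norm_sq_le z : unitz_norm z ^+ 2 <= unitz_norm (unitz_star z * z).
Proof.
set N := unitz_norm (unitz_star z * z).
have N0 : 0 <= N by exact: unitz_norm_ge0.
have h : unitz_norm z <= Num.sqrt N.
  apply: unitz_norm_le => [x|].
    rewrite -(@ler_pXn2r _ 2)// ?nnegrE ?mulr_ge0 ?sqrtr_ge0 ?nrm_ge0//.
    rewrite exprMn sqr_sqrtr// -nrm_star unitz_actP -unitz_actM.
    apply: le_trans (nrmM _ _) _; rewrite nrmS expr2 mulrCA.
    by rewrite ler_wpM2l ?nrm_ge0// unitz_normP.
  rewrite -(@ler_pXn2r _ 2)// ?nnegrE ?cabs_ge0 ?sqrtr_ge0//.
  rewrite sqr_sqrtr//; have [_] := unitz_norm_ge (unitz_star z * z).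
  by rewrite unitz_sndM /= cabsM cabsJ -expr2.
rewrite -(sqr_sqrtr N0) ler_pXn2r// nnegrE ?sqrtr_ge0 ?unitz_norm_ge0//.
Qed.

Lemma unitz_norm_star z : unitz_norm (unitz_star z * z) = unitz_norm z ^+ 2.
Proof.
apply/eqP; rewrite eq_le unitz_norm_sq_le andbT.
apply: le_trans (unitz_normM _ _) _; rewrite expr2 ler_wpM2r ?unitz_norm_ge0//.
have h := le_trans (unitz_norm_sq_le (unitz_star z)) (unitz_normM _ _).
rewrite unitz_starK in h.
have := unitz_norm_ge0 (unitz_star z).
rewrite le_eqVlt => /orP[/eqP<-|z0]; first exact: unitz_norm_ge0.
by rewrite -(ler_pM2r z0) -expr2.
Qed.

Lemma unitz_complete (u : nat -> U) :
  cauchyto unitz_norm u -> exists l, cvto unitz_norm u l.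
Proof.
move=> h.
have [a ha] : exists a, cvto nrm (fun n => (u n).1) a.
  apply: nrm_complete => e e0.
  have [n0 hn] := h (e / 2) ltac:(by rewrite divr_gt0); exists n0 => m n hm hn'.
  by have := unitz_fst_le (u m - u n); have := hn m n hm hn'; rewrite /=; lra.
have [k hk] : exists k, cvto cabs (fun n => (u n).2 : R[i]) k.
  apply: cabs_complete => e e0; have [n0 hn] := h e e0; exists n0 => m n hm hn'.
  have [_ h1] := unitz_norm_ge (u m - u n).
  by apply: le_lt_trans (hn m n hm hn').
exists (a, k) => e e0.
have e2 : 0 < e / 2 by rewrite divr_gt0.
have [n0 hn0] := ha _ e2; have [n1 hn1] := hk _ e2.
exists (maxn n0 n1) => n; rewrite geq_max => /andP[h0 h1].
apply: le_lt_trans (unitz_norm_le_add _) _; rewrite [e]splitr.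
by apply: ltrD; [exact: hn0 | exact: hn1].
Qed.

HB.instance Definition _ := isUnitalCStar.Build R U unitz_starK unitz_starP
  unitz_starM unitz_normD unitz_normZ unitz_norm0_eq0 unitz_normM
  unitz_norm_star unitz_complete.

End Unitization.

Section UnitizationInterface.
Context {R : realType}.
Local Open Scope complex_scope.

(* The unitization is used only through this interface: keeping the concrete
   construction opaque prevents the conversion algorithm from unfolding it. *)
Record unitization (A : cstarType R) := Unitization {
  uz : ucstarType R;
  iota : A -> uz;
  uchi : uz -> R[i];
  iotaP : forall (k : R[i]) a b, iota (k *: a + b) = k *: iota a + iota b;
  iotaM : forall a b, iota (amul a b) = iota a * iota b;
  iotaS : forall a, iota (astar a) = ustar (iota a);
  unorm_iota : forall a, unorm (iota a) = nrm a;
  uchiP : forall (k : R[i]) z w, uchi (k *: z + w) = k * uchi z + uchi w;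
  uchiM : forall z w, uchi (z * w) = uchi z * uchi w;
  uchi1 : uchi 1 = 1;
  uchiS : forall z, uchi (ustar z) = Num.conj (uchi z);
  uchi_le : forall z, cabs (uchi z) <= unorm z;
  uchi_iota : forall a, uchi (iota a) = 0;
  uchi0 : forall z, uchi z = 0 -> exists a, z = iota a
}.

Lemma unitz_eq (A : cstarType R) (z w : unitz A) : z.1 = w.1 -> z.2 = w.2 -> z = w.
Proof. by case: z w => [a k] [b l] /= -> ->. Qed.

Definition unitization_of (A : cstarType R) : unitization A.
Proof.
apply: (@Unitization A (unitz A) (fun a => (a, 0) : unitz A) (fun z => z.2)) => //.
- move=> k a b; apply: unitz_eq => //.
  by change (0 = k * 0 + 0 :> R[i]); rewrite mulr0 addr0.
- move=> a b; apply: unitz_eq; last by change (0 = 0 * 0 :> R[i]); rewrite mulr0.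
  change (amul a b = amul a b + (0 : R[i]) *: b + (0 : R[i]) *: a).
  by rewrite !scale0r !addr0.
- by move=> a; apply: unitz_eq; rewrite //= conjC0.
- move=> a; apply/eqP; rewrite eq_le; apply/andP; split.
    by apply: le_trans (unitz_norm_le_add _) _; rewrite /= cabs0 addr0.
  have := unitz_opnorm_fst ((a, 0) : unitz A); rewrite /= cabs0 addr0 => h.
  by apply: le_trans h _; case: (unitz_norm_ge ((a, 0) : unitz A)).
- by move=> z; case: (unitz_norm_ge z).
- by move=> [a k] /= ->; exists a.
Qed.

End UnitizationInterface.

(** * Positivity and approximate units in a C*-algebra *)

Section CStarPositivity.
Context {R : realType} {A : cstarType R}.
Local Open Scope complex_scope.
Local Notation U := (uz (unitization_of A)).
Local Notation iota := (iota (unitization_of A)).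
Local Notation uchi := (@uchi _ _ (unitization_of A)).
Implicit Types (a b c x d e : A) (z w : U) (r s t : R).

Lemma iotaD a b : iota (a + b) = iota a + iota b.
Proof. by have := iotaP (unitization_of A) 1 a b; rewrite !scale1r. Qed.

Lemma iota0 : iota 0 = 0.
Proof. by apply: (addrI (iota 0)); rewrite -iotaD !addr0. Qed.

Lemma iotaZ (k : R[i]) a : iota (k *: a) = k *: iota a.
Proof. by have := iotaP (unitization_of A) k a 0; rewrite iota0 !addr0. Qed.

Lemma iotaN a : iota (- a) = - iota a.
Proof. by rewrite -scaleN1r iotaZ scaleN1r. Qed.

Lemma iotaB a b : iota (a - b) = iota a - iota b.
Proof. by rewrite iotaD iotaN. Qed.

Lemma iota_inj a b : iota a = iota b -> a = b.
Proof.
move=> h; apply/eqP; rewrite -subr_eq0; apply/eqP/nrm0_eq0.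
by rewrite -(unorm_iota (unitization_of A)) iotaB h subrr unorm0.
Qed.

Lemma uchiD z w : uchi (z + w) = uchi z + uchi w.
Proof. by have := uchiP 1 z w; rewrite scale1r mul1r. Qed.

Lemma uchi00 : uchi 0 = 0.
Proof. by apply: (addrI (uchi 0)); rewrite -uchiD !addr0. Qed.

Lemma uchiZ (k : R[i]) z : uchi (k *: z) = k * uchi z.
Proof. by have := uchiP k z 0; rewrite uchi00 !addr0. Qed.

Lemma uchiA (k : R[i]) : uchi (k%:A) = k.
Proof. by rewrite uchiZ uchi1 mulr1. Qed.

Lemma uchiB z w : uchi (z - w) = uchi z - uchi w.
Proof. by rewrite uchiD -scaleN1r uchiZ mulN1r. Qed.

Lemma selfadj_uchi z : selfadj z -> exists r, uchi z = r%:C.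
Proof.
move=> sz; exists (complex.Re (uchi z)).
by rewrite RRe_real//; apply/CrealP; rewrite -uchiS sz.
Qed.

Lemma pos_uchi z : pos z -> exists2 r, 0 <= r & uchi z = r%:C.
Proof.
move=> [/selfadj_uchi[r zr] [t t0 ht]]; exists r => //.
have := le_trans (uchi_le _) ht.
by rewrite uchiB uchiA zr -rmorphB cabsR ler_norml; lra.
Qed.

Definition posA a := pos (iota a).

Lemma posA0 : posA 0. Proof. by rewrite /posA iota0; exact: pos0. Qed.

Lemma posAD a b : posA a -> posA b -> posA (a + b).
Proof. by rewrite /posA iotaD; exact: posD. Qed.

Lemma posAZ r a : 0 <= r -> posA a -> posA (r%:C *: a).
Proof. by rewrite /posA iotaZ; exact: posZ. Qed.

Lemma posA_starM a : posA (amul (astar a) a).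
Proof. by rewrite /posA iotaM iotaS; exact: pos_starM. Qed.

Lemma posA_mulstar a : posA (amul a (astar a)).
Proof. by rewrite /posA iotaM iotaS; exact: pos_mulstar. Qed.

Lemma posA_sum (I : Type) (r : seq I) (P : pred I) (F : I -> A) :
  (forall i, P i -> posA (F i)) -> posA (\sum_(i <- r | P i) F i).
Proof. by move=> h; apply: big_ind; [exact: posA0 | exact: posAD | exact: h]. Qed.

Lemma posA_mono a b : posA a -> posA (b - a) -> nrm a <= nrm b.
Proof. by rewrite /posA iotaB -!(unorm_iota (unitization_of A)); exact: pos_mono. Qed.

Lemma posA_mono_add a b : posA a -> posA b -> nrm a <= nrm (a + b).
Proof. by move=> pa pb; apply: (posA_mono pa); rewrite addrAC subrr add0r. Qed.

Lemma nrm_add_starM a b :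
  nrm (amul (astar a) a) <= nrm (amul (astar a) a + amul (astar b) b).
Proof. by apply: posA_mono_add; exact: posA_starM. Qed.

Lemma posA_mul_le a b t : nrm a <= t ->
  posA ((t * t)%:C *: amul (astar b) b - amul (astar (amul a b)) (amul a b)).
Proof.
move=> at'; have h : pos ((t * t)%:C%:A - iota (amul (astar a) a)).
  apply: pos_sub; first by rewrite iotaM iotaS; exact: selfadj_starM.
  by rewrite unorm_iota nrm_star; have := nrm_ge0 a; nra.
have := pos_conj (iota b) h; rewrite /posA.
suff -> : iota ((t * t)%:C *: amul (astar b) b - amul (astar (amul a b)) (amul a b)) =
  ustar (iota b) * ((t * t)%:C%:A - iota (amul (astar a) a)) * iota b by [].
by rewrite astarM !(iotaB, iotaM, iotaZ, iotaS); ncring R (uz (unitization_of A)).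
Qed.

(** Take [e = 1 - s] with [s^2 = 1 - b^*b] in the unitization. The character of [s] squares to 1,
    and [unorm (1 - s) <= 1] excludes the value -1, so [e] lies in [A]. Thus [1 - b^*b = (1 - e)^2]
    becomes available inside [A]. *)
Lemma sqrt_defect b : nrm b <= 1 ->
  exists2 e, astar e = e & amul (astar b) b = e + e - amul e e.
Proof.
move=> b1; have sb : selfadj (iota (amul (astar b) b)).
  by rewrite iotaM iotaS; exact: selfadj_starM.
have nb : unorm (iota (amul (astar b) b)) <= 1.
  by rewrite unorm_iota nrm_star; have := nrm_ge0 b; nra.
have [s [ss sq s1 _]] := sqrt_one_sub sb nb.
have [r hr] := selfadj_uchi ss.
have r1 : r = 1.
  have : uchi (s * s) = 1 by rewrite sq uchiB uchi1 uchi_iota subr0.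
  rewrite uchiM hr -rmorphM => /(@complexI R _ 1) rr.
  have := le_trans (uchi_le (1 - s)) s1; rewrite uchiB uchi1 hr.
  have -> : 1 - r%:C = (1 - r)%:C by rewrite rmorphB.
  rewrite cabsR ler_norml => /andP[h1 h2].
  have /eqP : (r - 1) * (r + 1) = 0 by rewrite mulrBl mulrDr !mulr1 rr mul1r; ring.
  by rewrite mulf_eq0 => /orP[/eqP|/eqP]; lra.
have /uchi0[e es] : uchi (1 - s) = 0 by rewrite uchiB uchi1 hr r1 subrr.
exists e; apply: iota_inj.
  by rewrite iotaS -es ustarB ss ustar1.
have -> : iota (amul (astar b) b) = 1 - s * s by rewrite sq subKr.
by rewrite iotaB iotaD iotaM -es; ncring R (uz (unitization_of A)).
Qed.

Lemma iota_pow_one_sub a n : exists w : A, (1 - iota a) ^+ n = 1 - iota w.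
Proof.
elim: n => [|n [w IH]]; first by exists 0; rewrite expr0 iota0 subr0.
exists (a + w - amul a w); rewrite exprS IH iotaB iotaD iotaM.
by ncring R (uz (unitization_of A)).
Qed.

Lemma unorm_mul_pow2 (h : U) n : pos h -> unorm h <= 1 -> forall (k : nat),
  (n > 0)%N -> unorm ((1 - h) ^+ k * (h * (1 - h) ^+ n)) <= n%:R^-1.
Proof.
move=> ph h1 k n0; apply: le_trans (unormM _ _) _.
have := unorm_mul_pow n ph h1; rewrite -ler_pdivlMl ?ltr0n// mulr1 => h2.
have := unorm_pow_le1 k (unorm_sub1 ph h1).
have := unorm_ge0 (h * (1 - h) ^+ n); have := unorm_ge0 ((1 - h) ^+ k); nra.
Qed.

Lemma exists_small_inv (e M : R) : 0 < e -> 0 <= M ->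
  exists2 n : nat, (n > 0)%N & M * n%:R^-1 <= e.
Proof.
move=> e0 M0; exists (Num.truncn (M / e)).+1 => //.
rewrite ler_pdivrMr ?ltr0n// mulrC -ler_pdivrMr//.
exact/ltW/truncnS_gt.
Qed.

(** With [h] the sum of the [b b^*] over [F] and [h0 = h / M], take [e = 1 - w] for
    [w = (1 - h0)^n]. Then ||e b - b||^2 = ||w b b^* w|| <= ||w h w|| = M ||w h0 w|| <= M / n, and
    [n] is chosen so that this is at most [eps^2]. *)
Lemma approx_unit (F : seq A) (eps : R) : 0 < eps -> exists e,
  [/\ astar e = e, nrm e <= 1 & forall b, b \in F -> nrm (amul e b - b) <= eps].
Proof.
move=> eps0; pose h := \sum_(b <- F) amul b (astar b).
have ph : posA h by apply: posA_sum => b _; exact: posA_mulstar.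
pose M := nrm h + 1; have M0 : 0 < M by have := nrm_ge0 h; rewrite /M; lra.
pose h0 := M^-1%:C *: h.
have ph0 : posA h0 by apply: posAZ => //; rewrite invr_ge0 ltW.
have h01 : unorm (iota h0) <= 1.
  rewrite unorm_iota nrmZ cabsR gtr0_norm ?invr_gt0// ler_pdivrMl// mulr1 /M.
  lra.
have [n n0 hn] := exists_small_inv (mulr_gt0 eps0 eps0) (ltW M0).
have [e he] := iota_pow_one_sub h0 n.
have pw : pos (1 - iota h0).
  by have := pos_sub (pos_selfadj ph0) h01; rewrite rmorph1 scale1r.
have sw : selfadj ((1 - iota h0) ^+ n) by exact/selfadj_pow/pos_selfadj.
have eE : iota e = 1 - (1 - iota h0) ^+ n by rewrite he subKr.
exists e; split.
- apply: iota_inj; rewrite iotaS eE; exact: selfadjB selfadj1 sw.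
- rewrite -(unorm_iota (unitization_of A)) eE.
  apply: pos_le_unorm.
    have : unorm ((1 - iota h0) ^+ n) <= 1.
      exact/unorm_pow_le1/unorm_sub1.
    by move/(pos_sub sw); rewrite rmorph1 scale1r.
  by rewrite rmorph1 scale1r subKr; exact: pos_pow.
- move=> b bF; have eps0' := ltW eps0; rewrite -(@ler_pXn2r _ 2)// ?nnegrE ?nrm_ge0//.
  rewrite -nrm_mulstar -(unorm_iota (unitization_of A)) iotaM iotaS iotaB iotaM eE.
  set w := (1 - iota h0) ^+ n in sw *.
  have -> : ((1 - w) * iota b - iota b) * ustar ((1 - w) * iota b - iota b) =
     w * (iota (amul b (astar b))) * w.
    have -> : (1 - w) * iota b - iota b = - (w * iota b) by ncring R (uz (unitization_of A)).
    rewrite ustarN ustarM sw iotaM iotaS; ncring R (uz (unitization_of A)).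
  have le : unorm (w * iota (amul b (astar b)) * w) <= unorm (w * iota h * w).
    apply: pos_mono.
      by apply: pos_conj_selfadj => //; exact: posA_mulstar.
    have -> : w * iota h * w - w * iota (amul b (astar b)) * w =
      w * iota (h - amul b (astar b)) * w by rewrite iotaB; ncring R (uz (unitization_of A)).
    apply: pos_conj_selfadj => //.
    rewrite /h (big_rem b)//= addrAC subrr add0r.
    by apply: posA_sum => c _; exact: posA_mulstar.
  apply: le_trans le _.
  have -> : iota h = M%:C *: iota h0.
    by rewrite /h0 iotaZ scalerA -rmorphM /= divff ?gt_eqF// scale1r.
  rewrite -scalerAr -scalerAl unormZr gtr0_norm// expr2.
  apply: le_trans hn; rewrite ler_pM2l// -mulrA.
  exact: unorm_mul_pow2.
Qed.

Lemma approx_unit2 (F : seq A) (eps : R) : 0 < eps -> exists e,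
  [/\ astar e = e, nrm e <= 1 &
    forall b, b \in F -> nrm (amul e b - b) <= eps /\ nrm (amul b e - b) <= eps].
Proof.
move=> e0; have [e [se e1 he]] := approx_unit (F ++ map (@astar R A) F) e0.
exists e; split=> // b bF; split; first by apply: he; rewrite mem_cat bF.
rewrite -nrmS astarB astarM se; apply: he.
by rewrite mem_cat map_f ?orbT.
Qed.

(* With [k = r^2 - b^*b], the element [d] is [|k| - k]. *)
Lemma cut b r : exists d e,
  [/\ astar d = d, astar e = e,
     amul d (amul (amul (astar b) b) d) = (r * r)%:C *: amul d d + amul e e &
     pos (iota d + ((r * r)%:C%:A - iota (amul (astar b) b)))].
Proof.
have [d [c /= [sd scd hd pd hk]]] := pos_cut (iota b) r.
rewrite -iotaS -iotaM in hd pd hk.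
(* The character takes the value [r^2] on [k] and, [|k|] being positive with the same square, also
   on [|k| = d + k]. Hence [d] comes from the algebra itself. *)
have d0 : uchi d = 0.
  have [s s0 hs] := pos_uchi pd.
  have e1 : uchi d + (r * r)%:C = s%:C.
    by rewrite -hs uchiD uchiB uchiA uchi_iota subr0.
  have := congr1 uchi hk; rewrite !uchiM hs uchiB uchiA uchi_iota subr0.
  rewrite -!rmorphM => /(@complexI R) ss.
  have {}ss : s = r * r.
    apply/eqP; rewrite -(@eqrXn2 _ 2)// ?expr2 ?ss//.
    by rewrite -expr2 sqr_ge0.
  by apply: (addIr (r * r)%:C); rewrite e1 ss add0r.
have [d' dE] := uchi0 d0.
have /uchi0[e' eE] : uchi (c * d) = 0 by rewrite uchiM d0 mulr0.
exists d', e'; split.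
- by apply: iota_inj; rewrite iotaS -dE.
- by apply: iota_inj; rewrite iotaS -eE.
- by apply: iota_inj; rewrite !(iotaD, iotaM, iotaZ) -dE -eE -hd iotaM mulrA.
- by rewrite -dE.
Qed.

Lemma nrm_cut0 b r : 0 <= r -> pos ((r * r)%:C%:A - iota (amul (astar b) b)) ->
  nrm b <= r.
Proof.
move=> r0 h; have := pos_le_unorm (posA_starM b) h.
by rewrite unorm_iota nrm_star expr2; have := nrm_ge0 b; nra.
Qed.

(** If [b^*b <= t + i] with [i] in [J], then [b] has norm about sqrt(t) modulo [b J]. With
    [j = i^2 / M] and [g = (1 - j)^n = 1 - w], the factor [g] almost annihilates [i], since ||i
    g||^2 = M ||g j g|| <= M / n; so ||b g||^2 <= ||g (t + i) g|| <= t + eps. It is applied to the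
    kernel of a homomorphism and to a closed ideal, in place of a quotient norm. *)
Lemma quot_bound (J : set A) b i t (eps : R) :
  J 0 -> (forall x y, J x -> J y -> J (x + y)) ->
  (forall (k : R[i]) x, J x -> J (k *: x)) ->
  (forall x y, J x -> J y -> J (amul x y)) ->
  J i -> astar i = i -> 0 <= t -> 0 < eps ->
  pos (t%:C%:A + iota i - iota (amul (astar b) b)) ->
  exists2 w : A, J w & nrm (b - amul b w) ^+ 2 <= t + eps.
Proof.
move=> J0 JD JZ JM Ji si t0 eps0 hp.
pose M := nrm i ^+ 2 + 1.
have M0 : 0 < M by have := sqr_ge0 (nrm i); rewrite /M; lra.
pose j := M^-1%:C *: amul i i.
have Jj : J j by apply/JZ/JM.
have pj : posA j.
  by apply: posAZ; [rewrite invr_ge0 ltW | rewrite -{1}si; exact: posA_starM].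
have j1 : unorm (iota j) <= 1.
  rewrite unorm_iota nrmZ cabsR gtr0_norm ?invr_gt0// ler_pdivrMl// mulr1 /M.
  by rewrite -{1}si nrm_star; lra.
have [n n0 hn] := exists_small_inv (mulr_gt0 eps0 eps0) (ltW M0).
have [w Jw hw] : exists2 w : A, J w & (1 - iota j) ^+ n = 1 - iota w.
  elim: n {n0 hn} => [|n [w Jw IH]]; first by exists 0; rewrite ?expr0 ?iota0 ?subr0.
  exists (j + w + (-1) *: amul j w).
    by apply/JD/JZ/JM => //; exact: JD.
  by rewrite exprS IH !iotaD (iotaZ (-1)) (iotaM _ j); ncring R (uz (unitization_of A)).
exists w => //.
have pw : pos (1 - iota j).
  by have := pos_sub (pos_selfadj pj) j1; rewrite rmorph1 scale1r.
have sg : selfadj ((1 - iota j) ^+ n) by exact/selfadj_pow/pos_selfadj.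
have g1 : unorm ((1 - iota j) ^+ n) <= 1 by exact/unorm_pow_le1/unorm_sub1.
have hg : forall k, (k > 0)%N -> unorm ((1 - iota j) ^+ n * (iota j * (1 - iota j) ^+ k)) <= k%:R^-1.
  by move=> k k0; exact: unorm_mul_pow2.
have {}hg := hg n n0.
set g := (1 - iota j) ^+ n in hw sg g1 hg *.
rewrite -nrm_star -(unorm_iota (unitization_of A)).
have -> : iota (amul (astar (b - amul b w)) (b - amul b w)) =
    g * iota (amul (astar b) b) * g.
  rewrite iotaM iotaS !iotaB !iotaM iotaS.
  have -> : iota b - iota b * iota w = iota b * g by rewrite hw; ncring R (uz (unitization_of A)).
  by rewrite ustarM sg; ncring R (uz (unitization_of A)).
have le : unorm (g * iota (amul (astar b) b) * g) <= unorm (g * (t%:C%:A + iota i) * g).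
  apply: pos_mono; first by apply: pos_conj_selfadj => //; exact: posA_starM.
  rewrite -mulrBl -mulrBr; exact: pos_conj_selfadj.
apply: le_trans le _.
have -> : g * (t%:C%:A + iota i) * g = t%:C *: (g * g) + g * (iota i * g) by ncring R (uz (unitization_of A)).
apply: le_trans (unormD _ _) _; apply: lerD.
  rewrite unormZr ger0_norm// -[leRHS]mulr1 ler_wpM2l//.
  by apply: le_trans (unormM _ _) _; have := unorm_ge0 g; nra.
apply: le_trans (unormM _ _) _.
have ig : unorm (iota i * g) <= eps.
  have eps0' := ltW eps0; rewrite -(@ler_pXn2r _ 2)// ?nnegrE ?unorm_ge0//.
  rewrite -unorm_star ustarM sg -iotaS si.
  have -> : g * iota i * (iota i * g) = M%:C *: (g * (iota j * g)).
    rewrite /j iotaZ iotaM -scalerAl -scalerAr scalerA -rmorphM /=.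
    by rewrite divff ?gt_eqF// scale1r; ncring R (uz (unitization_of A)).
  rewrite unormZr gtr0_norm// expr2; apply: le_trans hn.
  by rewrite ler_pM2l.
by have := unorm_ge0 g; have := unorm_ge0 (iota i * g); nra.
Qed.

End CStarPositivity.

(** * Linear spans *)

Section LinearSpan.
Context {R : realType} {E : lmodType R[i]}.
Implicit Types (G : set E) (x y : E) (k : R[i]).

Lemma lspan_gen G x : G x -> linear_span G x.
Proof.
move=> Gx; exists 1%N, (fun=> 1), (fun=> x); split=> //.
by rewrite big_ord1 scale1r.
Qed.

Lemma lspan0 G : linear_span G 0.
Proof. by exists 0%N, (fun=> 1), (fun=> 0); split; [case | rewrite big_ord0]. Qed.

Lemma lspanZ G k x : linear_span G x -> linear_span G (k *: x).
Proof.
move=> [n [l [g [hg ->]]]]; exists n, (fun i => k * l i), g; split=> //.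
by rewrite scaler_sumr; apply: eq_bigr => i _; rewrite scalerA.
Qed.

Lemma lspanD G x y : linear_span G x -> linear_span G y -> linear_span G (x + y).
Proof.
move=> [n [l [g [hg ->]]]] [m [l' [g' [hg' ->]]]].
exists (n + m)%N, (fun i => match fintype.split (i : 'I_(n + m)) with inl j => l j | inr j => l' j end),
  (fun i => match fintype.split (i : 'I_(n + m)) with inl j => g j | inr j => g' j end); split.
  by move=> i; case: (fintype.split _).
rewrite big_split_ord /=; congr (_ + _); apply: eq_bigr => i _.
  by case: (fintype.split (lshift m i)) (unsplitK (inl _ i : 'I_n + 'I_m)%type) => j /= [] // ->.
by case: (fintype.split (rshift n i)) (unsplitK (inr _ i : 'I_n + 'I_m)%type) => j /= [] // ->.
Qed.

Lemma lspan_ind G (P : E -> Prop) : P 0 -> (forall k x y, G x -> P y -> P (k *: x + y)) ->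
  forall x, linear_span G x -> P x.
Proof.
move=> P0 PD x [n [l [g [hg ->]]]].
elim: n l g hg => [|n IH] l g hg; first by rewrite big_ord0.
rewrite big_ord_recl; apply: PD => //.
exact: (IH (fun i => l (lift ord0 i)) (fun i => g (lift ord0 i))).
Qed.

Lemma lspan_sub G (P : set E) : P 0 -> (forall k x y, P x -> P y -> P (k *: x + y)) ->
  G `<=` P -> linear_span G `<=` P.
Proof. by move=> P0 PD GP; apply: lspan_ind => // k x y /GP; exact: PD. Qed.

Lemma lspan_mono G G' : G `<=` G' -> linear_span G `<=` linear_span G'.
Proof. by move=> h x [n [l [g [hg ->]]]]; exists n, l, g; split => // i; exact: h. Qed.

End LinearSpan.

(** * Adjointable operators *)

Section HilbertModules.
Context {R : realType}.
Local Open Scope complex_scope.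
Implicit Types (X : ipspace R) (r M : R) (k : R[i]).

Definition vnrm X (a : Defs.val X) : R := complex.Re `|a|.

Definition inrm X (x : X) : R := Num.sqrt (vnrm (ip x x)).

Lemma vnrmE X (a : Defs.val X) : `|a| = (vnrm a)%:C.
Proof. by rewrite RRe_real// normr_real. Qed.

Lemma vnrm_ge0 X (a : Defs.val X) : 0 <= vnrm a.
Proof. by rewrite -ler0c -vnrmE. Qed.

Lemma sqrtC_real r : 0 <= r -> sqrtC (r%:C : R[i]) = (Num.sqrt r)%:C.
Proof.
move=> r0; apply/eqP; rewrite -(@eqrXn2 _ 2)// ?sqrtC_ge0 ?ler0c ?sqrtr_ge0//.
by rewrite sqrtCK -rmorphXn sqr_sqrtr.
Qed.

Lemma ipnormE X (x : X) : ipnorm x = (inrm x)%:C.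
Proof. by rewrite /ipnorm vnrmE sqrtC_real// vnrm_ge0. Qed.

Lemma inrm_ge0 X (x : X) : 0 <= inrm x. Proof. exact: sqrtr_ge0. Qed.

Lemma inrm_sq X (x : X) : inrm x ^+ 2 = vnrm (ip x x).
Proof. by rewrite sqr_sqrtr// vnrm_ge0. Qed.

(** What the common operator theory uses of a space. The values of [ip] form only a normed group, so
    homogeneity and conjugate symmetry are expressed without scalars or an involution on them:
    [hm_ipZr] and [hm_flip] say that an equality of inner products survives scaling and exchange of
    arguments. Positivity of the values enters as [hm_mono]. *)
Record hmodule X : Prop := HModule {
  hm_domP : forall k (x y : X), dom x -> dom y -> dom (k *: x + y);
  hm_dom0 : dom (0 : X);
  hm_ipDr : forall x y z : X, dom x -> dom y -> dom z ->
    ip x (y + z) = ip x y + ip x z;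
  hm_ipDl : forall x y z : X, dom x -> dom y -> dom z ->
    ip (x + y) z = ip x z + ip y z;
  hm_ipZ : forall k (x y : X), dom x -> dom y ->
    ip (k *: x) y = ip x (Num.conj k *: y);
  hm_ipZr : forall k (x y x' y' : X), dom x -> dom y -> dom x' -> dom y' ->
    ip x y = ip x' y' -> ip x (k *: y) = ip x' (k *: y');
  hm_flip : forall x y x' y' : X, dom x -> dom y -> dom x' -> dom y' ->
    ip x y = ip x' y' -> ip y x = ip y' x';
  hm_def : forall x : X, dom x -> inrm x = 0 -> x = 0;
  hm_CS : forall x y : X, dom x -> dom y -> vnrm (ip x y) <= inrm x * inrm y;
  hm_mono : forall x y : X, dom x -> dom y ->
    vnrm (ip x x) <= vnrm (ip x x + ip y y);
  hm_tri : forall x y : X, dom x -> dom y -> inrm (x + y) <= inrm x + inrm y;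
  hm_scale : forall k (x : X), dom x -> inrm (k *: x) = cabs k * inrm x
}.

Section Theory.
Context {X : ipspace R} (hX : hmodule X).
Implicit Types (x y z : X) (T S : X -> X) (G P : set (X -> X)).

Lemma domD x y : dom x -> dom y -> dom (x + y).
Proof. by move=> dx dy; have := hm_domP hX 1 dx dy; rewrite scale1r. Qed.

Lemma domZ k x : dom x -> dom (k *: x).
Proof. by move=> dx; have := hm_domP hX k dx (hm_dom0 hX); rewrite addr0. Qed.

Lemma domN x : dom x -> dom (- x).
Proof. by move=> dx; rewrite -scaleN1r; exact: domZ. Qed.

Lemma domB x y : dom x -> dom y -> dom (x - y).
Proof. by move=> dx dy; apply: domD => //; exact: domN. Qed.

Lemma ip0r x : dom x -> ip x (0 : X) = 0.
Proof.
move=> dx; apply: (addrI (ip x (0 : X))).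
by rewrite -hm_ipDr ?addr0//; exact: hm_dom0.
Qed.

Lemma ip0l x : dom x -> ip (0 : X) x = 0.
Proof.
move=> dx; apply: (addrI (ip (0 : X) x)).
by rewrite -hm_ipDl ?addr0//; exact: hm_dom0.
Qed.

Lemma ipNr x y : dom x -> dom y -> ip x (- y) = - ip x y.
Proof.
move=> dx dy; apply: (addrI (ip x y)).
by rewrite -hm_ipDr// ?subrr ?ip0r//; exact: domN.
Qed.

Lemma ipNl x y : dom x -> dom y -> ip (- x) y = - ip x y.
Proof.
move=> dx dy; apply: (addrI (ip x y)).
by rewrite -hm_ipDl// ?subrr ?ip0l//; exact: domN.
Qed.

Lemma ipBr x y z : dom x -> dom y -> dom z -> ip x (y - z) = ip x y - ip x z.
Proof. by move=> dx dy dz; rewrite hm_ipDr ?ipNr//; exact: domN. Qed.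

Lemma ipBl x y z : dom x -> dom y -> dom z -> ip (x - y) z = ip x z - ip y z.
Proof. by move=> dx dy dz; rewrite hm_ipDl ?ipNl//; exact: domN. Qed.

Lemma inrm0 : inrm (0 : X) = 0.
Proof. by rewrite -(scale0r (0 : X)) hm_scale ?cabs0 ?mul0r//; exact: hm_dom0. Qed.

Lemma inrmN x : dom x -> inrm (- x) = inrm x.
Proof. by move=> dx; rewrite -scaleN1r hm_scale// cabsN -[1]/(1%:C) cabsR normr1 mul1r. Qed.

Lemma inrmB x y : dom x -> dom y -> inrm (x - y) <= inrm x + inrm y.
Proof. by move=> dx dy; rewrite -(inrmN dy); apply: hm_tri => //; exact: domN. Qed.

Lemma inrm_small x : dom x -> (forall e : R, 0 < e -> inrm x <= e) -> x = 0.
Proof.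
move=> dx h; apply: (hm_def hX dx); apply/eqP; rewrite eq_le inrm_ge0 andbT.
by apply/ler_addgt0Pr => e e0; rewrite add0r h.
Qed.

Lemma inrm_ip_small x : dom x -> ip x x = 0 -> x = 0.
Proof.
move=> dx h; apply: (hm_def hX dx).
by rewrite /inrm h /vnrm normr0 sqrtr0.
Qed.

Lemma ip_eq_right x y : dom x -> dom y ->
  (forall z, dom z -> ip z x = ip z y) -> x = y.
Proof.
move=> dx dy h; apply/eqP; rewrite -subr_eq0; apply/eqP.
have dxy := domB dx dy; apply: inrm_ip_small => //.
by rewrite [LHS]ipBr// h// subrr.
Qed.

Lemma is_adjoint_sym T T' : is_adjoint T T' -> is_adjoint T' T.
Proof.
move=> [hT hT' h]; split=> // x y dx dy.
have e := h y x dy dx; apply/esym; apply: (hm_flip hX) e => //.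
  exact: (proj1 hT).
exact: (proj1 hT').
Qed.

Lemma is_adjoint_unique T T1 T2 : is_adjoint T T1 -> is_adjoint T T2 -> T1 = T2.
Proof.
move=> [_ [h1 z1] e1] [_ [h2 z2] e2]; apply/funext => y.
have [dy|dy] := pselect (dom y); last by rewrite z1// z2.
apply: ip_eq_right => [||z dz]; [exact: h1 | exact: h2 |].
by rewrite -e1// e2.
Qed.

Lemma adjE T T' : is_adjoint T T' -> adj T = T'.
Proof.
move=> h; rewrite /adj; case: xgetP => [T'' _ h'|/(_ T')//].
exact: is_adjoint_unique h' h.
Qed.

Lemma adjP T : adjointable X T -> is_adjoint T (adj T).
Proof. by move=> [T' h]; rewrite (adjE h). Qed.

Lemma adj_adjointable T : adjointable X T -> adjointable X (adj T).
Proof. by move=> h; exists T; apply: is_adjoint_sym; exact: adjP. Qed.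

Lemma adjK T : adjointable X T -> adj (adj T) = T.
Proof. by move=> h; apply/adjE/is_adjoint_sym; exact: adjP. Qed.

Lemma adjointable_dom T x : adjointable X T -> dom x -> dom (T x).
Proof. by move=> [T' [[h _] _ _]]; exact: h. Qed.

Lemma adjointable_out T x : adjointable X T -> ~ dom x -> T x = 0.
Proof. by move=> [T' [[_ h] _ _]]; exact: h. Qed.

Lemma adj_ip T x y : adjointable X T -> dom x -> dom y ->
  ip (T x) y = ip x (adj T y).
Proof. by move=> /adjP[_ _ h]; exact: h. Qed.

Lemma adj_ip' T x y : adjointable X T -> dom x -> dom y ->
  ip (adj T x) y = ip x (T y).
Proof. by move=> /adjP/is_adjoint_sym[_ _ h]; exact: h. Qed.

Lemma adjointable_eq T S : adjointable X T -> adjointable X S ->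
  (forall x, dom x -> T x = S x) -> T = S.
Proof.
move=> hT hS h; apply/funext => x.
have [dx|dx] := pselect (dom x); first exact: h.
by rewrite !adjointable_out.
Qed.

Lemma adjointable0r T : adjointable X T -> T 0 = 0.
Proof.
move=> hT; apply: ip_eq_right; [exact/adjointable_dom/hm_dom0|exact: hm_dom0|].
move=> z dz; rewrite -adj_ip'//; last exact: hm_dom0.
by rewrite !ip0r//; apply: adjointable_dom => //; exact: adj_adjointable.
Qed.

Lemma adjointable_lin T k x y : adjointable X T -> dom x -> dom y ->
  T (k *: x + y) = k *: T x + T y.
Proof.
move=> hT dx dy; have hT' := adj_adjointable hT.
have dkx := domZ k dx; have dTx := adjointable_dom hT dx.
have dTy := adjointable_dom hT dy; have dkTx := domZ k dTx.
apply: ip_eq_right => [||z dz].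
- exact/adjointable_dom/domD.
- exact: domD.
- have dTz := adjointable_dom hT' dz.
  rewrite (hm_ipDr hX)// -adj_ip'//; last exact: domD.
  rewrite (hm_ipDr hX)//; congr (_ + _); last exact: adj_ip'.
  by apply: (hm_ipZr hX) => //; exact: adj_ip'.
Qed.

Lemma adjointableD T S x y : adjointable X T -> dom x -> dom y ->
  T (x + y) = T x + T y.
Proof. by move=> hT dx dy; have := adjointable_lin 1 hT dx dy; rewrite !scale1r. Qed.

Lemma adjointableZ T k x : adjointable X T -> dom x -> T (k *: x) = k *: T x.
Proof.
move=> hT dx; have := adjointable_lin k hT dx (hm_dom0 hX).
by rewrite (adjointable0r hT) !addr0.
Qed.

Lemma adjointableB T x y : adjointable X T -> dom x -> dom y ->
  T (x - y) = T x - T y.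
Proof.
move=> hT dx dy; rewrite adjointableD//; last exact: domN.
by rewrite -scaleN1r adjointableZ// scaleN1r.
Qed.

Lemma op_linE k T S x : (k *: T + S) x = k *: T x + S x. Proof. by []. Qed.

Lemma op_subE T S x : (T - S) x = T x - S x. Proof. by []. Qed.

Lemma is_adjoint_lin k T T' S S' : is_adjoint T T' -> is_adjoint S S' ->
  is_adjoint (k *: T + S) (Num.conj k *: T' + S').
Proof.
move=> [[a1 a2] [b1 b2] h] [[c1 c2] [d1 d2] h'].
split; [split=> x dx|split=> x dx|move=> x y dx dy].
- by apply: (hm_domP hX); [exact: a1 | exact: c1].
- by rewrite op_linE a2// c2// scaler0 addr0.
- by apply: (hm_domP hX); [exact: b1 | exact: d1].
- by rewrite op_linE b2// d2// scaler0 addr0.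
- rewrite !op_linE (hm_ipDl hX)//; [|exact/domZ/a1|exact: c1].
  rewrite (hm_ipDr hX)//; [|exact/domZ/b1|exact: d1].
  congr (_ + _); last exact: h'.
  rewrite (hm_ipZ hX)//; [|exact: a1].
  by apply: (hm_ipZr hX) => //; [exact: a1 | exact: b1 | exact: h].
Qed.

Lemma is_adjoint0 : is_adjoint (0 : X -> X) 0.
Proof.
split; [split=> // x _; exact: hm_dom0|split=> // x _; exact: hm_dom0|].
by move=> x y dx dy; rewrite ip0l// ip0r.
Qed.

Lemma is_adjoint_comp T T' S S' : is_adjoint T T' -> is_adjoint S S' ->
  is_adjoint (T \o S) (S' \o T').
Proof.
move=> hT hS; have aT : adjointable X T by exists T'.
have aS' : adjointable X S' by exists S; exact: is_adjoint_sym.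
move: hT hS => [[a1 a2] [b1 b2] h] [[c1 c2] [d1 d2] h'].
split; [split=> x dx /=|split=> x dx /=|move=> x y dx dy /=].
- exact/a1/c1.
- by rewrite c2// (adjointable0r aT).
- exact/d1/b1.
- by rewrite b2// (adjointable0r aS').
- by rewrite h//; [rewrite h'//; exact: b1 | exact: c1].
Qed.

Lemma restrE (f : X -> X) x : dom x -> restr f x = f x.
Proof. by move=> dx; rewrite /restr /patch mem_set. Qed.

Lemma restr_out (f : X -> X) x : ~ dom x -> restr f x = 0.
Proof. by move=> dx; rewrite /restr /patch memNset. Qed.

Lemma is_adjoint_id : is_adjoint (idop X) (idop X).
Proof.
have sm : self_map (idop X).
  by split=> x dx; [rewrite /idop restrE | rewrite /idop restr_out].
by split=> // x y dx dy; rewrite /idop !restrE.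
Qed.

Lemma idopE x : dom x -> idop X x = x.
Proof. exact: restrE. Qed.

Lemma adj_lin k T S : adjointable X T -> adjointable X S ->
  adj (k *: T + S) = Num.conj k *: adj T + adj S.
Proof. by move=> hT hS; apply/adjE/is_adjoint_lin; exact: adjP. Qed.

Lemma adj_comp T S : adjointable X T -> adjointable X S ->
  adj (T \o S) = adj S \o adj T.
Proof. by move=> hT hS; apply/adjE/is_adjoint_comp; exact: adjP. Qed.

Lemma adj_id : adj (idop X) = idop X.
Proof. exact/adjE/is_adjoint_id. Qed.

Lemma adjointable_id : adjointable X (idop X).
Proof. by exists (idop X); exact: is_adjoint_id. Qed.

Lemma adjointable0 : adjointable X 0.
Proof. by exists 0; exact: is_adjoint0. Qed.

Lemma adjointable_linop k T S : adjointable X T -> adjointable X S ->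
  adjointable X (k *: T + S).
Proof. by move=> [T' h] [S' h']; exists (Num.conj k *: T' + S'); exact: is_adjoint_lin. Qed.

Lemma adjointable_comp T S : adjointable X T -> adjointable X S ->
  adjointable X (T \o S).
Proof. by move=> [T' h] [S' h']; exists (S' \o T'); exact: is_adjoint_comp. Qed.

Lemma adjointable_add T S : adjointable X T -> adjointable X S ->
  adjointable X (T + S).
Proof. by move=> hT hS; have := adjointable_linop 1 hT hS; rewrite scale1r. Qed.

Lemma adjointable_scale k T : adjointable X T -> adjointable X (k *: T).
Proof. by move=> hT; have := adjointable_linop k hT adjointable0; rewrite addr0. Qed.

Lemma adjointable_sub T S : adjointable X T -> adjointable X S ->
  adjointable X (T - S).
Proof.
by move=> hT hS; rewrite -scaleN1r; apply/adjointable_add/adjointable_scale.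
Qed.

Lemma comp_id_r T : adjointable X T -> T \o idop X = T.
Proof.
move=> hT; apply: adjointable_eq => //.
  by apply: adjointable_comp => //; exact: adjointable_id.
by move=> x dx /=; rewrite idopE.
Qed.

Lemma comp_id_l T : adjointable X T -> idop X \o T = T.
Proof.
move=> hT; apply: adjointable_eq => //.
  by apply: adjointable_comp => //; exact: adjointable_id.
by move=> x dx /=; rewrite idopE//; exact: adjointable_dom.
Qed.

Definition bounded_by T M := forall x, dom x -> inrm (T x) <= M * inrm x.

Lemma bounded_by_adj T M : 0 <= M -> adjointable X T -> bounded_by T M ->
  bounded_by (adj T) M.
Proof.
move=> M0 hT b x dx; have hT' := adj_adjointable hT.
have dy := adjointable_dom hT' dx; have dTy := adjointable_dom hT dy.
have h : inrm (adj T x) ^+ 2 <= M * inrm x * inrm (adj T x).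
  rewrite inrm_sq adj_ip'//; apply: le_trans (hm_CS hX dx dTy) _.
  by have := b _ dy; have := inrm_ge0 x; nra.
have := inrm_ge0 (adj T x); rewrite le_eqVlt => /orP[/eqP <-|p].
  by rewrite mulr_ge0// inrm_ge0.
by rewrite -(ler_pM2r p) -expr2.
Qed.

Lemma bounded_by_comp T S M N : 0 <= M -> adjointable X S ->
  bounded_by T M -> bounded_by S N -> bounded_by (T \o S) (M * N).
Proof.
move=> M0 hS bT bS x dx /=; apply: le_trans (bT _ (adjointable_dom hS dx)) _.
by rewrite -mulrA ler_wpM2l// bS.
Qed.

Lemma bounded_by_lin k T S M N : adjointable X T -> adjointable X S ->
  bounded_by T M -> bounded_by S N -> bounded_by (k *: T + S) (cabs k * M + N).
Proof.
move=> hT hS bT bS x dx; rewrite op_linE.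
have dTx := adjointable_dom hT dx; have dSx := adjointable_dom hS dx.
apply: le_trans (hm_tri hX (domZ k dTx) dSx) _; rewrite (hm_scale hX)//.
rewrite mulrDl -mulrA; apply: lerD; last exact: bS.
by rewrite ler_wpM2l ?cabs_ge0// bT.
Qed.

Lemma ocs_spanP G T : op_closed_span G T <-> adjointable X T /\
  forall e : R, 0 < e -> exists2 T0, linear_span G T0 & bounded_by (T - T0) e.
Proof.
split=> -[hT h]; split=> // e e0.
  have [|T0 h0 b] := h e%:C; first by rewrite ltcR.
  by exists T0 => // x dx; have := b x dx; rewrite !ipnormE -rmorphM lecR.
have [r r0 ->] := normc_gt0E e0; have [T0 h0 b] := h r r0.
by exists T0 => // x dx; have := b x dx; rewrite !ipnormE -rmorphM lecR.
Qed.

Section ClosedSpan.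
Variable (G : set (X -> X)) (hG : G `<=` adjointable X).

Lemma span_adjointable : linear_span G `<=` adjointable X.
Proof.
apply: lspan_sub => //; first exact: adjointable0.
by move=> k x y; exact: adjointable_linop.
Qed.

Lemma ocs_span T : linear_span G T -> op_closed_span G T.
Proof.
move=> h; apply/ocs_spanP; split; first exact: span_adjointable.
move=> e e0; exists T => // x dx; rewrite subrr.
by rewrite inrm0 mulr_ge0 ?inrm_ge0// ltW.
Qed.

Lemma ocs_gen : G `<=` op_closed_span G.
Proof. by move=> T GT; apply/ocs_span/lspan_gen. Qed.

Lemma ocs_lin k T S : op_closed_span G T -> op_closed_span G S ->
  op_closed_span G (k *: T + S).
Proof.
move=> /ocs_spanP[hT hT'] /ocs_spanP[hS hS']; apply/ocs_spanP.
split; first exact: adjointable_linop.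
move=> e e0; pose M := cabs k + 1.
have M0 : 0 < M by have := cabs_ge0 k; rewrite /M; lra.
have [T0 sT bT] := hT' (e / (2 * M)) ltac:(by rewrite divr_gt0// mulr_gt0).
have [S0 sS bS] := hS' (e / 2) ltac:(by rewrite divr_gt0).
exists (k *: T0 + S0); first by apply/lspanD => //; exact: lspanZ.
have aT := adjointable_sub hT (span_adjointable sT).
have aS := adjointable_sub hS (span_adjointable sS).
have -> : k *: T + S - (k *: T0 + S0) = k *: (T - T0) + (S - S0).
  by rewrite scalerBr opprD addrACA.
move=> x dx; apply: le_trans (bounded_by_lin k aT aS bT bS dx) _.
rewrite ler_wpM2r ?inrm_ge0//.
have d0 : 0 < e / (2 * M) by rewrite divr_gt0// mulr_gt0.
have hM : e / (2 * M) * M = e / 2 by field; rewrite (gt_eqF M0).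
have := ler_wpM2l (ltW d0) (_ : cabs k <= M); rewrite /M lerDl => /(_ ler01).
by move: hM; rewrite /M mulrC; lra.
Qed.

Lemma ocs0 : op_closed_span G 0.
Proof. exact/ocs_span/lspan0. Qed.

Lemma ocs_sub_span (P : set (X -> X)) : P `<=` op_closed_span G ->
  op_closed_span P `<=` op_closed_span G.
Proof.
move=> PG T /ocs_spanP[hT hT']; apply/ocs_spanP; split=> // e e0.
have e2 : 0 < e / 2 by rewrite divr_gt0.
have [T0 sT bT] := hT' _ e2.
have /ocs_spanP[hT0 hT0'] : op_closed_span G T0.
  move: T0 sT {bT}; apply: lspan_sub => //; first exact: ocs0.
  by move=> k x y; exact: ocs_lin.
have [T1 sT1 bT1] := hT0' _ e2.
exists T1 => // x dx.
have -> : (T - T1) x = (T - T0) x + (T0 - T1) x.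
  by rewrite !op_subE addrA subrK.
have aT := adjointable_sub hT hT0.
have aT1 := adjointable_sub hT0 (span_adjointable sT1).
apply: le_trans (hm_tri hX (adjointable_dom aT dx) (adjointable_dom aT1 dx)) _.
by rewrite [e]splitr mulrDl lerD; [|exact: bT|exact: bT1].
Qed.

(** The function [c] lets one argument cover linear maps (composition with a fixed operator) and the
    conjugate-linear map [adj]. *)
Lemma ocs_map (f : (X -> X) -> X -> X) (c : R[i] -> R[i]) (P : set (X -> X)) M :
  0 <= M -> P `<=` adjointable X ->
  (forall T, adjointable X T -> adjointable X (f T)) ->
  c 1 = 1 ->
  (forall k T S, adjointable X T -> adjointable X S ->
     f (k *: T + S) = c k *: f T + f S) ->
  (forall T N, 0 <= N -> adjointable X T -> bounded_by T N ->
     bounded_by (f T) (M * N)) ->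
  (forall T, P T -> op_closed_span G (f T)) ->
  forall T, op_closed_span P T -> op_closed_span G (f T).
Proof.
move=> M0 hP ha c1 hc hb hf T /ocs_spanP[hT hT'].
have fD T1 T2 : adjointable X T1 -> adjointable X T2 -> f (T1 + T2) = f T1 + f T2.
  by move=> h1 h2; have := hc 1 _ _ h1 h2; rewrite c1 !scale1r.
have f0 : f 0 = 0.
  by apply: (addrI (f 0)); rewrite -fD ?addr0//; exact: adjointable0.
have key T0 : linear_span P T0 -> adjointable X T0 /\ op_closed_span G (f T0).
  move: T0; apply: lspan_ind; first by rewrite f0; split; [exact: adjointable0 | exact: ocs0].
  move=> k x y Px [sy hy]; have ax := hP _ Px; split; first exact: adjointable_linop.
  by rewrite hc//; apply: ocs_lin => //; exact: hf.
apply: (@ocs_sub_span [set S | op_closed_span G S]) => //.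
apply/ocs_spanP; split; first exact: ha.
move=> e e0; pose N := M + 1; have N0 : 0 < N by rewrite /N; lra.
have eN : 0 < e / N by rewrite divr_gt0.
have [T0 sT0 bT0] := hT' _ eN.
have [aT0 hf0] := key _ sT0.
exists (f T0); first exact: lspan_gen.
have aD := adjointable_sub hT aT0.
have -> : f T - f T0 = f (T - T0).
  by have := fD _ _ aD aT0; rewrite subrK => ->; rewrite addrK.
move=> x dx; apply: le_trans (hb _ _ (ltW eN) aD bT0 x dx) _.
rewrite ler_wpM2r ?inrm_ge0// mulrA ler_pdivrMr// mulrC ler_wpM2l ?ltW//.
by rewrite /N ltrDl.
Qed.

Lemma ocs_compl S (P : set (X -> X)) M : 0 <= M -> P `<=` adjointable X ->
  adjointable X S -> bounded_by S M ->
  (forall T, P T -> op_closed_span G (S \o T)) ->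
  forall T, op_closed_span P T -> op_closed_span G (S \o T).
Proof.
move=> M0 hP hS bS hf; apply: (@ocs_map (fun T => S \o T) id P M) => //.
- by move=> T; exact: adjointable_comp.
- move=> k T T' hT hT'; apply: adjointable_eq.
  + by apply: adjointable_comp => //; exact: adjointable_linop.
  + by apply: adjointable_linop; exact: adjointable_comp.
  + by move=> x dx /=; rewrite !op_linE /= adjointable_lin//; exact: adjointable_dom.
- by move=> T N N0 hT bT; exact: bounded_by_comp.
Qed.

Lemma ocs_compr S (P : set (X -> X)) M : 0 <= M -> P `<=` adjointable X ->
  adjointable X S -> bounded_by S M ->
  (forall T, P T -> op_closed_span G (T \o S)) ->
  forall T, op_closed_span P T -> op_closed_span G (T \o S).
Proof.
move=> M0 hP hS bS hf; apply: (@ocs_map (fun T => T \o S) id P M) => //.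
- by move=> T hT; exact: adjointable_comp.
- by move=> T N N0 hT bT; rewrite mulrC; exact: bounded_by_comp.
Qed.

Lemma ocs_adj (P : set (X -> X)) : P `<=` adjointable X ->
  (forall T, P T -> op_closed_span G (adj T)) ->
  forall T, op_closed_span P T -> op_closed_span G (adj T).
Proof.
move=> hP hf; apply: (@ocs_map (@adj R X) Num.conj P 1) => //.
- by move=> T; exact: adj_adjointable.
- exact: conjC1.
- by move=> k T T' hT hT'; exact: adj_lin.
- by move=> T N N0 hT bT; rewrite mul1r; exact: bounded_by_adj.
Qed.

Lemma ocs_bounded : (forall T, G T -> exists2 M, 0 <= M & bounded_by T M) ->
  forall T, op_closed_span G T -> exists2 M, 0 <= M & bounded_by T M.
Proof.
move=> hb T /ocs_spanP[hT hT'].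
have key T0 : linear_span G T0 -> adjointable X T0 /\ exists2 M, 0 <= M & bounded_by T0 M.
  move: T0; apply: lspan_ind.
    split; first exact: adjointable0.
    by exists 0 => // x dx; rewrite inrm0 mul0r.
  move=> k x y Gx [ay [M M0 bM]]; have ax := hG Gx; have [N N0 bN] := hb _ Gx.
  split; first exact: adjointable_linop.
  exists (cabs k * N + M); last exact: bounded_by_lin.
  by rewrite addr_ge0// mulr_ge0// cabs_ge0.
have [T0 sT0 bT0] := hT' 1 ltr01; have [aT0 [M M0 bM]] := key _ sT0.
exists (1 + M); first by rewrite addr_ge0.
have aD := adjointable_sub hT aT0.
have -> : T = 1 *: (T - T0) + T0 by rewrite scale1r subrK.
have -> : 1 + M = cabs (1 : R[i]) * 1 + M by rewrite -[X in cabs X]/(1%:C) cabsR normr1 mul1r.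
exact: bounded_by_lin.
Qed.

End ClosedSpan.

End Theory.

End HilbertModules.

Section Conjugation.
Context {R : realType}.
Implicit Types (k l : R[i]).

Lemma conjM k l : Num.conj (k * l) = Num.conj k * Num.conj l.
Proof. exact: rmorphM. Qed.

Lemma conjD k l : Num.conj (k + l) = Num.conj k + Num.conj l.
Proof. exact: rmorphD. Qed.

Lemma conjN k : Num.conj (- k) = - Num.conj k.
Proof. exact: rmorphN. Qed.

Lemma conjB k l : Num.conj (k - l) = Num.conj k - Num.conj l.
Proof. exact: rmorphB. Qed.

Lemma conjK k : Num.conj (Num.conj k) = k.
Proof. exact: conjCK. Qed.

End Conjugation.

(** * Semi-inner products and representations *)

Section SemiInnerProducts.
Context {R : realType} {E : lmodType R[i]}.
Local Open Scope complex_scope.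

Record semi_inner (f : E -> E -> R[i]) : Prop := SemiInner {
  siP : forall (k : R[i]) x y z, f x (k *: y + z) = k * f x y + f x z;
  siJ : forall x y, f y x = Num.conj (f x y);
  si_ge0 : forall x, 0 <= f x x
}.

Variables (f : E -> E -> R[i]) (hf : semi_inner f).
Implicit Types (x y z : E) (k : R[i]).

Definition seminorm (x : E) : R := Num.sqrt (complex.Re (f x x)).

Lemma siDr x y z : f x (y + z) = f x y + f x z.
Proof. by have := siP hf 1 x y z; rewrite scale1r mul1r. Qed.

Lemma si0r x : f x 0 = 0.
Proof. by apply: (addrI (f x 0)); rewrite -siDr !addr0. Qed.

Lemma siZr k x y : f x (k *: y) = k * f x y.
Proof. by have := siP hf k x y 0; rewrite si0r !addr0. Qed.

Lemma siDl x y z : f (x + y) z = f x z + f y z.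
Proof. by rewrite siJ// siDr conjD -!siJ. Qed.

Lemma siZl k x y : f (k *: x) y = Num.conj k * f x y.
Proof. by rewrite siJ// siZr conjM -siJ. Qed.

Lemma siNr x y : f x (- y) = - f x y.
Proof. by rewrite -scaleN1r siZr mulN1r. Qed.

Lemma siNl x y : f (- x) y = - f x y.
Proof. by rewrite siJ// siNr conjN -siJ. Qed.

Lemma siBr x y z : f x (y - z) = f x y - f x z.
Proof. by rewrite siDr siNr. Qed.

Lemma siBl x y z : f (x - y) z = f x z - f y z.
Proof. by rewrite siDl siNl. Qed.

Lemma seminorm_ge0 x : 0 <= seminorm x. Proof. exact: sqrtr_ge0. Qed.

Lemma Re_si_ge0 x : 0 <= complex.Re (f x x).
Proof. by have := si_ge0 hf x; rewrite lecE => /andP[]. Qed.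

Lemma si_diag x : f x x = (seminorm x ^+ 2)%:C.
Proof. by rewrite sqr_sqrtr ?Re_si_ge0// RRe_real// ger0_real// si_ge0. Qed.

Lemma mul_conj_cabs k : k * Num.conj k = (cabs k ^+ 2)%:C.
Proof. by rewrite -normCK cabsE rmorphXn. Qed.

Lemma si_CS x y : cabs (f x y) <= seminorm x * seminorm y.
Proof.
set a := f x y; have ba : f y x = Num.conj a by rewrite siJ.
(* The factor [conj a] aligns the phases, so the form at [x - t (conj a) y] is a real quadratic
   polynomial in [t]. *)
have key (t : R) : 0 <= seminorm x ^+ 2 - 2 * t * cabs a ^+ 2 + t ^+ 2 * cabs a ^+ 2 * seminorm y ^+ 2.
  have := si_ge0 hf (x - (t%:C * Num.conj a) *: y).
  rewrite siBl !siBr !siZl !siZr ba -/a !si_diag conjM conjK conjR.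
  have -> : (seminorm x ^+ 2)%:C - t%:C * Num.conj a * a -
     (t%:C * a * Num.conj a - t%:C * a * (t%:C * Num.conj a * (seminorm y ^+ 2)%:C)) =
     (seminorm x ^+ 2)%:C - 2 * t%:C * (a * Num.conj a) +
       t%:C ^+ 2 * (a * Num.conj a) * (seminorm y ^+ 2)%:C by ring.
  rewrite mul_conj_cabs.
  have -> : (seminorm x ^+ 2)%:C - 2 * t%:C * (cabs a ^+ 2)%:C +
       t%:C ^+ 2 * (cabs a ^+ 2)%:C * (seminorm y ^+ 2)%:C =
    (seminorm x ^+ 2 - 2 * t * cabs a ^+ 2 + t ^+ 2 * cabs a ^+ 2 * seminorm y ^+ 2)%:C.
    by ring.
  by rewrite ler0c.
have X0 := seminorm_ge0 x; have Y0 := seminorm_ge0 y; have a0 := cabs_ge0 a.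
have [y0|y0] := eqVneq (seminorm y) 0.
  have [->|an0] := eqVneq (cabs a) 0; first by rewrite mulr_ge0.
  have ap : 0 < cabs a ^+ 2 by rewrite exprn_gt0// lt_neqAle eq_sym an0.
  (* When [y] has seminorm 0 the polynomial is affine with negative slope, and at this [t] it takes
     the value -1. *)
  have := key ((seminorm x ^+ 2 + 1) / (2 * cabs a ^+ 2)).
  rewrite y0 expr0n mulr0 addr0 -mulrA.
  have -> : 2 * ((seminorm x ^+ 2 + 1) / (2 * cabs a ^+ 2) * cabs a ^+ 2) = seminorm x ^+ 2 + 1.
    by field; rewrite an0.
  lra.
have yp : 0 < seminorm y ^+ 2 by rewrite exprn_gt0// lt_neqAle eq_sym y0.
rewrite -(@ler_pXn2r _ 2)// ?nnegrE ?mulr_ge0// exprMn.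
have := key (seminorm y ^+ 2)^-1.
have -> : seminorm x ^+ 2 - 2 * (seminorm y ^+ 2)^-1 * cabs a ^+ 2 +
   (seminorm y ^+ 2)^-1 ^+ 2 * cabs a ^+ 2 * seminorm y ^+ 2 =
   (seminorm x ^+ 2 * seminorm y ^+ 2 - cabs a ^+ 2) / seminorm y ^+ 2.
  by field; rewrite y0.
by rewrite pmulr_lge0 ?invr_gt0// subr_ge0.
Qed.

Lemma seminormD x y : seminorm (x + y) <= seminorm x + seminorm y.
Proof.
have X0 := seminorm_ge0 x; have Y0 := seminorm_ge0 y.
rewrite -(@ler_pXn2r _ 2)// ?nnegrE ?addr_ge0 ?seminorm_ge0//.
rewrite -lecR -si_diag siDl !siDr !si_diag.
have -> : (seminorm x ^+ 2)%:C + f x y + (f y x + (seminorm y ^+ 2)%:C) =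
  (seminorm x ^+ 2 + seminorm y ^+ 2 + 2 * complex.Re (f x y))%:C.
  rewrite (siJ hf x y) conjE.
  have -> : ((f x y)^*)%C = 2%:R * (complex.Re (f x y))%:C - f x y.
    by rewrite -addcJ addrC addKr.
  by ring.
rewrite lecR sqrrD.
have := le_trans (le_trans (ler_norm _) (Re_le_cabs (f x y))) (si_CS x y).
by rewrite mulr2n; lra.
Qed.

Lemma seminormZ k x : seminorm (k *: x) = cabs k * seminorm x.
Proof.
apply/eqP; rewrite -(@eqrXn2 _ 2) ?mulr_ge0 ?seminorm_ge0 ?cabs_ge0//.
apply/eqP; apply: (@complexI R); rewrite -si_diag siZl siZr exprMn rmorphM /=.
by rewrite -si_diag -mul_conj_cabs; ring.
Qed.

Lemma seminorm0 : seminorm 0 = 0.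
Proof. by rewrite /seminorm si0r sqrtr0. Qed.

End SemiInnerProducts.

(** * Hilbert spaces and C*-algebras as Hilbert modules *)

Section Instances.
Context {R : realType}.
Local Open Scope complex_scope.

Lemma hip_semi (H : hilbertType R) : semi_inner (@hip R H).
Proof.
split; [exact: hipP | by move=> x y; rewrite -hip_conj | ].
by move=> x; rewrite hip_norm exprn_ge0.
Qed.

Lemma seminorm_hip (H : hilbertType R) (x : H) : seminorm (@hip R H) x = nrm x.
Proof.
rewrite /seminorm hip_norm nrmE -rmorphXn /= sqrtr_sqr ger0_norm//; exact: nrm_ge0.
Qed.

Lemma inrm_hspace (H : hilbertType R) (x : H) : @inrm R (hspace H) x = nrm x.
Proof.
rewrite /inrm -[vnrm _]/(cabs (hip x x)) (si_diag (hip_semi H)) cabsR.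
by rewrite ger0_norm ?sqr_ge0// sqrtr_sqr ger0_norm ?seminorm_ge0// seminorm_hip.
Qed.

Lemma hmodule_hspace (H : hilbertType R) : hmodule (hspace H).
Proof.
have hs := hip_semi H.
split=> //.
- by move=> x y z _ _ _; exact: siDr.
- by move=> x y z _ _ _; exact: siDl.
- by move=> k x y _ _; rewrite /= siZl// siZr.
- by move=> k x y x' y' _ _ _ _ /= e; rewrite !siZr// e.
- by move=> x y x' y' _ _ _ _ /= e; rewrite (siJ hs x) e -siJ.
- by move=> x _; rewrite inrm_hspace => /nrm0_eq0.
- by move=> x y _ _; rewrite !inrm_hspace -!seminorm_hip; exact: si_CS.
- move=> x y _ _; rewrite -[vnrm _]/(cabs _) -[vnrm (_ + _)]/(cabs (hip x x + hip y y)) /=.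
  rewrite !(si_diag hs) -rmorphD !cabsR !ger0_norm ?addr_ge0 ?sqr_ge0//.
  by rewrite lerDl sqr_ge0.
- by move=> x y _ _; rewrite !inrm_hspace nrmD.
- by move=> k x _; rewrite !inrm_hspace nrmZ.
Qed.

Lemma inrm_selfmod (B : cstarType R) (x : B) : @inrm R (selfmod B) x = nrm x.
Proof.
rewrite /inrm -[vnrm _]/(nrm (amul (astar x) x)) nrm_star sqrtr_sqr.
by rewrite ger0_norm// nrm_ge0.
Qed.

Lemma hmodule_selfmod (B : cstarType R) : hmodule (selfmod B).
Proof.
split=> //.
- by move=> x y z _ _ _; exact: amulDr.
- by move=> x y z _ _ _; rewrite /= astarD amulDl.
- by move=> k x y _ _; rewrite /= astarZ amulZl amulZr.
- by move=> k x y x' y' _ _ _ _ /= e; rewrite !amulZr e.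
- move=> x y x' y' _ _ _ _ /= e.
  by rewrite -(astarK x) -astarM e astarM astarK.
- by move=> x _; rewrite inrm_selfmod => /nrm0_eq0.
- move=> x y _ _; rewrite !inrm_selfmod.
  by apply: le_trans (nrmM _ _) _; rewrite nrmS.
- by move=> x y _ _; exact: nrm_add_starM.
- by move=> x y _ _; rewrite !inrm_selfmod nrmD.
- by move=> k x _; rewrite !inrm_selfmod nrmZ.
Qed.

End Instances.

(** * Norm estimates for representations *)

Section Representations.
Context {R : realType} {B : cstarType R} {X : ipspace R} (hX : hmodule X).
Context {rho : B -> X -> X} (hrho : representation rho).
Local Open Scope complex_scope.
Implicit Types (a b : B) (x y : X) (r s : R).

Lemma rep_adjointable b : adjointable X (rho b).
Proof. by case: hrho => h _ _ _; exact: h. Qed.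

Lemma rep_lin (k : R[i]) a b : rho (k *: a + b) = k *: rho a + rho b.
Proof. by case: hrho => _ h _ _; exact: h. Qed.

Lemma repM a b : rho (amul a b) = rho a \o rho b.
Proof. by case: hrho => _ _ h _; exact: h. Qed.

Lemma repS a : rho (astar a) = adj (rho a).
Proof. by case: hrho => _ _ _ h; exact: h. Qed.

Lemma repD a b : rho (a + b) = rho a + rho b.
Proof. by have := rep_lin 1 a b; rewrite !scale1r. Qed.

Lemma rep0 : rho 0 = 0.
Proof. by apply: (addrI (rho 0)); rewrite -repD !addr0. Qed.

Lemma repZ (k : R[i]) a : rho (k *: a) = k *: rho a.
Proof. by have := rep_lin k a 0; rewrite rep0 !addr0. Qed.

Lemma repN a : rho (- a) = - rho a.
Proof. by rewrite -scaleN1r repZ scaleN1r. Qed.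

Lemma repB a b : rho (a - b) = rho a - rho b.
Proof. by rewrite repD repN. Qed.

Lemma rep_dom b x : dom x -> dom (rho b x).
Proof. by move=> dx; apply: adjointable_dom => //; exact: rep_adjointable. Qed.

Lemma rep_ip a b x y : dom x -> dom y ->
  ip (rho a x) (rho b y) = ip x (rho (amul (astar a) b) y).
Proof.
move=> dx dy; rewrite repM repS /=.
by apply: adj_ip => //; [exact: rep_adjointable | exact: rep_dom].
Qed.

(** As [1 - b^*b = (1 - e)^2], the value <x, x> is <b x, b x> plus <x - e x, x - e x>, and [hm_mono]
    discards the second term. *)
Let rep_contractive1 b : nrm b <= 1 -> bounded_by (rho b) 1.
Proof.
move=> b1 x dx; have [e se be] := sqrt_defect b1; rewrite mul1r.
have de := rep_dom e dx; have dee := rep_dom (amul e e) dx; have dy := domB hX dx de.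
rewrite ler_wsqrtr//.
suff -> : ip x x = ip (rho b x) (rho b x) + ip (x - rho e x) (x - rho e x).
  by apply: (hm_mono hX) => //; exact: rep_dom.
rewrite rep_ip// be repB repD.
rewrite (_ : (rho e + rho e - rho (amul e e)) x = rho e x + rho e x - rho (amul e e) x) //.
rewrite (ipBr hX)//; [|exact: domD].
rewrite (hm_ipDr hX)// (ipBl hX)// !(ipBr hX)//.
rewrite (rep_ip e e)// se.
have -> : ip (rho e x) x = ip x (rho e x).
  by rewrite (adj_ip hX)// -?repS ?se//; exact: rep_adjointable.
move: (ip x x) (ip x (rho e x)) (ip x (rho (amul e e) x)) => p q r.
by rewrite addrC -(addrA q) -(addrA p) -opprD subrK.
Qed.

Lemma rep_contractive b : bounded_by (rho b) (nrm b).
Proof.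
have [b0|b0] := eqVneq (nrm b) 0.
  move=> x dx; rewrite b0 mul0r (nrm0_eq0 b0) rep0.
  by rewrite inrm0.
have bp : 0 < nrm b by rewrite lt_neqAle eq_sym b0 nrm_ge0.
have h : nrm ((nrm b)^-1%:C *: b) <= 1.
  by rewrite nrmZ cabsR gtr0_norm ?invr_gt0// mulVf.
move=> x dx; have := rep_contractive1 h dx; rewrite repZ mul1r.
rewrite (_ : ((nrm b)^-1%:C *: rho b) x = (nrm b)^-1%:C *: rho b x)//.
rewrite (hm_scale hX _ (rep_dom b dx)) cabsR gtr0_norm ?invr_gt0//.
by rewrite ler_pdivrMl.
Qed.

(* [rho d = 0] because [rho b] is bounded below by [s > r] on the range of [rho d]. *)
Lemma rep_cut b r s : 0 <= r -> r < s -> bounded_by (rho b) r ->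
  exists d, [/\ astar d = d, rho d = 0 &
    pos (iota (unitization_of B) d +
      ((s * s)%:C%:A - iota (unitization_of B) (amul (astar b) b)))].
Proof.
move=> r0 rs hb; have [d [e [sd se de pd]]] := cut b s.
exists d; split=> //.
apply: (adjointable_eq (rep_adjointable d) (adjointable0 hX)) => x dx.
rewrite [RHS]/(0 : X); apply: (hm_def hX); first exact: rep_dom.
have dd := rep_dom d dx; have de' := rep_dom e dx; have db := rep_dom b dd.
have key : ip (rho b (rho d x)) (rho b (rho d x)) =
    ip (s%:C *: rho d x) (s%:C *: rho d x) + ip (rho e x) (rho e x).
  rewrite rep_ip// (hm_ipZ hX)//; last exact: domZ.
  rewrite conjR scalerA -rmorphM /=.
  rewrite -[rho (amul (astar b) b) (rho d x)]/((rho (amul (astar b) b) \o rho d) x).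
  rewrite -repM rep_ip// sd de rep_ip// se.
  rewrite repD repZ (_ : (_ + _) x = (s * s)%:C *: rho (amul d d) x + rho (amul e e) x)//.
  rewrite (hm_ipDr hX dx (domZ hX _ (rep_dom _ dx)) (rep_dom _ dx)); congr (_ + _).
  apply: (hm_ipZr hX) => //; try exact: rep_dom.
  by rewrite rep_ip// sd.
have h1 : (s * inrm (rho d x)) ^+ 2 <= inrm (rho b (rho d x)) ^+ 2.
  rewrite (inrm_sq (rho b _)) key.
  have -> : s * inrm (rho d x) = inrm (s%:C *: rho d x).
    by rewrite (hm_scale hX)// cabsR ger0_norm//; lra.
  by rewrite inrm_sq; apply: (hm_mono hX) => //; exact: domZ.
have h2 := hb _ dd; have d0 := inrm_ge0 (rho d x); have b0 := inrm_ge0 (rho b (rho d x)).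
rewrite ler_pXn2r// ?nnegrE ?mulr_ge0// in h1; last by lra.
apply/eqP; rewrite eq_le d0 andbT; nra.
Qed.

(** The element [d] of [rep_cut] records the excess of [b^*b] over [(r + e)^2] and is killed by
    [rho]; injectivity makes it 0, so there is no excess. *)
Lemma rep_isometric b r : injective rho -> 0 <= r -> bounded_by (rho b) r ->
  nrm b <= r.
Proof.
move=> inj r0 hb; apply/ler_addgt0Pr => e e0.
have [|d [sd d0 pd]] := @rep_cut b r (r + e) r0 _ hb; first by rewrite ltrDl.
have d00 : d = 0 by apply: inj; rewrite d0 rep0.
rewrite d00 iota0 add0r in pd.
by apply: nrm_cut0 pd; lra.
Qed.

End Representations.

(** * Homomorphisms: contractivity, lifting and closed range *)

Section Morphisms.
Context {R : realType} {B D : cstarType R} {phi : B -> D}.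
Hypothesis hphi : star_hom (S := alg_ops B) (S' := alg_ops D) setT setT phi.
Local Open Scope complex_scope.
Implicit Types (a b : B) (r : R).

Lemma homM a b : phi (amul a b) = amul (phi a) (phi b).
Proof. by case: hphi => _ _ h _; exact: h. Qed.

Lemma homS a : phi (astar a) = astar (phi a).
Proof. by case: hphi => _ _ _ h; exact: h. Qed.

Lemma homP (k : R[i]) a b : phi (k *: a + b) = k *: phi a + phi b.
Proof. by case: hphi => _ h _ _; exact: h. Qed.

Lemma homD a b : phi (a + b) = phi a + phi b.
Proof. by have := homP 1 a b; rewrite !scale1r. Qed.

Lemma hom0 : phi 0 = 0.
Proof. by apply: (addrI (phi 0)); rewrite -homD !addr0. Qed.

Lemma homZ (k : R[i]) a : phi (k *: a) = k *: phi a.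
Proof. by have := homP k a 0; rewrite hom0 !addr0. Qed.

Lemma homB a b : phi (a - b) = phi a - phi b.
Proof. by rewrite homD -scaleN1r homZ scaleN1r. Qed.

Lemma lmul_adjoint (d : D) : is_adjoint (lmul d) (lmul (astar d)).
Proof.
have sm (c : D) : @self_map R (selfmod D) (lmul c) by split=> // x [].
by split=> // x y _ _; rewrite /= /lmul astarM amulA.
Qed.

(** Letting [phi b] act on the Hilbert module [D] makes the results on representations available for
    homomorphisms. *)
Lemma lmul_representation : @representation R B (selfmod D) (fun b => lmul (phi b)).
Proof.
have h := hmodule_selfmod D.
split.
- by move=> b _; exists (lmul (astar (phi b))); exact: lmul_adjoint.
- move=> k a b _ _; apply/funext => x.
  by rewrite /lmul homP; exact: amulPl.
- by move=> a b _ _; apply/funext => x; rewrite /lmul /= homM amulA.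
- by move=> b _ /=; rewrite homS; apply/esym/(adjE h)/lmul_adjoint.
Qed.

Lemma hom_contractive b : nrm (phi b) <= nrm b.
Proof.
have h := hmodule_selfmod D.
have := rep_contractive h lmul_representation b (x := astar (phi b)) I.
rewrite !inrm_selfmod /lmul nrm_mulstar nrmS.
have := nrm_ge0 (phi b); rewrite le_eqVlt => /orP[/eqP <- _|p]; first exact: nrm_ge0.
by rewrite expr2 ler_pM2r.
Qed.

(** [rep_cut] bounds [b^*b] by [s^2] modulo an element of the kernel, with [s = ||phi b|| + r/2],
    and [quot_bound] for the kernel then corrects [b] to [b - b w]. The slack [r^2/2] keeps
    [s^2 + r^2/2] below [(||phi b|| + r)^2]. *)
Lemma hom_lift b r : 0 < r -> exists2 c, phi c = phi b & nrm c <= nrm (phi b) + r.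
Proof.
move=> r0; have h := hmodule_selfmod D.
have n0 := nrm_ge0 (phi b).
have hb : @bounded_by R (selfmod D) (lmul (phi b)) (nrm (phi b)).
  by move=> x _; rewrite !inrm_selfmod; exact: nrmM.
have [|d [sd d0 pd]] := rep_cut h lmul_representation (b := b) (s := nrm (phi b) + r / 2) n0 _ hb.
  by rewrite ltrDl divr_gt0.
have {}d0 : phi d = 0.
  by apply: amul_eq0 => x; exact: (congr1 (fun f => f x) d0).
have [|||||||||w Jw hw] := @quot_bound R B [set c | phi c = 0] b d
    ((nrm (phi b) + r / 2) * (nrm (phi b) + r / 2)) (r * r / 2).
- exact: hom0.
- by move=> x y /= hx hy; rewrite homD hx hy addr0.
- by move=> k x /= hx; rewrite homZ hx scaler0.
- by move=> x y /= hx hy; rewrite homM hx amul0l.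
- exact: d0.
- exact: sd.
- by rewrite mulr_ge0//; lra.
- by rewrite divr_gt0// mulr_gt0.
- by rewrite [X in pos (X - _)]addrC -addrA.
- exists (b - amul b w).
    by rewrite homB homM Jw amul0r subr0.
  rewrite -(@ler_pXn2r _ 2)// ?nnegrE ?nrm_ge0//; last by lra.
  by apply: le_trans hw _; rewrite !expr2; nra.
Qed.

Lemma geometric_cauchy (V : normedModType R[i]) (u : nat -> V) (C : R) :
  (forall n, nrm (u n.+1 - u n) <= C * 2^-1 ^+ n) -> cauchyto nrm u.
Proof.
move=> h; have half : (2^-1 : R) ^+ _ >= 0 by move=> n; rewrite exprn_ge0.
have C0 : 0 <= C by have := le_trans (nrm_ge0 _) (h 0%N); rewrite expr0 mulr1.
have key n k : nrm (u (k + n)%N - u n) <= 2 * C * 2^-1 ^+ n - 2 * C * 2^-1 ^+ (k + n).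
  elim: k => [|k IH]; first by rewrite !subrr nrm0.
  rewrite addSn; apply: le_trans (nrm_tri (u (k + n)%N) _ _) _.
  have := h (k + n)%N; rewrite exprS; lra.
have key0 m n : (n <= m)%N -> nrm (u m - u n) <= 2 * C * 2^-1 ^+ n.
  move=> /subnK <-; apply: le_trans (key _ _) _; rewrite gerBl.
  by rewrite mulr_ge0// mulr_ge0.
move=> e e0; have [N N0 hN] := exists_small_inv e0 (ltac:(lra) : 0 <= 4 * C + 1).
have h2 : 2^-1 ^+ N <= N%:R^-1 :> R.
  by rewrite exprVn lef_pV2 ?posrE ?exprn_gt0 ?ltr0n// -natrX ler_nat ltnW// ltn_expl.
exists N => m n hm hn; apply: le_lt_trans (nrm_tri (u N) _ _) _.
have := key0 m N hm; have := key0 n N hn; rewrite (nrm_distC (u n)).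
have Np : 0 < N%:R^-1 :> R by rewrite invr_gt0 ltr0n.
nra.
Qed.

(** Preimages [b n] of approximations of [y] need not converge. They are replaced by [u n] with the
    same images, where each step adds a lift of [phi (b n.+1) - phi (b n)] of nearly minimal norm,
    so the increments are geometric. *)
Lemma hom_image_closed : closure (range phi) `<=` range phi.
Proof.
move=> y /closure_nrm hy.
have half0 n : (0 : R) < 2^-1 ^+ n by rewrite exprn_gt0.
have /choice[b hb] : forall n, exists b, nrm (y - phi b) <= 2^-1 ^+ n.
  by move=> n; have [_ [b _ <-] h] := hy _ (half0 n); exists b.
have /choice[L hL] : forall p : B * nat, exists c,
    phi c = phi p.1 /\ nrm c <= nrm (phi p.1) + 2^-1 ^+ p.2.
  by move=> [c n]; have [c' h1 h2] := hom_lift c (half0 n); exists c'.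
pose fix u n := if n is m.+1 then u m + L (b m.+1 - u m, m) else b 0%N.
have phu n : phi (u n) = phi (b n).
  elim: n => //= n IH; rewrite homD (proj1 (hL _)) homB /=.
  by rewrite addrC subrK.
have uinc n : nrm (u n.+1 - u n) <= 3 * 2^-1 ^+ n.
  rewrite /= addrC addKr; apply: le_trans (proj2 (hL _)) _ => /=.
  rewrite homB phu; have := nrm_tri y (phi (b n.+1)) (phi (b n)).
  have := hb n.+1; have := hb n; rewrite (nrm_distC y (phi (b n.+1))) exprS.
  have := half0 n; lra.
have [l ul] := nrm_complete (geometric_cauchy uinc).
exists l => //; apply/eqP; rewrite -subr_eq0; apply/eqP/nrm_small => e e0.
have e2 : 0 < e / 2 by rewrite divr_gt0.
have [n0 hn0] := ul _ e2.
have [N N0 hN] := exists_small_inv e2 ler01.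
pose n := maxn n0 N.
apply: le_trans (nrm_tri (phi (u n)) _ _) _; rewrite [e]splitr; apply: lerD.
  rewrite -homB; apply: le_trans (hom_contractive _) _.
  by rewrite nrm_distC ltW// hn0// leq_maxl.
rewrite phu nrm_distC; apply: le_trans (hb n) (le_trans _ hN); rewrite mul1r.
rewrite exprVn lef_pV2 ?posrE ?exprn_gt0 ?ltr0n// -natrX ler_nat.
by apply: leq_trans (leq_maxr n0 N) _; rewrite ltnW// ltn_expl.
Qed.

End Morphisms.

(** * The Hahn-Banach theorem *)

Section SublinearFunctionals.
Context {R : realType} {V : lmodType R[i]}.
Local Open Scope complex_scope.
Implicit Types (x y : V) (r s t : R) (p q : V -> R).

Record sublinear p : Prop := Sublinear {
  sub_add : forall x y, p (x + y) <= p x + p y;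
  sub_scale : forall r x, 0 < r -> p (r%:C *: x) = r * p x;
  sub0 : p 0 = 0
}.

Lemma sub_opp p x : sublinear p -> - p (- x) <= p x.
Proof. by move=> hp; have := sub_add hp x (- x); rewrite subrr sub0//; lra. Qed.

(* The largest sublinear functional below [p] that is linear along [y]. *)
Definition straighten p y x : R :=
  inf [set p (x + t%:C *: y) - t * p y | t in [set t | 0 <= t]].

Section Straighten.
Variables (p : V -> R) (hp : sublinear p) (y : V).

Let sub_scale0 r x : 0 <= r -> p (r%:C *: x) = r * p x.
Proof.
rewrite le_eqVlt => /orP[/eqP <-|]; first by rewrite scale0r mul0r (sub0 hp).
exact: sub_scale.
Qed.

Lemma straighten_lb x t : 0 <= t -> - p (- x) <= p (x + t%:C *: y) - t * p y.
Proof.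
move=> t0; have := sub_add hp (x + t%:C *: y) (- x).
by rewrite addrAC subrr add0r sub_scale0//; lra.
Qed.

Lemma straighten_has_inf x :
  has_inf [set p (x + t%:C *: y) - t * p y | t in [set t | 0 <= t]].
Proof.
split; first by exists (p (x + 0%:C *: y) - 0 * p y), 0 => /=.
by exists (- p (- x)) => _ [t /= t0 <-]; exact: straighten_lb.
Qed.

Lemma straighten_le_at x t : 0 <= t -> straighten p y x <= p (x + t%:C *: y) - t * p y.
Proof.
move=> t0; apply: ge_inf; first by case: (straighten_has_inf x).
by exists t.
Qed.

Lemma straighten_adherent x e : 0 < e ->
  exists2 t, 0 <= t & p (x + t%:C *: y) - t * p y < straighten p y x + e.
Proof.
by move=> e0; have [_ [t /= t0 <-] h] := inf_adherent e0 (straighten_has_inf x); exists t.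
Qed.

Lemma straighten_le x : straighten p y x <= p x.
Proof.
by have := @straighten_le_at x 0 (lexx _); rewrite scale0r addr0 mul0r subr0.
Qed.

Lemma straighten_opp : straighten p y (- y) <= - p y.
Proof.
have := @straighten_le_at (- y) 1 ler01.
by rewrite rmorph1 scale1r addNr (sub0 hp) mul1r add0r.
Qed.

Lemma straighten_sublinear : sublinear (straighten p y).
Proof.
split.
- move=> x x'; apply/ler_addgt0Pr => e e0.
  have e2 : 0 < e / 2 by rewrite divr_gt0.
  have [t t0 ht] := straighten_adherent x e2.
  have [t' t0' ht'] := straighten_adherent x' e2.
  have := straighten_le_at (x + x') (addr_ge0 t0 t0').
  have -> : x + x' + (t + t')%:C *: y = (x + t%:C *: y) + (x' + t'%:C *: y).
    by linring R V.
  have := sub_add hp (x + t%:C *: y) (x' + t'%:C *: y); lra.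
- have h r x : 0 < r -> straighten p y (r%:C *: x) <= r * straighten p y x.
    move=> r0; apply/ler_addgt0Pr => e e0.
    have [t t0 ht] := straighten_adherent x (divr_gt0 e0 r0).
    have := straighten_le_at (r%:C *: x) (mulr_ge0 (ltW r0) t0).
    have -> : r%:C *: x + (r * t)%:C *: y = r%:C *: (x + t%:C *: y) by linring R V.
    rewrite (sub_scale hp)//; rewrite -(ltr_pM2l r0) !mulrDr mulrN in ht.
    rewrite [r * (e / r)]mulrC divfK ?gt_eqF// in ht; lra.
  move=> r x r0; apply/eqP; rewrite eq_le h//=.
  have := h r^-1 (r%:C *: x); rewrite invr_gt0 => /(_ r0).
  by rewrite scalerA -rmorphM /= mulVf ?gt_eqF// scale1r ler_pdivlMl.
- apply/eqP; rewrite eq_le; apply/andP; split.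
    by apply: le_trans (straighten_le _) _; rewrite (sub0 hp).
  apply: lb_le_inf; first by case: (straighten_has_inf 0).
  move=> _ [t /= t0 <-]; apply: le_trans (straighten_lb 0 t0).
  by rewrite oppr0 (sub0 hp) oppr0.
Qed.

End Straighten.

(** Zorn's lemma for the reverse order. The infimum of a chain is finite because every member
    satisfies [- q (- x) <= p x], and it is subadditive because any two members are comparable. *)
Lemma minimal_sublinear q : sublinear q -> exists p,
  [/\ sublinear p, forall x, p x <= q x &
   forall p', sublinear p' -> (forall x, p' x <= p x) -> forall x, p' x = p x].
Proof.
move=> hq; pose T := {p : V -> R | sublinear p /\ forall x, p x <= q x}.
pose le (p1 p2 : T) := `[< forall x, sval p2 x <= sval p1 x >].
have [[p [hp pq]] hmin] : exists t : T, forall s : T, le t s -> s = t.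
  apply: Zorn.
  - by move=> t; apply/asboolP.
  - move=> r s t /asboolP h1 /asboolP h2; apply/asboolP => x.
    exact: le_trans (h2 x) (h1 x).
  - move=> [s hs] [t ht] /asboolP /= h1 /asboolP /= h2; apply: eq_exist.
    by apply/funext => x; apply/eqP; rewrite eq_le h1 h2.
  - move=> C totC; have [[p0 Cp0]|C0] := pselect (exists p0 : T, C p0); last first.
      by exists (exist _ q (conj hq (fun x => lexx _))) => s Cs; case: C0; exists s.
    pose E x := [set sval u x | u in C].
    have hE x : has_inf (E x).
      split; first by exists (sval p0 x), p0.
      exists (- q (- x)) => _ [[p [hp pq]] Cp <-] /=.
      by apply: le_trans (sub_opp x hp); rewrite lerN2.
    pose pi x := inf (E x).
    have pi_le (p : T) x : C p -> pi x <= sval p x.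
      by move=> Cp; apply: ge_inf; [case: (hE x) | exists p].
    have pi_adh x e : 0 < e -> exists2 p : T, C p & sval p x < pi x + e.
      by move=> e0; have [_ [p Cp <-] h] := inf_adherent e0 (hE x); exists p.
    have hpi : sublinear pi.
      split.
      - move=> x y; apply/ler_addgt0Pr => e e0.
        have e2 : 0 < e / 2 by rewrite divr_gt0.
        have [p1 C1 h1] := pi_adh x _ e2; have [p2 C2 h2] := pi_adh y _ e2.
        have [/asboolP h|/asboolP h] := totC _ _ C1 C2.
          have := pi_le _ (x + y) C2; have [hs _] := svalP p2.
          have := sub_add hs x y; have := h x; lra.
        have := pi_le _ (x + y) C1; have [hs _] := svalP p1.
        have := sub_add hs x y; have := h y; lra.
      - have h r x : 0 < r -> pi (r%:C *: x) <= r * pi x.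
          move=> r0; apply/ler_addgt0Pr => e e0.
          have [p Cp h] := pi_adh x _ (divr_gt0 e0 r0); have [hs _] := svalP p.
          have := pi_le _ (r%:C *: x) Cp; rewrite (sub_scale hs)//.
          rewrite -(ltr_pM2l r0) mulrDr [r * (e / r)]mulrC divfK ?gt_eqF// in h; lra.
        move=> r x r0; apply/eqP; rewrite eq_le h//=.
        have := h r^-1 (r%:C *: x); rewrite invr_gt0 => /(_ r0).
        by rewrite scalerA -rmorphM /= mulVf ?gt_eqF// scale1r ler_pdivlMl.
      - apply/eqP; rewrite eq_le; apply/andP; split.
          by apply: le_trans (pi_le _ 0 Cp0) _; have [hs _] := svalP p0; rewrite (sub0 hs).
        apply: lb_le_inf; first by case: (hE 0).
        by move=> _ [p Cp <-]; have [hs _] := svalP p; rewrite (sub0 hs).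
    have piq x : pi x <= q x.
      by apply: le_trans (pi_le _ x Cp0) _; have [_] := svalP p0.
    exists (exist _ pi (conj hpi piq)) => p Cp; apply/asboolP => x /=.
    exact: pi_le.
exists p; split=> // p' hp' pp' x.
have p'q y : p' y <= q y by exact: le_trans (pp' y) (pq y).
have := hmin (exist _ p' (conj hp' p'q)) => /(_ _)/(congr1 sval) /= ->//.
by apply/asboolP.
Qed.

(** A minimal [p] below [straighten q y] coincides with each [straighten p x], hence is odd by
    [straighten_opp], hence additive. Starting from [straighten q y] instead of [q] forces
    [p (- y) <= - q y], which gives the value at [y]. *)
Lemma hahn_banach q y : sublinear q -> exists f : V -> R,
  [/\ forall x x', f (x + x') = f x + f x',
      forall r x, f (r%:C *: x) = r * f x,
      forall x, f x <= q x & f y = q y].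
Proof.
move=> hq; have [p [hp pq hmin]] := minimal_sublinear (straighten_sublinear hq y).
have popp x : p (- x) = - p x.
  apply/eqP; rewrite eq_le; apply/andP; split.
    rewrite -(hmin _ (straighten_sublinear hp x)).
      exact: straighten_opp.
    exact: straighten_le.
  by have := sub_opp (- x) hp; rewrite opprK; lra.
have padd x x' : p (x + x') = p x + p x'.
  apply/eqP; rewrite eq_le (sub_add hp)/=.
  by have := sub_add hp (x + x') (- x'); rewrite addrK popp; lra.
exists p; split=> //.
- move=> r x; have [r0|r0|->] := ltgtP r 0.
  + have -> : r%:C *: x = - ((- r)%:C *: x) by linring R V.
    by rewrite popp (sub_scale hp) ?oppr_gt0//; ring.
  + exact: sub_scale.
  + by rewrite scale0r mul0r (sub0 hp).
- by move=> x; apply: le_trans (pq x) (straighten_le hq y x).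
- apply/eqP; rewrite eq_le (le_trans (pq y) (straighten_le hq y y))/=.
  by have := le_trans (pq (- y)) (straighten_opp hq y); rewrite popp; lra.
Qed.

End SublinearFunctionals.

(** * States vanishing on an ideal *)

Section StateOffIdeal.
Context {R : realType} {B : cstarType R}.
Local Open Scope complex_scope.
Local Notation U := (uz (unitization_of B)).
Local Notation iota := (iota (unitization_of B)).
Local Notation uchi := (@uchi _ _ (unitization_of B)).

Record closed_ideal (I : set B) : Prop := ClosedIdeal {
  ci0 : I 0;
  ciD : forall x y, I x -> I y -> I (x + y);
  ciZ : forall (k : R[i]) x, I x -> I (k *: x);
  ciMr : forall x y, I x -> I (amul x y);
  ciMl : forall x y, I y -> I (amul x y);
  ciS : forall x, I x -> I (astar x);
  ci_closed : closure I `<=` I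
}.

Variables (I : set B) (hI : closed_ideal I).

Definition re_part (z : U) : U := (2^-1)%:C *: (z + ustar z).

Lemma re_partD z w : re_part (z + w) = re_part z + re_part w.
Proof. by rewrite /re_part ustarD; linring R (uz (unitization_of B)). Qed.

Lemma re_partZ (r : R) z : re_part (r%:C *: z) = r%:C *: re_part z.
Proof. by rewrite /re_part ustarZr; linring R (uz (unitization_of B)). Qed.

Lemma re_part_selfadj z : selfadj (re_part z).
Proof. by rewrite /selfadj /re_part ustarZr ustarD ustarK addrC. Qed.

Lemma half_double : (2^-1)%:C + (2^-1)%:C = 1 :> R[i].
Proof. by rewrite -rmorphD /= (_ : 2^-1 + 2^-1 = 1 :> R) //; lra. Qed.

Lemma re_part_id z : selfadj z -> re_part z = z.
Proof. by move=> sz; rewrite /re_part sz scalerDr -scalerDl half_double scale1r. Qed.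

Lemma re_part_skew z : ustar z = - z -> re_part z = 0.
Proof. by move=> sz; rewrite /re_part sz subrr scaler0. Qed.

Lemma unorm_re_part z : unorm (re_part z) <= unorm z.
Proof.
rewrite unormZr ger0_norm ?invr_ge0//.
by have := unormD z (ustar z); rewrite unormS; lra.
Qed.

(* The infimum of this set is the supremum of the spectrum of the real part of
   [z] in the quotient of the unitization by [I], computed without the quotient. *)
Definition gauge_set (z : U) : set R :=
  [set t | exists i, [/\ I i, astar i = i & pos (t%:C%:A + iota i - re_part z)]].

Definition gauge (z : U) : R := inf (gauge_set z).

Lemma gauge_set_norm z : gauge_set z (unorm (re_part z)).
Proof.
exists 0; split; [exact: ci0 | exact: astar0 |].
by rewrite iota0 addr0; apply: pos_sub => //; exact: re_part_selfadj.
Qed.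

(** The character of the unitization vanishes on [iota i], so it bounds [t] from below independently
    of [i]. *)
Lemma gauge_set_lb z t : gauge_set z t -> - unorm (re_part z) <= t.
Proof.
move=> [i [Ii si /pos_uchi[r r0 hr]]].
have [s hs] := selfadj_uchi (re_part_selfadj z).
rewrite uchiB uchiD uchiA uchi_iota addr0 hs -rmorphB in hr.
have {}hr := complexI hr; have := uchi_le (re_part z).
by rewrite hs cabsR ler_norml => /andP[]; lra.
Qed.

Lemma gauge_has_inf z : has_inf (gauge_set z).
Proof.
split; first by exists (unorm (re_part z)); exact: gauge_set_norm.
by exists (- unorm (re_part z)) => t; exact: gauge_set_lb.
Qed.

Lemma gauge_le z t : gauge_set z t -> gauge z <= t.
Proof. by move=> h; apply: ge_inf => //; case: (gauge_has_inf z). Qed.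

Lemma gauge_adherent z (e : R) : 0 < e -> exists2 t, gauge_set z t & t < gauge z + e.
Proof. by move=> e0; have [t ht h] := inf_adherent e0 (gauge_has_inf z); exists t. Qed.

Lemma gauge_norm z : gauge z <= unorm z.
Proof. exact: le_trans (gauge_le (gauge_set_norm z)) (unorm_re_part z). Qed.

Lemma gauge_sublinear : sublinear gauge.
Proof.
have re0 : re_part 0 = 0 by rewrite /re_part ustar0 addr0 scaler0.
split.
- move=> z w; apply/ler_addgt0Pr => e e0.
  have e2 : 0 < e / 2 by rewrite divr_gt0.
  have [t [i [Ii si hi]] ht] := gauge_adherent z e2.
  have [s [j [Ij sj hj]] hs] := gauge_adherent w e2.
  have : gauge_set (z + w) (t + s).
    exists (i + j); split; [exact: ciD | by rewrite astarD si sj |].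
    have := posD hi hj; rewrite iotaD re_partD.
    have -> // : (t + s)%:C%:A + (iota i + iota j) - (re_part z + re_part w) =
      t%:C%:A + iota i - re_part z + (s%:C%:A + iota j - re_part w).
    by linring R (uz (unitization_of B)).
  by move/gauge_le; lra.
- have h (r : R) z : 0 < r -> gauge (r%:C *: z) <= r * gauge z.
    move=> r0; apply/ler_addgt0Pr => e e0.
    have [t [i [Ii si hi]] ht] := gauge_adherent z (divr_gt0 e0 r0).
    have : gauge_set (r%:C *: z) (r * t).
      exists (r%:C *: i); split; [exact: ciZ | by rewrite astarZ conjR si |].
      have := posZ (ltW r0) hi; rewrite iotaZ re_partZ.
      have -> // : (r * t)%:C%:A + r%:C *: iota i - r%:C *: re_part z =
        r%:C *: (t%:C%:A + iota i - re_part z) by linring R (uz (unitization_of B)).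
    move/gauge_le; rewrite -(ltr_pM2l r0) mulrDr [r * (e / r)]mulrC in ht.
    by rewrite divfK ?gt_eqF// in ht; lra.
  move=> r z r0; apply/eqP; rewrite eq_le h//=.
  have := h r^-1 (r%:C *: z); rewrite invr_gt0 => /(_ r0).
  by rewrite scalerA -rmorphM /= mulVf ?gt_eqF// scale1r ler_pdivlMl.
- apply/eqP; rewrite eq_le; apply/andP; split.
    by apply: le_trans (gauge_norm 0) _; rewrite unorm0.
  apply: lb_le_inf; first by case: (gauge_has_inf 0).
  by move=> t /gauge_set_lb; rewrite re0 unorm0 oppr0.
Qed.

(** If the gauge were not positive, [b^*b <= d + i] with [i] in [I] for every [d > 0], and
    [quot_bound] would put [b] within sqrt(2d) of [b w] in [I]; [d = e^2/2] makes this distance [e],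
    against the closedness of [I]. *)
Lemma gauge_gt0 b : ~ I b -> 0 < gauge (iota (amul (astar b) b)).
Proof.
move=> nIb; rewrite ltNge; apply/negP => g0; apply: nIb.
apply: (ci_closed hI); apply/closure_nrm => e e0.
pose d := e * e / 2; have d0 : 0 < d by rewrite divr_gt0// mulr_gt0.
have [t [i [Ii si hi]] ht] := gauge_adherent (iota (amul (astar b) b)) d0.
have [|||||||||w Iw hw] := @quot_bound R B I b i d d.
- exact: ci0.
- by move=> *; exact: ciD.
- by move=> *; exact: ciZ.
- by move=> *; exact: ciMr.
- exact: Ii.
- exact: si.
- exact: ltW.
- exact: d0.
- rewrite re_part_id in hi; last by rewrite iotaM iotaS; exact: selfadj_starM.
  have -> : d%:C%:A + iota i - iota (amul (astar b) b) =
    (t%:C%:A + iota i - iota (amul (astar b) b)) + (d - t)%:C%:A.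
    by linring R (uz (unitization_of B)).
  by apply: posD => //; apply: pos_scalar; lra.
- exists (amul b w); first exact: ciMl.
  rewrite -(@ler_pXn2r _ 2)// ?nnegrE ?nrm_ge0//; last exact: ltW.
  by apply: le_trans hw _; rewrite /d; lra.
Qed.

(** In the absence of a unit, [ss_norm] takes the place of normalization: it makes the GNS seminorm
    at most the norm. *)
Record separating_state (b : B) (F : B -> R[i]) : Prop := SeparatingState {
  ssP : forall (k : R[i]) x y, F (k *: x + y) = k * F x + F y;
  ssS : forall x, F (astar x) = Num.conj (F x);
  ss_pos : forall x, posA x -> 0 <= F x;
  ss_norm : forall x, posA x -> F x <= (nrm x)%:C;
  ss_ideal : forall x, I x -> F x = 0;
  ss_neq0 : F (amul (astar b) b) != 0
}.

(** A real functional dominated by the gauge is at most 0 wherever the gauge is: on negative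
    elements, and on both signs of skew-adjoint elements and of elements of [I]. The Hahn-Banach
    theorem makes it attain the positive gauge of [b^*b]. *)
Lemma exists_separating_state b : ~ I b -> exists F, separating_state b F.
Proof.
move=> nIb; have [f [fD fZ fle fb]] := hahn_banach (iota (amul (astar b) b)) gauge_sublinear.
have fN z : f (- z) = - f z.
  have -> : - z = (-1)%:C *: z by rewrite rmorphN1 scaleN1r.
  by rewrite fZ mulN1r.
have gauge_le0 z i : I i -> astar i = i -> pos (iota i - re_part z) -> f z <= 0.
  move=> Ii si hi; apply: le_trans (fle z) (gauge_le _); exists i; split=> //.
  by rewrite scale0r add0r.
have f_skew z : ustar z = - z -> f z = 0.
  move=> sz; apply/eqP; rewrite eq_le; apply/andP; split.
    apply: (gauge_le0 z 0); [exact: ci0 | exact: astar0 |].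
    by rewrite re_part_skew// iota0 subrr; exact: pos0.
  rewrite -oppr_le0 -fN; apply: (gauge_le0 _ 0); [exact: ci0 | exact: astar0 |].
  by rewrite re_part_skew ?ustarN ?sz// iota0 subrr; exact: pos0.
have f_star z : f (ustar z) = f z.
  have : f (z - ustar z) = 0 by apply: f_skew; rewrite ustarB ustarK opprB.
  by rewrite fD fN; lra.
have f_pos z : pos z -> 0 <= f z.
  move=> pz; rewrite -oppr_le0 -fN; apply: (gauge_le0 _ 0); [exact: ci0 | exact: astar0 |].
  rewrite re_part_id ?opprK ?iota0 ?add0r//.
  exact/selfadjN/pos_selfadj.
have f_ideal i : I i -> f (iota i) = 0.
  move=> Ii; pose j := (2^-1)%:C *: (i + astar i).
  have sj : astar j = j by rewrite /j astarZ conjR astarD astarK addrC.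
  have Ij : I j by apply: (ciZ hI); apply: (ciD hI) => //; exact: (ciS hI).
  have jE : re_part (iota i) = iota j by rewrite /re_part /j iotaZ iotaD iotaS.
  apply/eqP; rewrite eq_le; apply/andP; split.
    by apply: (gauge_le0 _ j) => //; rewrite jE subrr; exact: pos0.
  rewrite -oppr_le0 -fN; apply: (gauge_le0 _ (- j)).
  - by rewrite -scaleN1r; exact: ciZ.
  - by rewrite astarN sj.
  - have -> : re_part (- iota i) = - iota j.
      by rewrite -jE /re_part ustarN -opprD scalerN.
    by rewrite iotaN subrr; exact: pos0.
pose i := ('i : R[i]).
have ii : i * i = -1 by rewrite -expr2 sqrCi.
have fii z : f (i *: (i *: z)) = - f z by rewrite scalerA ii scaleN1r fN.
(* The complex-linear functional with real part [f]. It is real on self-adjoint [z], because there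
   [i z] is skew-adjoint and [f] vanishes on it. *)
pose F z : R[i] := (f z)%:C - i * (f (i *: z))%:C.
have FD z w : F (z + w) = F z + F w.
  by rewrite /F scalerDr !fD !rmorphD /=; ring.
have FZr (r : R) z : F (r%:C *: z) = r%:C * F z.
  have h : i *: (r%:C *: z) = r%:C *: (i *: z) by rewrite !scalerA mulrC.
  by rewrite /F h !fZ !rmorphM; ring.
have Fi z : F (i *: z) = i * F z.
  rewrite /F fii rmorphN mulrBr mulrA ii; ring.
have FZ (k : R[i]) z : F (k *: z) = k * F z.
  have -> : k *: z = (complex.Re k)%:C *: z + i *: ((complex.Im k)%:C *: z).
    by rewrite {1}[k]complexE scalerDl scalerA complexiE.
  by rewrite FD FZr Fi FZr mulrA -mulrDl [in RHS](complexE k) complexiE.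
have Freal z : selfadj z -> F z = (f z)%:C.
  move=> sz; rewrite /F (f_skew (i *: z)) ?mulr0 ?subr0//.
  by rewrite ustarZ sz conji scaleNr.
exists (fun x => F (iota x)); split.
- by move=> k x y; rewrite iotaD iotaZ FD FZ.
- move=> x; rewrite iotaS /F f_star conjB conjM !conjR conji.
  have -> : i *: ustar (iota x) = - ustar (i *: iota x).
    by rewrite ustarZ conji scaleNr opprK.
  by rewrite fN f_star rmorphN mulrN mulNr.
- by move=> x px; rewrite Freal ?ler0c; [exact: f_pos | exact: pos_selfadj].
- move=> x px; rewrite Freal; last exact: pos_selfadj.
  rewrite lecR -(unorm_iota (unitization_of B)).
  exact: le_trans (fle _) (gauge_norm _).
- move=> x Ix; rewrite /F f_ideal// (_ : i *: iota x = iota (i *: x)) ?iotaZ//.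
  by rewrite -iotaZ f_ideal ?mulr0 ?subr0//; exact: ciZ.
- rewrite Freal; last by rewrite iotaM iotaS; exact: selfadj_starM.
  by rewrite fb; apply/eqP => /(@complexI R _ 0) h; have := gauge_gt0 nIb; rewrite h ltxx.
Qed.

End StateOffIdeal.

(** * Limits of complex sequences *)

Section ComplexLimits.
Context {R : realType}.
Local Open Scope complex_scope.
Implicit Types (u v : nat -> R[i]) (k l : R[i]).

Lemma cabs_cvtoP k u v l m : cvto cabs u l -> cvto cabs v m ->
  cvto cabs (fun n => k * u n + v n) (k * l + m).
Proof.
move=> hu hv e e0; pose M := cabs k + 1.
have M0 : 0 < M by have := cabs_ge0 k; rewrite /M; lra.
have [n0 h0] := hu (e / (2 * M)) ltac:(by rewrite divr_gt0// mulr_gt0).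
have [n1 h1] := hv (e / 2) ltac:(by rewrite divr_gt0).
exists (maxn n0 n1) => n; rewrite geq_max => /andP[/h0 a /h1 b].
have -> : k * u n + v n - (k * l + m) = k * (u n - l) + (v n - m) by ring.
apply: le_lt_trans (cabsD _ _) _; rewrite cabsM.
rewrite ltr_pdivlMr ?mulr_gt0// /M in a.
have := cabs_ge0 (u n - l); have := cabs_ge0 k; nra.
Qed.

Lemma cabs_cvto_conj u l : cvto cabs u l ->
  cvto cabs (fun n => Num.conj (u n)) (Num.conj l).
Proof.
move=> hu e e0; have [n0 h0] := hu e e0; exists n0 => n hn.
by rewrite -conjB cabsJ; exact: h0.
Qed.

Lemma cabs_cvto_unique u l l' : cvto cabs u l -> cvto cabs u l' -> l = l'.
Proof. exact: (@cvto_unique R (R[i]^o)). Qed.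

Lemma cabs_cvto_cst l : cvto cabs (fun=> l) l.
Proof. by move=> e e0; exists 0%N => n _; rewrite subrr cabs0. Qed.

Lemma cabs_cvto_ge0 u l : cvto cabs u l -> (forall n, 0 <= u n) -> 0 <= l.
Proof.
move=> hu h.
have hi : complex.Im l = 0.
  apply/eqP; rewrite -normr_le0; apply/ler_addgt0Pr => e e0; rewrite add0r.
  have [n0 /(_ n0 (leqnn _)) hn] := hu e e0.
  have := le_lt_trans (Im_le_cabs _) hn; have := h n0; rewrite lecE => /andP[/eqP hz _].
  by rewrite raddfB /= hz sub0r normrN => /ltW.
rewrite lecE hi eqxx /=; apply/ler_addgt0Pr => e e0.
have [n0 /(_ n0 (leqnn _)) hn] := hu e e0.
have := le_lt_trans (Re_le_cabs _) hn; have := h n0; rewrite lecE => /andP[_ /= hz].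
by rewrite raddfB /= ltr_norml => /andP[]; lra.
Qed.

Lemma cabs_cvto_le u l M : cvto cabs u l -> (exists n0, forall n, (n0 <= n)%N -> cabs (u n) <= M) ->
  cabs l <= M.
Proof.
move=> hu [n0 h]; apply/ler_addgt0Pr => e e0; have [n1 h1] := hu e e0.
have := h1 _ (leq_maxr n0 n1); have := h _ (leq_maxl n0 n1).
have := cabsD (u (maxn n0 n1)) (- (u (maxn n0 n1) - l)).
by rewrite cabsN subKr; lra.
Qed.

End ComplexLimits.

(** * Completion of a semi-inner product space *)

(** Bundling the form with the space lets the type [completion] depend on one argument and carry
    canonical structures. *)
Record semiSpace (R : realType) := SemiSpace {
  semi_vec : lmodType R[i];
  semi_form : semi_vec -> semi_vec -> R[i];
  semi_axiom : semi_inner semi_form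
}.

Section CompletionCarrier.
Context {R : realType} (S : semiSpace R).
Local Open Scope complex_scope.
Local Notation E := (semi_vec S).
Local Notation f := (@semi_form R S).
Local Notation hf := (@semi_axiom R S).
Local Notation sn := (seminorm f).
Implicit Types (u v w : nat -> E) (g h : E -> R[i]) (c d : E).

(* An element of the completion is the functional [c |-> lim f c (u n)] given by
   a Cauchy sequence [u], so that no quotient is needed. *)
Definition represents u g :=
  cauchyto sn u /\ forall c, cvto cabs (fun n => f c (u n)) (g c).

Lemma cauchy_lin (k : R[i]) u v : cauchyto sn u -> cauchyto sn v ->
  cauchyto sn (fun n => k *: u n + v n).
Proof.
move=> hu hv e e0; pose M := cabs k + 1.
have M0 : 0 < M by have := cabs_ge0 k; rewrite /M; lra.
have [n0 h0] := hu (e / (2 * M)) ltac:(by rewrite divr_gt0// mulr_gt0).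
have [n1 h1] := hv (e / 2) ltac:(by rewrite divr_gt0).
exists (maxn n0 n1) => m n; rewrite !geq_max => /andP[m0 m1] /andP[n0' n1'].
have -> : k *: u m + v m - (k *: u n + v n) = k *: (u m - u n) + (v m - v n).
  by linring R (semi_vec S).
apply: le_lt_trans (seminormD hf _ _) _; rewrite (seminormZ hf).
have a := h0 m n m0 n0'; have := h1 m n m1 n1'.
rewrite ltr_pdivlMr ?mulr_gt0// /M in a.
have := seminorm_ge0 f (u m - u n); have := cabs_ge0 k; nra.
Qed.

Lemma represents_lin (k : R[i]) u v g h : represents u g -> represents v h ->
  represents (fun n => k *: u n + v n) (k *: g + h).
Proof.
move=> [cu hu] [cv hv]; split; first exact: cauchy_lin.
move=> c; have := cabs_cvtoP k (hu c) (hv c); congr (cvto _ _ _).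
by apply/funext => n; rewrite (siP hf).
Qed.

Lemma represents_cst c : represents (fun=> c) (fun d => f d c).
Proof.
split; last by move=> d; exact: cabs_cvto_cst.
by move=> e e0; exists 0%N => m n _ _; rewrite subrr (seminorm0 hf).
Qed.

Lemma cauchy_bound u : cauchyto sn u ->
  exists K, 0 < K /\ exists n0, forall n, (n0 <= n)%N -> sn (u n) <= K.
Proof.
move=> hu; have [n0 h] := hu 1 ltr01; exists (sn (u n0) + 1); split.
  by have := seminorm_ge0 f (u n0); lra.
exists n0 => n hn; have := h n n0 hn (leqnn _).
have := seminormD hf (u n - u n0) (u n0); rewrite subrK; lra.
Qed.

(** For a fixed late index [m], ||w_n||^2 <= |<w_n - w_m, w_n>| + |<w_m, w_n>|: the first term is
    small by the Cauchy property and a bound [K] on the sequence, the second by weak convergence;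
    each is kept below [e^2/2]. *)
Lemma cauchy_null w : cauchyto sn w -> (forall c, cvto cabs (fun n => f c (w n)) 0) ->
  forall e : R, 0 < e -> exists N, forall n, (N <= n)%N -> sn (w n) < e.
Proof.
move=> cw hw e e0; have [K [K0 [n0 hK]]] := cauchy_bound cw.
have [n1 h1] := cw (e * e / (2 * K)) ltac:(by rewrite divr_gt0// mulr_gt0).
pose m := maxn n0 n1.
have [n2 h2] := hw (w m) (e * e / 2) ltac:(by rewrite divr_gt0// mulr_gt0).
exists (maxn m n2) => n; rewrite !geq_max => /andP[/andP[hn0 hn1] hn2].
have a := h1 n m hn1 (leq_maxr _ _); have b := hK n hn0.
have := h2 n hn2; rewrite subr0 => c.
have d := le_trans (si_CS hf (w n - w m) (w n)) (ler_wpM2l (seminorm_ge0 f _) b).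
have q : sn (w n) ^+ 2 <= cabs (f (w n - w m) (w n)) + cabs (f (w m) (w n)).
  have <- : cabs (f (w n) (w n)) = sn (w n) ^+ 2.
    by rewrite (si_diag hf) cabsR ger0_norm ?sqr_ge0.
  by apply: le_trans (cabsD _ _); rewrite (siBl hf) subrK.
rewrite ltr_pdivlMr ?mulr_gt0// in a.
rewrite -(@ltr_pXn2r _ 2)// ?nnegrE ?seminorm_ge0 ?(ltW e0)//.
rewrite (expr2 e); nra.
Qed.

Lemma cauchy_pair u v : cauchyto sn u -> cauchyto sn v ->
  cauchyto cabs (fun n => f (u n) (v n)).
Proof.
move=> cu cv e e0; have [K [K0 [n0 hK]]] := cauchy_bound cu.
have [L [L0 [n1 hL]]] := cauchy_bound cv.
have [n2 h2] := cu (e / (2 * L)) ltac:(by rewrite divr_gt0// mulr_gt0).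
have [n3 h3] := cv (e / (2 * K)) ltac:(by rewrite divr_gt0// mulr_gt0).
exists (maxn (maxn n0 n1) (maxn n2 n3)) => m n.
rewrite !geq_max => /andP[/andP[m0 m1] /andP[m2 m3]] /andP[/andP[n0' n1'] /andP[n2' n3']].
have -> : f (u m) (v m) - f (u n) (v n) = f (u m - u n) (v m) + f (u n) (v m - v n).
  by rewrite (siBl hf) (siBr hf) addrA subrK.
apply: le_lt_trans (cabsD _ _) _.
have a := h2 m n m2 n2'; have b := h3 m n m3 n3'.
rewrite ltr_pdivlMr ?mulr_gt0// in a; rewrite ltr_pdivlMr ?mulr_gt0// in b.
have p := le_trans (si_CS hf (u m - u n) (v m)) (ler_wpM2l (seminorm_ge0 f _) (hL m m1)).
have q := le_trans (si_CS hf (u n) (v m - v n)) (ler_wpM2r (seminorm_ge0 f _) (hK n n0')).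
nra.
Qed.

(** Sequences with the same functional differ by a null sequence ([cauchy_null]), so the inner
    product does not depend on the representing sequences. *)
Lemma pair_limit_eq u u' v v' g h l :
  represents u g -> represents u' g -> represents v h -> represents v' h ->
  cvto cabs (fun n => f (u n) (v n)) l -> cvto cabs (fun n => f (u' n) (v' n)) l.
Proof.
move=> ru ru' rv rv' hl.
have null w w' k : represents w k -> represents w' k -> forall e : R, 0 < e ->
    exists N, forall n, (N <= n)%N -> sn (w n - w' n) < e.
  move=> rw rw'; have := represents_lin (-1) rw' rw => -[c1 c2].
  have e0 n : -1 *: w' n + w n = w n - w' n by linring R (semi_vec S).
  have cd : cauchyto sn (fun n => w n - w' n).
    by have := c1; congr (cauchyto _ _); apply/funext => n; rewrite e0.
  apply: (cauchy_null cd) => c; have := c2 c.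
  have -> : (-1 *: k + k) c = 0.
    by rewrite (_ : (_ + _) c = -1 *: k c + k c)// scaleN1r addNr.
  by congr (cvto _ _ _); apply/funext => n; rewrite e0.
have [K [K0 [n0 hK]]] := cauchy_bound (proj1 ru').
have [L [L0 [n1 hL]]] := cauchy_bound (proj1 rv).
move=> e e0.
have [n2 h2] := null _ _ _ ru ru' (e / (3 * L)) ltac:(by rewrite divr_gt0// mulr_gt0).
have [n3 h3] := null _ _ _ rv rv' (e / (3 * K)) ltac:(by rewrite divr_gt0// mulr_gt0).
have [n4 h4] := hl (e / 3) ltac:(by rewrite divr_gt0).
exists (maxn n4 (maxn (maxn n0 n1) (maxn n2 n3))) => n.
rewrite !geq_max => /andP[/h4 d /andP[/andP[/hK m0 /hL m1] /andP[/h2 a /h3 b]]].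
have -> : f (u' n) (v' n) - l =
  - f (u n - u' n) (v n) - f (u' n) (v n - v' n) + (f (u n) (v n) - l).
  by rewrite (siBl hf) (siBr hf); ring.
apply: le_lt_trans (cabsD _ _) _.
have := cabsD (- f (u n - u' n) (v n)) (- f (u' n) (v n - v' n)); rewrite !cabsN.
rewrite ltr_pdivlMr ?mulr_gt0// in a; rewrite ltr_pdivlMr ?mulr_gt0// in b.
have p := le_trans (si_CS hf (u n - u' n) (v n)) (ler_wpM2l (seminorm_ge0 f _) m1).
have q := le_trans (si_CS hf (u' n) (v n - v' n)) (ler_wpM2r (seminorm_ge0 f _) m0).
nra.
Qed.

Definition completion_pred : {pred E -> R[i]} :=
  fun g => `[< exists u, represents u g >].

Lemma completion_submod : submod_closed completion_pred.
Proof.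
split.
  apply/asboolP; exists (fun=> 0); have := represents_cst 0.
  by congr represents; apply/funext => c; rewrite (si0r hf).
move=> k g h /asboolP[u ru] /asboolP[v rv]; apply/asboolP.
by exists (fun n => k *: u n + v n); exact: represents_lin.
Qed.

Record completion := Completion {
  cev : E -> R[i];
  _ : cev \in completion_pred
}.

HB.instance Definition _ := [isSub for cev].
HB.instance Definition _ := [Choice of completion by <:].

Lemma completion_inj (x y : completion) : cev x = cev y -> x = y.
Proof. exact: val_inj. Qed.

Lemma completion_predP (k : R[i]) g h : g \in completion_pred ->
  h \in completion_pred -> k *: g + h \in completion_pred.
Proof. exact: (proj2 completion_submod). Qed.

Lemma completion_predD g h : g \in completion_pred -> h \in completion_pred ->
  g + h \in completion_pred.
Proof. by move=> hg hh; have := completion_predP 1 hg hh; rewrite scale1r. Qed.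

Lemma completion_predZ (k : R[i]) g : g \in completion_pred ->
  k *: g \in completion_pred.
Proof.
by move=> hg; have := completion_predP k hg (proj1 completion_submod); rewrite addr0.
Qed.

Lemma completion_predN g : g \in completion_pred -> - g \in completion_pred.
Proof. by move=> hg; rewrite -scaleN1r; exact: completion_predZ. Qed.

Lemma cevP (x : completion) : cev x \in completion_pred.
Proof. by case: x. Qed.

Definition cadd x y := Completion (completion_predD (cevP x) (cevP y)).
Definition copp x := Completion (completion_predN (cevP x)).
Definition czero := Completion (proj1 completion_submod).
Definition cscale k x := Completion (completion_predZ k (cevP x)).

Lemma caddA : associative cadd.
Proof. by move=> x y z; apply: completion_inj; exact: addrA. Qed.
Lemma caddC : commutative cadd.
Proof. by move=> x y; apply: completion_inj; exact: addrC. Qed.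
Lemma cadd0 : left_id czero cadd.
Proof. by move=> x; apply: completion_inj; exact: add0r. Qed.
Lemma caddN : left_inverse czero copp cadd.
Proof. by move=> x; apply: completion_inj; exact: addNr. Qed.

HB.instance Definition _ := GRing.isZmodule.Build completion caddA caddC cadd0 caddN.

Lemma cscaleA k l x : cscale k (cscale l x) = cscale (k * l) x.
Proof. by apply: completion_inj; exact: scalerA. Qed.
Lemma cscale1 : left_id 1 cscale.
Proof. by move=> x; apply: completion_inj; exact: scale1r. Qed.
Lemma cscaleDr : right_distributive cscale +%R.
Proof. by move=> k x y; apply: completion_inj; exact: scalerDr. Qed.
Lemma cscaleDl x : {morph cscale^~ x : k l / k + l}.
Proof. by move=> k l; apply: completion_inj; exact: scalerDl. Qed.

HB.instance Definition _ := GRing.Zmodule_isLmodule.Build R[i] completion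
  cscaleA cscale1 cscaleDr cscaleDl.

End CompletionCarrier.

(** Completeness of a normed module is stated for filters. A Cauchy filter contains balls of radius
    2^-n; their centres form a Cauchy sequence, whose limit is the limit of the filter. *)
Lemma seq_complete_cvg (R : realType) (V : normedModType R[i]) :
  (forall u : nat -> V, cauchyto nrm u -> exists l, cvto nrm u l) ->
  forall F : set_system V, ProperFilter F -> cauchy F -> cvg F.
Proof.
move=> hV F FF /cauchy_ballP/cauchy_ballP/cauchyP cF.
have half0 n : (0 : R) < 2^-1 ^+ n by rewrite exprn_gt0.
have /choice[x hx] : forall n, exists x, F (ball x ((2^-1 ^+ n)%:C : R[i])%C).
  by move=> n; apply: cF; rewrite ltcR.
have inv_le (N n : nat) : (0 < N)%N -> (N <= n)%N -> (2^-1 : R) ^+ n <= N%:R^-1.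
  move=> N0 Nn; rewrite exprVn lef_pV2 ?posrE ?exprn_gt0 ?ltr0n// -natrX ler_nat.
  by apply: leq_trans Nn _; rewrite ltnW// ltn_expl.
have [l hl] : exists l, cvto nrm x l.
  apply: hV => e e0; have [N N0 hN] := exists_small_inv e0 (ler0n R 2).
  exists N => m n hm hn.
  have := filter_ex (filterI (hx m) (hx n)) => -[y []].
  rewrite -!ball_normE /= !nrmE !ltcR => a b.
  apply: le_lt_trans (nrm_tri y _ _) _; rewrite (nrm_distC y).
  have := inv_le _ _ N0 hm; have := inv_le _ _ N0 hn; lra.
apply/cvg_ex; exists l => A /nbhs_ballP[_ /normc_gt0E[e e0 ->] hA].
have e2 : 0 < e / 2 by rewrite divr_gt0.
have [N N0 hN] := exists_small_inv e2 ler01; have [n0 hn0] := hl _ e2.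
pose n := maxn n0 N.
apply: filterS (hx n) => y; rewrite -ball_normE /= nrmE ltcR => hy.
apply: hA; rewrite -ball_normE /= nrmE ltcR.
apply: le_lt_trans (nrm_tri (x n) _ _) _; rewrite nrm_distC.
have := hn0 n (leq_maxl _ _); have := inv_le _ _ N0 (leq_maxr n0 N).
rewrite mul1r in hN; rewrite -/n; lra.
Qed.

(** * The Hilbert space structure of the completion *)

Section CompletionHilbert.
Context {R : realType} {S : semiSpace R}.
Local Open Scope complex_scope.
Local Notation E := (semi_vec S).
Local Notation f := (@semi_form R S).
Local Notation hf := (@semi_axiom R S).
Local Notation sn := (seminorm f).
Local Notation H := (completion S).
Implicit Types (u v w : nat -> E) (g h : H) (c d : E).

Lemma cev_lin (k : R[i]) g h : cev (k *: g + h) = k *: cev g + cev h.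
Proof. by []. Qed.

Lemma cev_inj g h : cev g = cev h -> g = h.
Proof. exact: val_inj. Qed.

Lemma cev_rep g : exists u, represents u (cev g).
Proof. by case: g => g /= /asboolP. Qed.

Definition approx g : nat -> E := sval (cid (cev_rep g)).

Lemma approxP g : represents (approx g) (cev g).
Proof. by rewrite /approx; case: cid. Qed.

Lemma inner_exists g h : exists l, cvto cabs (fun n => f (approx g n) (approx h n)) l.
Proof. by apply/cabs_complete/cauchy_pair; [case: (approxP g) | case: (approxP h)]. Qed.

Definition inner g h : R[i] := sval (cid (inner_exists g h)).

Lemma innerP g h u v : represents u (cev g) -> represents v (cev h) ->
  cvto cabs (fun n => f (u n) (v n)) (inner g h).
Proof.
move=> ru rv; apply: (pair_limit_eq (approxP g) ru (approxP h) rv).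
by rewrite /inner; case: cid.
Qed.

Lemma inner_semi : semi_inner inner.
Proof.
split.
- move=> k g h h'; apply: (cabs_cvto_unique (u := fun n => f (approx g n) (k *: approx h n + approx h' n))).
    by apply: innerP; rewrite ?cev_lin; [exact: approxP | apply: represents_lin; exact: approxP].
  have := cabs_cvtoP k (innerP (approxP g) (approxP h)) (innerP (approxP g) (approxP h')).
  by congr (cvto _ _ _); apply/funext => n; rewrite (siP hf).
- move=> g h; apply: (cabs_cvto_unique (innerP (approxP h) (approxP g))).
  have := cabs_cvto_conj (innerP (approxP g) (approxP h)).
  by congr (cvto _ _ _); apply/funext => n; rewrite -(siJ hf).
- move=> g; apply: (cabs_cvto_ge0 (innerP (approxP g) (approxP g))) => n.
  exact: (si_ge0 hf).
Qed.

Local Notation hn := (seminorm inner).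

Lemma hn_eq0 g : hn g = 0 -> g = 0.
Proof.
move=> g0; have ig : inner g g = 0 by rewrite (si_diag inner_semi) g0 expr0n.
have hg := innerP (approxP g) (approxP g); rewrite ig in hg.
apply: cev_inj; apply/funext => c.
rewrite [RHS]/(0 : R[i]).
apply: (cabs_cvto_unique (proj2 (approxP g) c)) => e e0.
pose K := sn c + 1; have K0 : 0 < K by have := seminorm_ge0 f c; rewrite /K; lra.
have [n0 h0] := hg (e / K * (e / K)) ltac:(by rewrite mulr_gt0// divr_gt0).
exists n0 => n /h0; rewrite !subr0 (si_diag hf) cabsR ger0_norm ?sqr_ge0// -expr2.
rewrite ltr_pXn2r ?nnegrE ?seminorm_ge0 ?divr_ge0 ?(ltW e0) ?(ltW K0)//.
rewrite ltr_pdivlMr// => h1; apply: le_lt_trans (si_CS hf _ _) _.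
have := seminorm_ge0 f (approx g n); rewrite /K in h1; nra.
Qed.

Definition hnorm g : R[i] := (hn g)%:C.

Lemma hnormD g h : hnorm (g + h) <= hnorm g + hnorm h.
Proof. by rewrite /hnorm -rmorphD lecR; exact: (seminormD inner_semi). Qed.

Lemma hnormZ (k : R[i]) g : hnorm (k *: g) = `|k| * hnorm g.
Proof. by rewrite /hnorm (seminormZ inner_semi) rmorphM cabsE. Qed.

Lemma hnorm_eq0 g : hnorm g = 0 -> g = 0.
Proof. by move=> /(@complexI R _ 0); exact: hn_eq0. Qed.

HB.instance Definition _ := Lmodule_isNormed.Build R[i] H hnormD hnormZ hnorm_eq0.

Lemma nrm_completion g : nrm g = hn g.
Proof. by []. Qed.

Lemma cin_proof c : (fun d => f d c) \in @completion_pred R S.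
Proof. by apply/asboolP; exists (fun=> c); exact: represents_cst. Qed.

Definition cin c : H := Completion (cin_proof c).

Lemma cin_lin (k : R[i]) c d : cin (k *: c + d) = k *: cin c + cin d.
Proof.
by apply: cev_inj; rewrite cev_lin; apply/funext => x; rewrite /= (siP hf).
Qed.

Lemma inner_cin c g : inner (cin c) g = cev g c.
Proof.
have h : represents (fun=> c) (cev (cin c)) by exact: represents_cst.
exact: (cabs_cvto_unique (innerP h (approxP g)) (proj2 (approxP g) c)).
Qed.

Lemma hn_cin c : hn (cin c) = sn c.
Proof. by rewrite /seminorm inner_cin. Qed.

Lemma cinB c d : cin (c - d) = cin c - cin d.
Proof. by have := cin_lin (-1) d c; rewrite !scaleN1r addrC => ->; rewrite addrC. Qed.

Lemma hn_limit u g M : represents u (cev g) -> 0 <= M ->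
  (exists n0, forall n, (n0 <= n)%N -> sn (u n) <= M) -> hn g <= M.
Proof.
move=> ru M0 [n0 h]; rewrite -(@ler_pXn2r _ 2)// ?nnegrE ?seminorm_ge0//.
have <- : cabs (inner g g) = hn g ^+ 2.
  by rewrite (si_diag inner_semi) cabsR ger0_norm ?sqr_ge0.
apply: cabs_cvto_le (innerP ru ru) _; exists n0 => n /h hn'.
rewrite (si_diag hf) cabsR ger0_norm ?sqr_ge0//.
by rewrite ler_pXn2r ?nnegrE ?seminorm_ge0.
Qed.

Lemma approx_dist u g (e : R) N : represents u (cev g) -> 0 <= e ->
  (forall n, (N <= n)%N -> sn (u n - u N) <= e) -> hn (g - cin (u N)) <= e.
Proof.
move=> ru e0 h; apply: (@hn_limit (fun n => -1 *: u N + u n)) => //.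
  have -> : g - cin (u N) = -1 *: cin (u N) + g by rewrite scaleN1r addrC.
  rewrite cev_lin; apply: represents_lin => //; exact: represents_cst.
by exists N => n /h; rewrite scaleN1r addrC.
Qed.

Lemma completion_dense g (e : R) : 0 < e -> exists c, hn (g - cin c) <= e.
Proof.
move=> e0; have [cu _] := approxP g; have [N hN] := cu e e0.
exists (approx g N); apply: approx_dist (approxP g) (ltW e0) _ => n Nn.
by apply: ltW; exact: hN.
Qed.

(** A diagonal argument: vectors [w n] of the original space within 2^-n of [G n] form a Cauchy
    sequence, and the functional they represent is the limit. *)
Lemma completion_complete (G : nat -> H) : cauchyto nrm G -> exists l, cvto nrm G l.
Proof.
move=> cG; have half0 n : (0 : R) < 2^-1 ^+ n by rewrite exprn_gt0.
have /choice[w hw] : forall n, exists c, nrm (G n - cin c) <= 2^-1 ^+ n.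
  by move=> n; exact: completion_dense.
have inv_le (N n : nat) : (0 < N)%N -> (N <= n)%N -> (2^-1 : R) ^+ n <= N%:R^-1.
  move=> N0 Nn; rewrite exprVn lef_pV2 ?posrE ?exprn_gt0 ?ltr0n// -natrX ler_nat.
  by apply: leq_trans Nn _; rewrite ltnW// ltn_expl.
have cw : cauchyto sn w.
  move=> e e0; have e3 : 0 < e / 3 by rewrite divr_gt0.
  have [N N0 hN] := exists_small_inv e3 ler01; have [n0 hn0] := cG _ e3.
  exists (maxn n0 N) => m n; rewrite !geq_max => /andP[m0 mN] /andP[n0' nN].
  rewrite -hn_cin cinB -nrm_completion.
  apply: le_lt_trans (nrm_tri (G m) _ _) _; rewrite nrm_distC.
  have := nrm_tri (G n) (G m) (cin (w n)); have := hn0 m n m0 n0'.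
  have := hw m; have := hw n; have := inv_le _ _ N0 mN; have := inv_le _ _ N0 nN.
  rewrite mul1r in hN; lra.
have /choice[g hg] : forall c, exists l, cvto cabs (fun n => f c (w n)) l.
  by move=> c; apply/cabs_complete/(cauchy_pair _ cw); case: (represents_cst c).
have rg : represents w g by [].
have gp : g \in @completion_pred R S by apply/asboolP; exists w.
exists (Completion gp) => e e0; have e3 : 0 < e / 3 by rewrite divr_gt0.
have [N N0 hN] := exists_small_inv e3 ler01; have [n0 hn0] := cw _ e3.
exists (maxn n0 N) => n; rewrite geq_max => /andP[n0n Nn].
apply: le_lt_trans (nrm_tri (cin (w n)) _ _) _; rewrite (nrm_distC (cin _)).
have : nrm (Completion gp - cin (w n)) <= e / 3.
  apply: (approx_dist (u := w)) => //; first exact: ltW.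
  by move=> m nm; apply/ltW/hn0 => //; exact: leq_trans nm.
have := hw n; have := inv_le _ _ N0 Nn; rewrite mul1r in hN; lra.
Qed.

HB.instance Definition _ := Uniform_isComplete.Build H
  (seq_complete_cvg completion_complete).

Lemma inner_norm g : inner g g = `|g| ^+ 2.
Proof. by rewrite (si_diag inner_semi) nrmE nrm_completion rmorphXn. Qed.

HB.instance Definition _ := isHilbertSpace.Build R H
  (siP inner_semi) (siJ inner_semi) inner_norm.

End CompletionHilbert.

(** * Lifting operators to the completion *)

Section CompletionOperators.
Context {R : realType} {S : semiSpace R}.
Local Open Scope complex_scope.
Local Notation E := (semi_vec S).
Local Notation f := (@semi_form R S).
Local Notation hf := (@semi_axiom R S).
Local Notation sn := (seminorm f).
Local Notation H := (completion S : hilbertType R).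
Implicit Types (g h : completion S) (c d : E) (T : E -> E).

(* The extension to the completion of an operator with adjoint [T']. *)
Definition lift_op (T' : E -> E) g : completion S :=
  xget 0 [set h | cev h = cev g \o T'].

Lemma hipE g h : hip (g : H) (h : H) = inner g h. Proof. by []. Qed.

Lemma cev_conj_lin g (k : R[i]) c d :
  cev g (k *: c + d) = Num.conj k * cev g c + cev g d.
Proof.
have hs := @inner_semi R S.
by rewrite -!inner_cin cin_lin (siDl hs) (siZl hs).
Qed.

Lemma cevB g c d : cev g (c - d) = cev g c - cev g d.
Proof.
have -> : c - d = -1 *: d + c by rewrite scaleN1r addrC.
by rewrite cev_conj_lin conjN conjC1 mulN1r addrC.
Qed.

Section Lift.
Variables (T T' : E -> E) (M : R).
Hypothesis T_lin : forall (k : R[i]) c d, T (k *: c + d) = k *: T c + T d.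
Hypothesis T_adj : forall c d, f (T' c) d = f c (T d).
Hypothesis M0 : 0 <= M.
Hypothesis T_bound : forall c, sn (T c) <= M * sn c.

Let TB c d : T (c - d) = T c - T d.
Proof. by have := T_lin (-1) d c; rewrite !scaleN1r addrC => ->; rewrite addrC. Qed.

Lemma lift_rep u g : represents u (cev g) -> represents (T \o u) (cev g \o T').
Proof.
move=> [cu hu]; split=> [e e0|c /=].
  pose N := M + 1; have N0 : 0 < N by rewrite ltr_wpDl.
  have [n0 hn] := cu (e / N) ltac:(by rewrite divr_gt0).
  exists n0 => m n hm hn' /=; rewrite -TB.
  apply: le_lt_trans (T_bound _) _; have := hn m n hm hn'; rewrite ltr_pdivlMr//.
  have := seminorm_ge0 f (u m - u n); have := M0; rewrite /N; nra.
by have := hu (T' c); congr (cvto _ _ _); apply/funext => n; rewrite T_adj.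
Qed.

Lemma lift_opE g c : cev (lift_op T' g) c = cev g (T' c).
Proof.
rewrite /lift_op; case: xgetP => [h _ ->//|].
have gp : cev g \o T' \in @completion_pred R S.
  by apply/asboolP; exists (T \o approx g); apply: lift_rep; exact: approxP.
by move=> /(_ (Completion gp)) [].
Qed.

Lemma lift_op_rep u g : represents u (cev g) -> represents (T \o u) (cev (lift_op T' g)).
Proof.
move=> ru; have -> : cev (lift_op T' g) = cev g \o T'.
  by apply/funext => c; rewrite lift_opE.
exact: lift_rep.
Qed.

End Lift.

Record bounded_pair (T T' : E -> E) : Prop := BoundedPair {
  bp_lin : forall (k : R[i]) c d, T (k *: c + d) = k *: T c + T d;
  bp_lin' : forall (k : R[i]) c d, T' (k *: c + d) = k *: T' c + T' d;
  bp_adj : forall c d, f (T' c) d = f c (T d);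
  bp_bound : exists2 M, 0 <= M & forall c, sn (T c) <= M * sn c;
  bp_bound' : exists2 M, 0 <= M & forall c, sn (T' c) <= M * sn c
}.

Lemma cev_lift T T' g c : bounded_pair T T' -> cev (lift_op T' g) c = cev g (T' c).
Proof. by move=> [l _ a [M M0 b] _]; exact: (lift_opE l a M0 b). Qed.

Lemma lift_adjoint T T' : bounded_pair T T' ->
  @is_adjoint R (hspace H) (lift_op T') (lift_op T).
Proof.
move=> hT; split=> [||g h _ _]; try by split=> // x [].
have [l l' a [M M0 b] [M' M'0 b']] := hT.
have a' c d : f (T c) d = f c (T' d) by rewrite (siJ hf) -a -(siJ hf).
have r1 := lift_op_rep l a M0 b (approxP g).
have r2 := lift_op_rep l' a' M'0 b' (approxP h).
have h1 := innerP r1 (approxP h); have h2 := innerP (approxP g) r2.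
rewrite /= !hipE; apply: (cabs_cvto_unique h1).
by move: h2; congr (cvto _ _ _); apply/funext => n /=; rewrite a'.
Qed.

Lemma lift_cin T T' c : bounded_pair T T' -> lift_op T' (cin c) = cin (T c).
Proof.
by move=> hT; apply: cev_inj; apply/funext => d; rewrite (cev_lift _ _ hT) /= (bp_adj hT).
Qed.

End CompletionOperators.

(** * Multipliers and the GNS construction *)

Section MultiplierAlgebra.
Context {R : realType} {B : cstarType R}.
Local Open Scope complex_scope.
Local Notation hM := (hmodule_selfmod B).
Local Notation M := (selfmod B).
Implicit Types (T S V : M -> M) (a b c : B).

Lemma multM T b c : multiplier B T -> T (amul b c) = amul (T b) c.
Proof.
move=> hT; apply/eqP; rewrite -subr_eq0; apply/eqP.
apply: amul_star_eq0; set z := (_ - _).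
suff h x : amul (astar x) (T (amul b c)) = amul (astar x) (amul (T b) c).
  by rewrite /z amulBr h subrr.
have := adj_ip' hM (x := x) (y := amul b c) hT I I => /= <-.
have := adj_ip' hM (x := x) (y := b) hT I I => /= e.
by rewrite amulA e amulA.
Qed.

Lemma mult_lin T (k : R[i]) b c : multiplier B T -> T (k *: b + c) = k *: T b + T c.
Proof. by move=> hT; exact: (adjointable_lin hM k hT I I). Qed.

Lemma mult_ip T b c : multiplier B T -> amul (astar (T b)) c = amul (astar b) (adj T c).
Proof. by move=> hT; exact: (adj_ip hM hT I I). Qed.

Lemma mult_ip' T b c : multiplier B T -> amul (astar (adj T b)) c = amul (astar b) (T c).
Proof. by move=> hT; exact: (adj_ip' hM hT I I). Qed.

Lemma adj_multiplier T : multiplier B T -> multiplier B (adj T).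
Proof. exact: (adj_adjointable hM). Qed.

Lemma idopB b : idop M b = b. Proof. exact: idopE. Qed.

Lemma lmul_adj b : @adj R M (lmul b) = lmul (astar b).
Proof. exact/(adjE hM)/lmul_adjoint. Qed.

Lemma lmul_multiplier b : multiplier B (lmul b).
Proof. by exists (lmul (astar b)); exact: lmul_adjoint. Qed.

Lemma lmul_mult T b : multiplier B T -> lmul (T b) = T \o lmul b.
Proof. by move=> hT; apply/funext => c; rewrite /= /lmul multM. Qed.

Lemma rmulE T b c : multiplier B T -> amul (rmul b T) c = amul b (T c).
Proof. by move=> hT; rewrite /rmul mult_ip'// astarK. Qed.

Lemma lmul_rmul T b : multiplier B T -> lmul (rmul b T) = lmul b \o T.
Proof. by move=> hT; apply/funext => c; rewrite /= /lmul rmulE. Qed.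

Lemma lmul_inj a b : @lmul R B a = lmul b -> a = b.
Proof.
move=> h; apply/eqP; rewrite -subr_eq0; apply/eqP/amul_eq0 => x.
by rewrite amulBl -[amul a x]/(lmul a x) h subrr.
Qed.

(** An order inequality rather than one of norms, because positive functionals preserve it; this is
    what bounds [T] in the GNS seminorm. *)
Definition contractive T := forall b, posA (amul (astar b) b - amul (astar (T b)) (T b)).

Lemma contractive_nrm T b : contractive T -> nrm (T b) <= nrm b.
Proof.
move=> hT; rewrite -(@ler_pXn2r _ 2)// ?nnegrE ?nrm_ge0// -!nrm_star.
by apply: posA_mono => //; exact: posA_starM.
Qed.

(** The difference is [c^*c] for the component [c = b - V^*V b] of [b] in the kernel of [V]. *)
Lemma piso_contractive V : partial_isometry V -> contractive V.
Proof.
move=> [hV e] b; pose c := b - adj V (V b).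
suff -> : amul (astar b) b - amul (astar (V b)) (V b) = amul (astar c) c.
  exact: posA_starM.
have hV' := adj_multiplier hV.
have e' : V (adj V (V b)) = V b by rewrite -[RHS](congr1 (fun f => f b) e).
have h1 : amul (astar (V b)) (V b) = amul (astar b) (adj V (V b)) by rewrite mult_ip.
rewrite {1}/c astarB amulBl mult_ip'// /c.
have -> : V (b - adj V (V b)) = 0.
  have := mult_lin (-1) (adj V (V b)) b hV.
  by rewrite !scaleN1r e' addNr addrC.
by rewrite amul0r subr0 amulBr h1.
Qed.

Lemma piso_adj V : partial_isometry V -> partial_isometry (adj V : M -> M).
Proof.
move=> [hV e]; have hV' := adj_multiplier hV; split; first exact: adj_multiplier.
have := congr1 (@adj R M) e.
by rewrite (adj_comp hM (adjointable_comp hM hV hV') hV) (adj_comp hM hV hV') (adjK hM hV).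
Qed.

(** With an approximate unit [u], the element [T b] is the limit of [T (u b) = (T u) b], which lies
    in the ideal. *)
Lemma mult_ideal (I : set B) T b : closed_ideal I -> multiplier B T ->
  contractive T -> I b -> I (T b).
Proof.
move=> hI hT cT Ib; apply: (ci_closed hI); apply/closure_nrm => e e0.
have [u [su u1 hu]] := approx_unit [:: b] e0.
exists (T (amul u b)); first by rewrite multM//; exact: (ciMl hI).
have -> : T b - T (amul u b) = T (b - amul u b).
  have := mult_lin (-1) (amul u b) b hT.
  by rewrite !scaleN1r addrC => ->; rewrite addrC.
apply: le_trans (contractive_nrm _ cT) _.
by rewrite nrm_distC hu// mem_seq1.
Qed.

End MultiplierAlgebra.

(** * The GNS representation of a separating state *)

Section GNS.
Context {R : realType} {B : cstarType R}.
Context {I : set B} (hI : closed_ideal I) {b0 : B} {F : B -> R[i]}.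
Hypothesis hF : separating_state I b0 F.
Local Open Scope complex_scope.
Local Notation M := (selfmod B).
Local Notation hM := (hmodule_selfmod B).
Implicit Types (a b c : B) (T S : M -> M).

Definition gns_form a b : R[i] := F (amul (astar a) b).

Lemma stateD a b : F (a + b) = F a + F b.
Proof. by have := ssP hF 1 a b; rewrite scale1r mul1r. Qed.

Lemma state0 : F 0 = 0.
Proof. by apply: (addrI (F 0)); rewrite -stateD !addr0. Qed.

Lemma stateZ (k : R[i]) a : F (k *: a) = k * F a.
Proof. by have := ssP hF k a 0; rewrite state0 !addr0. Qed.

Lemma stateB a b : F (a - b) = F a - F b.
Proof. by rewrite stateD -scaleN1r stateZ mulN1r. Qed.

Lemma gns_semi : semi_inner gns_form.
Proof.
split; rewrite /gns_form.
- by move=> k x y z; rewrite amulDr amulZr (ssP hF).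
- by move=> x y; rewrite -(ssS hF) astarM astarK.
- by move=> x; apply: (ss_pos hF); exact: posA_starM.
Qed.

Definition gns_space : semiSpace R := SemiSpace gns_semi.

Local Notation sn := (seminorm gns_form).
Local Notation H := (completion gns_space : hilbertType R).

Lemma gns_sn_le a b r : 0 <= r ->
  posA ((r * r)%:C *: amul (astar a) a - amul (astar b) b) -> sn b <= r * sn a.
Proof.
move=> r0 /(ss_pos hF); rewrite stateB stateZ subr_ge0 -!/(gns_form _ _).
rewrite !(si_diag gns_semi) -rmorphM lecR => h.
have sa := seminorm_ge0 gns_form a; have sb := seminorm_ge0 gns_form b.
rewrite -(@ler_pXn2r _ 2)// ?nnegrE ?mulr_ge0// exprMn (expr2 r).
exact: h.
Qed.

Lemma gns_sn_nrm a : sn a <= nrm a.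
Proof.
rewrite -(@ler_pXn2r _ 2)// ?nnegrE ?seminorm_ge0 ?nrm_ge0//.
rewrite -lecR -(si_diag gns_semi) -nrm_star.
by apply: (ss_norm hF); exact: posA_starM.
Qed.

(* The operators on the GNS space induced by left multiplications and by
   contractive multipliers of [B]. *)
Definition admissible T := multiplier B T /\
  exists2 r, 0 <= r & forall a, sn (T a) <= r * sn a /\ sn (adj T a) <= r * sn a.

Lemma admissible_pair T : admissible T -> @bounded_pair R gns_space T (adj T).
Proof.
move=> [hT [r r0 h]]; have hT' := adj_multiplier hT; split.
- by move=> k a b; exact: mult_lin.
- by move=> k a b; exact: mult_lin.
- by move=> a b; rewrite /= /gns_form mult_ip'.
- by exists r => // a; case: (h a).
- by exists r => // a; case: (h a).
Qed.

Lemma admissible_lmul b : admissible (lmul b).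
Proof.
split; first exact: lmul_multiplier.
exists (nrm b); first exact: nrm_ge0.
move=> a; rewrite lmul_adj; split; apply: gns_sn_le (nrm_ge0 _) _.
  exact: posA_mul_le.
by apply: posA_mul_le; rewrite nrmS.
Qed.

Lemma admissible_piso V : partial_isometry V -> admissible V.
Proof.
move=> hV; split; first by case: hV.
exists 1 => // a; split; apply: gns_sn_le => //; rewrite mul1r rmorph1 scale1r.
  exact: piso_contractive.
by apply: piso_contractive; exact: piso_adj.
Qed.

Lemma admissible_adj T : admissible T -> admissible (adj T).
Proof.
move=> [hT [r r0 h]]; split; first exact: adj_multiplier.
by exists r => // a; rewrite (adjK hM hT); case: (h a).
Qed.

Lemma admissible_comp T S : admissible T -> admissible S -> admissible (T \o S).
Proof.
move=> [hT [r r0 h]] [hS [s s0 h']]; split; first exact: (adjointable_comp hM).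
exists (r * s); first exact: mulr_ge0.
move=> a; rewrite (adj_comp hM)//=.
have [h1 h2] := h (S a); have [h3 h4] := h a.
have [h5 h6] := h' (adj T a); have [h7 h8] := h' a.
by split; [nra | nra].
Qed.

Definition gns_op T : hspace H -> hspace H := lift_op (S := gns_space) (adj T).

Lemma gns_opE T g c : admissible T -> cev (gns_op T g) c = cev g (adj T c).
Proof. by move=> /admissible_pair hT; exact: cev_lift hT. Qed.

Lemma gns_op_cin T c : admissible T -> gns_op T (cin (S := gns_space) c) = cin (S := gns_space) (T c).
Proof. by move=> /admissible_pair hT; exact: lift_cin hT. Qed.

Lemma gns_adjoint T : admissible T -> @is_adjoint R (hspace H) (gns_op T) (gns_op (adj T)).
Proof.
move=> hT; rewrite /gns_op (adjK hM); last by case: hT.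
exact: (lift_adjoint (admissible_pair hT)).
Qed.

Lemma gns_op_adj T : admissible T -> adj (gns_op T) = gns_op (adj T).
Proof. by move=> hT; apply: (adjE (hmodule_hspace H)); exact: gns_adjoint. Qed.

Lemma gns_op_adjointable T : admissible T -> adjointable (hspace H) (gns_op T).
Proof. by move=> hT; exists (gns_op (adj T)); exact: gns_adjoint. Qed.

Lemma gns_op_comp T S : admissible T -> admissible S ->
  gns_op (T \o S) = gns_op T \o gns_op S.
Proof.
move=> hT hS; apply/funext => g; apply: cev_inj; apply/funext => c /=.
rewrite !gns_opE//; last exact: admissible_comp.
by rewrite (adj_comp hM)//; [case: hT | case: hS].
Qed.

Definition gns_rep b : hspace H -> hspace H := gns_op (lmul b).

Lemma gns_representation : representation gns_rep.
Proof.
split.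
- by move=> b _; apply: gns_op_adjointable; exact: admissible_lmul.
- move=> k a b _ _; apply/funext => g; apply: cev_inj; apply/funext => c.
  have h (x : B) := admissible_lmul x.
  rewrite gns_opE// lmul_adj.
  rewrite (_ : (_ + _) g = k *: gns_rep a g + gns_rep b g)//.
  rewrite [RHS](_ : _ = k * cev (gns_rep a g) c + cev (gns_rep b g) c)//.
  rewrite !gns_opE// !lmul_adj /lmul astarP amulPl cev_conj_lin.
  by rewrite conjK.
- move=> a b _ _ /=; rewrite /gns_rep.
  have -> : lmul (amul a b) = lmul a \o lmul b.
    by apply/funext => c; rewrite /lmul /= amulA.
  by apply: gns_op_comp; exact: admissible_lmul.
- by move=> b _ /=; rewrite /gns_rep -lmul_adj gns_op_adj//; exact: admissible_lmul.
Qed.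

Lemma cev_ideal (g : completion gns_space) i : I i -> cev g i = 0.
Proof.
move=> Ii; have [_ h] := approxP g.
apply: (cabs_cvto_unique (h i)) => e e0; exists 0%N => n _.
rewrite /= /gns_form (ss_ideal hF) ?subrr ?cabs0//.
by apply: (ciMr hI); exact: (ciS hI).
Qed.

(** The state vanishes on [I], so every functional in the completion does, and these functionals
    cannot tell [c] from [adj T c]. *)
Lemma gns_op_id T : admissible T -> (forall c, I (c - adj T c)) ->
  gns_op T = idop (hspace H).
Proof.
move=> hT h; apply/funext => g; rewrite [RHS]restrE//.
apply: cev_inj; apply/funext => c; rewrite gns_opE//.
by apply/eqP; rewrite eq_sym -subr_eq0 -cevB; apply/eqP/cev_ideal.
Qed.

(** An approximate unit [u] takes the part of the cyclic vector: [F (b0^*b0)] is close to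
    [F (b0^*b0 u)], the inner product of [b0] with the image of [u] under [gns_rep b0]. *)
Lemma gns_faithful_at : gns_rep b0 <> 0.
Proof.
move=> h0; have := ss_neq0 hF; apply/negP/negPn/eqP.
apply: cabs0_eq0; apply/eqP; rewrite eq_le cabs_ge0 andbT.
apply/ler_addgt0Pr => e e0; rewrite add0r.
pose K := nrm b0 + 1; have K0 : 0 < K by have := nrm_ge0 b0; rewrite /K; lra.
have [u [su u1 hu]] := approx_unit2 [:: b0] (divr_gt0 e0 K0).
have [_ hu'] := hu b0 (mem_head _ _).
have z : F (amul (astar b0) (amul b0 u)) = 0.
  have -> : F (amul (astar b0) (amul b0 u)) =
      inner (cin (S := gns_space) b0) (cin (S := gns_space) (amul b0 u)).
    by rewrite inner_cin.
  have -> : cin (S := gns_space) (amul b0 u) = gns_rep b0 (cin (S := gns_space) u).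
    by rewrite /gns_rep gns_op_cin//; exact: admissible_lmul.
  rewrite h0 [(0 : hspace H -> hspace H) _]/(0 : H).
  exact: (si0r (inner_semi)).
have -> : F (amul (astar b0) b0) = F (amul (astar b0) (b0 - amul b0 u)).
  by rewrite amulBr stateB z subr0.
apply: le_trans (si_CS gns_semi _ _) _.
have := gns_sn_nrm b0; have := gns_sn_nrm (b0 - amul b0 u).
rewrite (nrm_distC b0) => h1 h2; rewrite ler_pdivlMr// in hu'.
have := seminorm_ge0 gns_form b0; have := seminorm_ge0 gns_form (b0 - amul b0 u).
rewrite /K in hu'; nra.
Qed.

End GNS.

Lemma multB (R : realType) (B : cstarType R) (T : selfmod B -> selfmod B) (b c : B) :
  multiplier B T -> T (b - c) = T b - T c.
Proof. by move=> hT; exact: (adjointableB (hmodule_selfmod B) hT I I). Qed.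

Lemma mult0 (R : realType) (B : cstarType R) (T : selfmod B -> selfmod B) :
  multiplier B T -> T 0 = 0.
Proof. by move=> hT; exact: (adjointable0r (hmodule_selfmod B) hT). Qed.

(** * Covariant pairs *)

Section CovariantPairs.
Context {R : realType} {A B : cstarType R} {alpha : A -> A}.
Context {iA : A -> B} {v : nat -> selfmod B -> selfmod B}.
Local Open Scope complex_scope.
Local Notation M := (selfmod B).
Local Notation hM := (hmodule_selfmod B).
Implicit Types (a : A) (b c : B).

Hypothesis hcov : covariant_piso alpha (X := M) (fun a => lmul (iA a)) v.

Lemma pisoV n : partial_isometry (v n).
Proof. by case: hcov => _ h _ _ _; exact: h. Qed.

Lemma multV n : multiplier B (v n).
Proof. by case: (pisoV n). Qed.

Lemma multV' n : multiplier B (adj (v n)).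
Proof. by apply: adj_multiplier; exact: multV. Qed.

Lemma VD m n : v m \o v n = v (m + n)%N.
Proof. by case: hcov => _ _ h _ _; exact: h. Qed.

Lemma Vcomm n a : adj (v n) \o v n \o lmul (iA a) = lmul (iA a) \o adj (v n) \o v n.
Proof. by case: hcov => _ _ _ _ h; exact: h. Qed.

Lemma iA_nondegenerate b (e : R) : 0 < e ->
  exists2 c, linear_span [set z | exists a w, z = amul (iA a) w] c & nrm (b - c) <= e.
Proof.
case: hcov => -[_ h] _ _ _ _ e0; have [|c sc hc] := h b I e%:C; first by rewrite ltcR.
exists c; first by apply: lspan_mono sc => _ [a [w [_ ->]]]; exists a, w.
by move: hc; rewrite ipnormE inrm_selfmod lecR.
Qed.

Lemma contractive_eq (T S : M -> M) (r : R) (G : set B) : 0 <= r ->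
  multiplier B T -> multiplier B S ->
  (forall b, nrm (T b - S b) <= r * nrm b) ->
  (forall b (e : R), 0 < e -> exists2 c, linear_span G c & nrm (b - c) <= e) ->
  (forall c, G c -> T c = S c) -> T = S.
Proof.
move=> r0 hT hS hr hG he; apply/funext => b.
have lin c : linear_span G c -> T c = S c.
  move: c; apply: lspan_ind; first by rewrite (mult0 hT) (mult0 hS).
  by move=> k x y Gx IH; rewrite (mult_lin _ _ _ hT) (mult_lin _ _ _ hS) he// IH.
apply/eqP; rewrite -subr_eq0; apply/eqP/nrm_small => e e0.
pose K := r + 1; have K0 : 0 < K by rewrite /K; lra.
have [c /lin ec hc] := hG b (e / K) ltac:(by rewrite divr_gt0).
have -> : T b - S b = T (b - c) - S (b - c).
  by rewrite (multB _ _ hT) (multB _ _ hS) ec opprB addrA subrK.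
apply: le_trans (hr _) _; rewrite ler_pdivlMr// /K in hc.
by have := nrm_ge0 (b - c); nra.
Qed.

Lemma V0 : v 0 = idop M.
Proof.
apply: (@contractive_eq _ _ 2 [set z | exists a w, z = amul (iA a) w]) => //.
- exact: multV.
- exact: adjointable_id.
- move=> b; rewrite idopB; apply: le_trans (nrmB _ _) _.
  by have := contractive_nrm b (piso_contractive (pisoV 0)); lra.
- exact: iA_nondegenerate.
- move=> _ [a [w ->]]; rewrite idopB.
  have e : lmul (iA a) = v 0 \o lmul (iA a) \o adj (v 0).
    by case: hcov => _ _ _ h _; exact: (h 0%N a).
  rewrite -[amul (iA a) w]/(lmul (iA a) w) e /=.
  by rewrite -[v 0 (v 0 _)]/((v 0 \o v 0) _) VD.
Qed.

Lemma adjV0 : adj (v 0) = idop M.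
Proof. by rewrite V0; exact: (adj_id hM). Qed.

Lemma adjVS n : adj (v n.+1) = adj (v 1) \o adj (v n).
Proof. by rewrite -addn1 -VD (adj_comp hM) //; exact: multV. Qed.

Lemma adjVS' n : adj (v n.+1) = adj (v n) \o adj (v 1).
Proof. by rewrite -add1n -VD (adj_comp hM) //; exact: multV. Qed.

Definition defect : M -> M := idop M - (adj (v 1) \o v 1).

Lemma defectE b : defect b = b - adj (v 1) (v 1 b).
Proof. by rewrite -[defect b]/(idop M b - adj (v 1) (v 1 b)) idopB. Qed.

Lemma defect_multiplier : multiplier B defect.
Proof.
apply: (adjointable_sub hM); first exact: adjointable_id.
by apply: (adjointable_comp hM); [exact: multV' | exact: multV].
Qed.

Lemma defect_nrm b : nrm (defect b) <= 2 * nrm b.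
Proof.
rewrite defectE; apply: le_trans (nrmB _ _) _.
have := contractive_nrm (v 1 b) (piso_contractive (piso_adj (pisoV 1))).
have := contractive_nrm b (piso_contractive (pisoV 1)); lra.
Qed.

Lemma lmul_monomial m a n :
  lmul (monomial iA v m a n) = adj (v m) \o lmul (iA a) \o v n.
Proof.
rewrite /monomial lmul_mult; last exact: multV'.
by rewrite lmul_rmul//; exact: multV.
Qed.

Lemma lmul_defect_monomial m a n :
  lmul (defect_monomial iA v m a n) = adj (v m) \o lmul (iA a) \o defect \o v n.
Proof.
rewrite /defect_monomial lmul_mult; last exact: multV'.
rewrite lmul_rmul//; apply: (adjointable_comp hM); last exact: multV.
exact: defect_multiplier.
Qed.

(** For positive [m] the factor [v_m^*] starts with [v^*], which [1 - v^*v] annihilates. For [m = 0]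
    the defect commutes past [iA a]. *)
Lemma defect_monomial0 m a n : defect (monomial iA v m a n) =
  if m is 0%N then defect_monomial iA v 0 a n else 0.
Proof.
apply: lmul_inj; rewrite lmul_mult; last exact: defect_multiplier.
rewrite lmul_monomial; case: m => [|m].
  rewrite lmul_defect_monomial adjV0; apply/funext => c /=.
  rewrite !idopB !defectE -[lmul (iA a) (_ - _)]/(amul _ _) amulBr.
  by congr (_ - _); exact: (congr1 (fun f => f (v n c)) (Vcomm 1 a)).
apply/funext => c /=; rewrite defectE adjVS /=.
have [h1 h2] := piso_adj (pisoV 1).
rewrite (adjK hM (multV 1)) in h2.
set z := adj (v m) _.
have := congr1 (fun f => f z) h2 => /= ->.
by rewrite subrr /lmul amul0l.
Qed.

Lemma defect_in_ideal (I : set B) :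
  closed_span [set b | exists m a n, b = monomial iA v m a n] = setT ->
  closed_ideal I -> (forall m a n, I (defect_monomial iA v m a n)) ->
  forall b, I (defect b).
Proof.
move=> hspan hI hdef b; apply: (ci_closed hI); apply/closure_nrm => e e0.
have /closure_nrm hb : closed_span [set b | exists m a n, b = monomial iA v m a n] b.
  by rewrite hspan.
have [c sc hc] := hb (e / 2) ltac:(by rewrite divr_gt0).
exists (defect c).
  move: c sc {hc}; apply: lspan_ind.
    by rewrite (mult0 defect_multiplier); exact: (ci0 hI).
  move=> k _ y [m [a [n ->]]] Iy; rewrite (mult_lin _ _ _ defect_multiplier).
  apply: (ciD hI) => //; apply: (ciZ hI); rewrite defect_monomial0.
  by case: m => [|m]; [exact: hdef | exact: (ci0 hI)].
rewrite -(multB _ _ defect_multiplier).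
by apply: le_trans (defect_nrm _) _; lra.
Qed.

(** By telescoping: [1 - v_(n+1)^*v_(n+1)] is the sum of [1 - v^*v] and [v^*(1 - v_n^*v_n)v], and
    closed ideals are stable under [v^*]. *)
Lemma projections_in_ideal (I : set B) : closed_ideal I ->
  (forall b, I (defect b)) -> forall n b, I (b - adj (v n) (v n b)).
Proof.
move=> hI hd; elim=> [|n IH] b.
  by rewrite adjV0 V0 !idopB subrr; exact: (ci0 hI).
rewrite adjVS /= -[v n.+1]/(v (1 + n)%N) addnC -VD /=.
have -> : b - adj (v 1) (adj (v n) (v n (v 1 b))) =
   defect b + adj (v 1) (v 1 b - adj (v n) (v n (v 1 b))).
  by rewrite (multB _ _ (multV' 1)) defectE addrA subrK.
apply: (ciD hI) => //; apply: mult_ideal => //; first exact: multV'.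
by apply/piso_contractive/piso_adj; exact: pisoV.
Qed.

End CovariantPairs.

(** * Factoring isometric GNS representations through the quotient *)

Section IsometricQuotient.
Context {R : realType} {A B D : cstarType R} {alpha : A -> A}.
Context {iA : A -> B} {v : nat -> selfmod B -> selfmod B}.
Context {jA : A -> D} {T : nat -> selfmod D -> selfmod D} {phi : B -> D}.
Local Open Scope complex_scope.
Local Notation hB := (hmodule_selfmod B).
Local Notation hD := (hmodule_selfmod D).

Hypothesis hiA : star_hom (S := alg_ops A) (S' := alg_ops B) setT setT iA.
Hypothesis hcov : covariant_piso alpha (X := selfmod B) (fun a => lmul (iA a)) v.
Hypothesis hspan :
  closed_span [set b | exists m a n, b = monomial iA v m a n] = setT.
Hypothesis hiso : iso_crossed_product alpha jA T.
Hypothesis hphi : star_hom (S := alg_ops B) (S' := alg_ops D) setT setT phi.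
Hypothesis hphi_gen : forall m a n,
  phi (monomial iA v m a n) = monomial jA T m a n.

Lemma isoT n : multiplier D (T n).
Proof. by case: hiso => _ [_ h _ _] _ _; case: (h n). Qed.

(** Universality describes [rho] at the multipliers [T n] but not at their adjoints. The difference
    of the two sides is orthogonal to all [rho d' w], whose span is dense by non-degeneracy. *)
Lemma rep_extension_adj (X : ipspace R) (hX : hmodule X) (rho : D -> X -> X)
    (m : selfmod D -> selfmod D) (V : X -> X) :
  representation rho -> Defs.nondegenerate rho -> multiplier D m ->
  extension_at rho m V -> forall d, rho (adj m d) = adj V \o rho d.
Proof.
move=> hr nr hm [hV he] d.
have aV := adj_adjointable hX hV.
have ar := rep_adjointable hr.
apply: (adjointable_eq (ar _)); first exact: (adjointable_comp hX).
move=> x dx /=; apply/eqP; rewrite -subr_eq0; apply/eqP.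
set z := _ - _.
have rd c y : dom y -> dom (rho c y) by exact: (rep_dom hr).
have da : dom (adj V (rho d x)) by apply: (adjointable_dom aV); exact: rd.
have dz : dom z by apply: (domB hX) => //; exact: rd.
have key d' w : dom w -> ip z (rho d' w) = 0.
  move=> dw; rewrite (ipBl hX (rd _ _ dx) da (rd _ _ dw)).
  rewrite (rep_ip hX hr _ _ dx dw) (adj_ip' hX hV (rd _ _ dx) (rd _ _ dw)).
  rewrite -[V (rho d' w)]/((V \o rho d') w) -he (rep_ip hX hr _ _ dx dw).
  have -> : amul (astar (adj m d)) d' = amul (astar d) (m d') by rewrite mult_ip'.
  by rewrite subrr.
clearbody z.
apply: (inrm_small hX dz) => e e0.
have [|y sy hy] := nr z dz (e%:C); first by rewrite ltcR.
have [dy zy] : dom y /\ ip z y = 0.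
  move: y sy {hy}; apply: lspan_ind; first by split; [exact: (hm_dom0 hX) | exact: (ip0r hX)].
  move=> k _ y [d' [w [dw ->]]] [dy iy]; split; first by apply: (hm_domP hX) => //; exact: rd.
  rewrite (hm_ipDr hX dz (domZ hX k (rd d' _ dw)) dy).
  rewrite iy addr0 -[RHS](key (k *: d') w dw) (repZ hr).
  by [].
have h : inrm z ^+ 2 <= inrm z * inrm (z - y).
  rewrite inrm_sq; have -> : ip z z = ip z (z - y) by rewrite (ipBr hX)// zy subr0.
  by apply: (hm_CS hX) => //; exact: (domB hX).
rewrite ipnormE lecR in hy; have z0 := inrm_ge0 z.
move: z0; rewrite le_eqVlt => /orP[/eqP <-|zp]; first exact: ltW.
by move: h; rewrite expr2 ler_pM2l// => /le_trans; apply.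
Qed.

(* The GNS representation of a state that vanishes on [I] but not at [b^*b] is
   isometric, hence factors through [phi]. *)
Lemma hom_ker_sub (I : set B) : closed_ideal I ->
  (forall m a n, I (defect_monomial iA v m a n)) ->
  forall b, phi b = 0 -> I b.
Proof.
move=> hI hdef b pb; apply: contrapT => nIb.
have [F hF] := exists_separating_state hI nIb.
have hd := defect_in_ideal hcov hspan hI hdef.
pose X := hspace (completion (gns_space hF) : hilbertType R).
have hX : hmodule X by exact: hmodule_hspace.
pose V n : X -> X := gns_op (hF := hF) (v n).
pose pi a : X -> X := gns_rep (hF := hF) (iA a).
have hV n : admissible (F := F) (v n) by apply: (admissible_piso hF); exact: (pisoV hcov n).
have hV' n : admissible (F := F) (adj (v n)) by exact: admissible_adj.
have hl c : admissible (F := F) (lmul c) by exact: (admissible_lmul hF).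
have adjVE n : adj (V n) = gns_op (hF := hF) (adj (v n)) by exact: gns_op_adj.
have cov : covariant_iso alpha pi V.
  split.
  - split.
      have [r1 r2 r3 r4] := gns_representation hF; split.
      + by move=> a _; exact: r1.
      + by move=> k a c _ _; rewrite /pi (homP hiA); exact: r2.
      + by move=> a c _ _; rewrite /pi (homM hiA); exact: r3.
      + by move=> a _; rewrite /pi (homS hiA); exact: r4.
    move=> x _ _ /normc_gt0E[e e0 ->].
    have e2 : 0 < e / 2 by rewrite divr_gt0.
    have [c hc] := completion_dense x e2.
    have [d sd hd'] := iA_nondegenerate hcov c e2.
    exists (cin (S := gns_space hF) d).
      move: d sd {hd'}; apply: lspan_ind.
        have -> : cin (S := gns_space hF) 0 = 0.
          by have := cinB (S := gns_space hF) 0 0; rewrite !subrr.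
        exact: lspan0.
      move=> k _ y [a [w ->]] IH; rewrite (cin_lin (S := gns_space hF)); apply: lspanD => //; apply/lspanZ/lspan_gen.
      exists a, (cin (S := gns_space hF) w); split=> //.
      by rewrite /pi /gns_rep gns_op_cin.
    rewrite ipnormE inrm_hspace lecR.
    apply: le_trans (nrm_tri (cin (S := gns_space hF) c) _ _) _; rewrite [e]splitr; apply: lerD => //.
    rewrite -cinB nrm_completion hn_cin.
    exact: le_trans (gns_sn_nrm hF _) hd'.
  - move=> n; split; first exact: gns_op_adjointable.
    rewrite adjVE -gns_op_comp//; apply: (gns_op_id hI); first exact: admissible_comp.
    move=> c; rewrite (adj_comp hB)//; [|exact: (multV' hcov n)|exact: (multV hcov n)].
    rewrite (adjK hB); last exact: (multV hcov n).
    exact: (projections_in_ideal hcov hI hd).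
  - by move=> m n; rewrite /V -gns_op_comp// (VD hcov).
  - move=> n a; rewrite adjVE /pi /gns_rep -!gns_op_comp//; last exact: admissible_comp.
    by case: hcov => _ _ _ h _; rewrite (h n a).
have [_ _ huniv _] := hiso.
have [rho [hr nr hrA hrT]] := huniv _ _ _ cov.
have ra := rep_adjointable hr.
have arA a : rho (astar (jA a)) = adj (pi a).
  by rewrite (repS hr) hrA.
(* Universality fixes [rho] on [jA] and at each [T n]; on monomials this already identifies
   [rho \o phi] with the GNS representation. *)
have key m a n : rho (phi (monomial iA v m a n)) = gns_rep (hF := hF) (monomial iA v m a n).
  rewrite hphi_gen [in LHS]/monomial (rep_extension_adj hX hr nr (isoT m) (hrT m)).
  rewrite /rmul (repS hr) (rep_extension_adj hX hr nr (isoT n) (hrT n)) arA.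
  have aV := gns_op_adjointable hF (hV n).
  have ap : adjointable X (pi a) by rewrite /pi /gns_rep; exact: (gns_op_adjointable hF (hl (iA a))).
  rewrite (adj_comp hX); [|exact: (adj_adjointable hX)|exact: (adj_adjointable hX)].
  have -> : adj (adj (pi a)) = pi a by exact: (adjK hX ap).
  have -> : adj (adj (V n)) = V n by exact: (adjK hX aV).
  rewrite (adjVE m).
  rewrite /gns_rep (lmul_monomial hcov m a n).
  have h1 := admissible_comp (hV' m) (hl (iA a)).
  by rewrite (gns_op_comp hF h1 (hV n)) (gns_op_comp hF (hV' m) (hl (iA a))).
have rphi : representation (rho \o phi).
  have [r1 r2 r3 r4] := hr; split.
  - by move=> c _; exact: r1.
  - by move=> k c d _ _ /=; rewrite (homP hphi); exact: r2.
  - by move=> c d _ _ /=; rewrite (homM hphi); exact: r3.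
  - by move=> c _ /=; rewrite (homS hphi); exact: r4.
have rg := gns_representation hF.
have e0 : rho (phi b) = gns_rep (hF := hF) b.
  apply: (adjointable_eq (ra _) (rep_adjointable rg b)) => x dx.
  apply/eqP; rewrite -subr_eq0; apply/eqP/nrm_small => e e0.
  have /closure_nrm hb : closed_span [set b | exists m a n, b = monomial iA v m a n] b.
    by rewrite hspan.
  (* Both representations are contractive, so they differ at [b] by at most 2 ||b - c|| ||x||; the
     added 1 keeps [K] positive. *)
  pose K := 2 * nrm (x : completion (gns_space hF)) + 1.
  have K0 : 0 < K by have := nrm_ge0 (x : completion (gns_space hF)); rewrite /K; lra.
  have [c sc hc] := hb (e / K) ltac:(by rewrite divr_gt0).
  have ec : rho (phi c) = gns_rep (hF := hF) c.
    move: c sc {hc}; apply: lspan_ind.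
      by rewrite (hom0 hphi) (rep0 hr) (rep0 rg).
    move=> k _ y [m [a [n ->]]] IH.
    by rewrite (homP hphi) (rep_lin hr) (rep_lin rg) key IH.
  have -> : rho (phi b) x - gns_rep (hF := hF) b x =
      rho (phi (b - c)) x - gns_rep (hF := hF) (b - c) x.
    rewrite (homB hphi) (repB hr) (repB rg) ec !op_subE.
    by rewrite opprB addrA subrK.
  apply: le_trans (nrmB _ _) _.
  have h1 := rep_contractive hX rphi (b - c) dx.
  have h2 := rep_contractive hX rg (b - c) dx.
  rewrite !inrm_hspace in h1 h2; rewrite ler_pdivlMr// /K in hc.
  have := nrm_ge0 (x : completion (gns_space hF)); have := nrm_ge0 (b - c).
  have h1' : nrm (rho (phi (b - c)) x) <= nrm (b - c) * nrm (x : completion (gns_space hF)) := h1.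
  have h2' : nrm (gns_rep (hF := hF) (b - c) x) <= nrm (b - c) * nrm (x : completion (gns_space hF)) := h2.
  nra.
by have h := gns_faithful_at (hF := hF); apply: h; rewrite -e0 pb (rep0 hr).
Qed.

End IsometricQuotient.

(** * The Hilbert module l^2(N, A) *)

Section FiniteCauchySchwarz.
Context {R : realType} {A : cstarType R}.
Local Open Scope complex_scope.
Implicit Types (a b : A) (x y : nat -> A) (r : seq nat) (t : R).
Local Notation iota := (iota (unitization_of A)).

Definition fip r x y : A := \sum_(k <- r) amul (astar (x k)) (y k).

Lemma posA_fip r x : posA (fip r x x).
Proof. by apply: posA_sum => k _; exact: posA_starM. Qed.

Lemma posA_le_conj (h b : A) t : posA h -> nrm h <= t ->
  posA (t%:C *: amul (astar b) b - amul (astar b) (amul h b)).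
Proof.
move=> ph ht; have h1 : pos (t%:C%:A - iota h).
  by apply: pos_sub; [exact: pos_selfadj | rewrite unorm_iota].
have := pos_conj (iota b) h1; rewrite /posA; congr pos.
by rewrite !(iotaB, iotaM, iotaZ, iotaS); ncring R (uz (unitization_of A)).
Qed.

(** Positivity of the inner square of [x a - t y] reads [a^*X a - 2 t a^*a + t^2 Y >= 0]. For
    [t > ||X||] the first term is at most [t a^*a], whence [a^*a <= t Y]. The excess [d] keeps [t]
    positive and costs at most [e] in the end. *)
Lemma fip_CS r x y : nrm (fip r x y) ^+ 2 <= nrm (fip r x x) * nrm (fip r y y).
Proof.
set X := fip r x x; set Y := fip r y y; set a := fip r x y.
apply/ler_addgt0Pr => e e0; pose d := e / (nrm Y + 1).
have Y0 : 0 < nrm Y + 1 by have := nrm_ge0 Y; lra.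
have d0 : 0 < d by rewrite divr_gt0.
pose t := nrm X + d; have t0 : 0 < t by have := nrm_ge0 X; rewrite /t; lra.
have asa : astar a = fip r y x.
  by rewrite /a /fip astar_sum; apply: eq_bigr => k _; rewrite astarM astarK.
have p1 : posA (amul (astar a) (amul X a) - t%:C *: (amul (astar a) a + amul (astar a) a)
    + (t * t)%:C *: Y).
  have := posA_fip r (fun k => amul (x k) a - t%:C *: y k); congr posA.
  rewrite {1}/fip; transitivity (\sum_(k <- r) (
      amul (astar a) (amul (amul (astar (x k)) (x k)) a)
      - t%:C *: (amul (astar a) (amul (astar (x k)) (y k)) + amul (amul (astar (y k)) (x k)) a)
      + (t * t)%:C *: amul (astar (y k)) (y k))).
    apply: eq_bigr => k _.
    rewrite astarB astarZ conjR astarM amulBl !amulBr !amulZl !amulZr -!amulA.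
    by linring R A.
  rewrite big_split /= sumrB -!scaler_sumr big_split /=; congr (_ - _ *: (_ + _) + _).
  - by rewrite -amul_sumr -amul_suml.
  - by rewrite -amul_sumr.
  - by rewrite -amul_suml asa.
have p2 : posA (t%:C *: amul (astar a) a - amul (astar a) (amul X a)).
  by apply: posA_le_conj; [exact: posA_fip | rewrite /t lerDl ltW].
have p3 : posA (t%:C *: Y - amul (astar a) a).
  have := posAZ (ltW (_ : 0 < t^-1)) (posAD p1 p2); rewrite invr_gt0 => /(_ t0).
  congr posA; set q := amul _ (amul X a); set s := amul _ a.
  have -> : q - t%:C *: (s + s) + (t * t)%:C *: Y + (t%:C *: s - q) =
    t%:C *: (t%:C *: Y - s) by linring R A.
  by rewrite scalerA -rmorphM /= mulVf ?gt_eqF// scale1r.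
have := posA_mono (posA_starM a) p3.
rewrite nrm_star nrmZ cabsR gtr0_norm// => h; apply: le_trans h _.
rewrite /t mulrDl lerD2l /d mulrAC ler_pdivrMr// ler_wpM2l ?ltW//; lra.
Qed.

Lemma nrm_fip_ge0 r x y : 0 <= nrm (fip r x y). Proof. exact: nrm_ge0. Qed.

Lemma fip_cat r r' x y : fip (r ++ r') x y = fip r x y + fip r' x y.
Proof. exact: big_cat. Qed.

Lemma fip_mono r r' x : nrm (fip r x x) <= nrm (fip (r ++ r') x x).
Proof. by rewrite fip_cat; apply: posA_mono_add; exact: posA_fip. Qed.

Lemma fip_mono_r r r' x : nrm (fip r' x x) <= nrm (fip (r ++ r') x x).
Proof. by rewrite fip_cat addrC; apply: posA_mono_add; exact: posA_fip. Qed.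

Lemma fip_dom r x y t : 0 <= t -> (forall k, posA ((t * t)%:C *: amul (astar (x k)) (x k)
    - amul (astar (y k)) (y k))) ->
  nrm (fip r y y) <= t * t * nrm (fip r x x).
Proof.
move=> t0 h.
have -> : t * t * nrm (fip r x x) = nrm ((t * t)%:C *: fip r x x).
  by rewrite nrmZ cabsR ger0_norm// mulr_ge0.
apply: posA_mono; first exact: posA_fip.
rewrite /fip scaler_sumr -sumrB; exact: posA_sum.
Qed.

(** By the parallelogram identity, what is missing on the left is the inner square of [x - y]. *)
Lemma fip_addle r x y : nrm (fip r (fun k => x k + y k) (fun k => x k + y k)) <=
  2 * nrm (fip r x x) + 2 * nrm (fip r y y).
Proof.
have -> : 2 * nrm (fip r x x) + 2 * nrm (fip r y y) =
    nrm (2%:C *: fip r x x) + nrm (2%:C *: fip r y y).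
  by rewrite !nrmZ !cabsR ger0_norm.
apply: le_trans (nrmD _ _).
apply: posA_mono; first exact: posA_fip.
have := posA_fip r (fun k => x k - y k); congr posA.
rewrite /fip !scaler_sumr -big_split /= -sumrB; apply: eq_bigr => k _.
have -> : 2%:C = 1 + 1 :> R[i] by rewrite rmorphD.
rewrite !astarB !astarD !amulBl !amulDl !amulBr !amulDr.
by linring R A.
Qed.

End FiniteCauchySchwarz.

(** * Domain and inner product of the module of sequences *)

Section L2.
Context {R : realType} {A : cstarType R}.
Local Open Scope complex_scope.
Local Notation X := (l2mod A).
Implicit Types (x y z : X) (a b : A) (t : R).

Definition psum x y n : A := fip (index_iota 0 n) x y.

Lemma psumB x y m n : (m <= n)%N -> psum x y n - psum x y m = fip (index_iota m n) x y.
Proof.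
move=> mn; rewrite /psum /fip (@big_cat_nat _ _ _ m 0 n)//=.
by rewrite addrAC subrr add0r.
Qed.

Lemma l2_domP x : dom x <-> forall e : R, 0 < e -> exists N, forall m n,
  (N <= m)%N -> (m <= n)%N -> nrm (fip (index_iota m n) x x) < e.
Proof.
split=> [/cvg_ex[l /cvto_cvg hl] e e0|h].
  have [N hN] := cvto_cauchy hl e0; exists N => m n Nm mn.
  by rewrite -psumB// hN// (leq_trans Nm).
have [|l hl] := @nrm_complete R A (psum x x).
  move=> e e0; have [N hN] := h e e0; exists N => m n Nm Nn.
  have [mn|nm] := leqP m n; last by rewrite psumB ?hN// ltnW.
  by rewrite nrm_distC psumB ?hN.
by apply/cvg_ex; exists l; apply/cvto_cvg.
Qed.

Lemma psum_cauchy x y : dom x -> dom y -> cauchyto nrm (psum x y).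
Proof.
move=> /l2_domP hx /l2_domP hy e e0.
have [N hN] := hx e e0; have [N' hN'] := hy e e0.
have key m n : (maxn N N' <= m)%N -> (m <= n)%N -> nrm (psum x y n - psum x y m) < e.
  rewrite geq_max => /andP[h1 h2] mn; rewrite psumB//.
  have a := hN m n h1 mn; have b := hN' m n h2 mn.
  have c := fip_CS (index_iota m n) x y.
  rewrite -(@ltr_pXn2r _ 2)// ?nnegrE ?nrm_ge0 ?(ltW e0)//.
  apply: le_lt_trans c _; rewrite expr2.
  have := nrm_fip_ge0 (index_iota m n) x x; have := nrm_fip_ge0 (index_iota m n) y y.
  nra.
exists (maxn N N') => m n hm hn; have [mn|/ltnW nm] := leqP m n; last exact: key.
by rewrite nrm_distC; exact: key.
Qed.

Lemma ip_cvto x y : dom x -> dom y -> cvto nrm (psum x y) (ip x y).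
Proof.
move=> dx dy; have [l hl] := nrm_complete (psum_cauchy dx dy).
have e : ip x y = l by exact: (cvto_lim hl).
by rewrite e.
Qed.

Lemma ip_eq_lim x y (l : A) : dom x -> dom y -> cvto nrm (psum x y) l -> ip x y = l.
Proof. by move=> dx dy; apply: cvto_unique; exact: ip_cvto. Qed.

Lemma l2_domD x y : dom x -> dom y -> dom (x + y).
Proof.
move=> /l2_domP hx /l2_domP hy; apply/l2_domP => e e0.
have e4 : 0 < e / 4 by rewrite divr_gt0.
have [N hN] := hx _ e4; have [N' hN'] := hy _ e4.
exists (maxn N N') => m n; rewrite geq_max => /andP[h1 h2] mn.
apply: le_lt_trans (fip_addle _ _ _) _.
have := hN m n h1 mn; have := hN' m n h2 mn; lra.
Qed.

Lemma l2_dom_le x y t : 0 <= t -> (forall k, posA ((t * t)%:C *: amul (astar (x k)) (x k)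
    - amul (astar (y k)) (y k))) -> dom x -> dom y.
Proof.
move=> t0 h /l2_domP hx; apply/l2_domP => e e0.
pose K := t * t + 1; have K0 : 0 < K by have := mulr_ge0 t0 t0; rewrite /K; lra.
have [N hN] := hx (e / K) ltac:(by rewrite divr_gt0).
exists N => m n hm mn; apply: le_lt_trans (fip_dom _ t0 h) _.
have := hN m n hm mn; rewrite ltr_pdivlMr// /K.
have := nrm_fip_ge0 (index_iota m n) x x; nra.
Qed.

Lemma l2_domZ (k : R[i]) x : dom x -> dom (k *: x).
Proof.
apply: (@l2_dom_le _ _ (cabs k)) => [|n]; first exact: cabs_ge0.
have -> : (k *: x) n = k *: x n by [].
rewrite astarZ amulZl amulZr scalerA.
have -> : (cabs k * cabs k)%:C = Num.conj k * k by rewrite (mulrC (Num.conj k)) mul_conj_cabs expr2.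
by rewrite subrr; exact: posA0.
Qed.

Lemma l2_dom0 : dom (0 : X).
Proof.
apply/l2_domP => e e0; exists 0%N => m n _ _; rewrite /fip big1 ?nrm0// => k _.
exact: amul0r.
Qed.

Lemma cvto_lin (k : R[i]) (u w : nat -> A) (l m : A) :
  cvto nrm u l -> cvto nrm w m -> cvto nrm (fun n => k *: u n + w n) (k *: l + m).
Proof.
move=> hu hw e e0; pose M := cabs k + 1.
have M0 : 0 < M by have := cabs_ge0 k; rewrite /M; lra.
have [n0 h0] := hu (e / (2 * M)) ltac:(by rewrite divr_gt0// mulr_gt0).
have [n1 h1] := hw (e / 2) ltac:(by rewrite divr_gt0).
exists (maxn n0 n1) => n; rewrite geq_max => /andP[/h0 a /h1 b].
have -> : k *: u n + w n - (k *: l + m) = k *: (u n - l) + (w n - m) by linring R A.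
apply: le_lt_trans (nrmD _ _) _; rewrite nrmZ.
rewrite ltr_pdivlMr ?mulr_gt0// /M in a.
have := nrm_ge0 (u n - l); have := cabs_ge0 k; nra.
Qed.

Lemma cvto_star (u : nat -> A) l : cvto nrm u l ->
  cvto nrm (fun n => astar (u n)) (astar l).
Proof.
move=> h e e0; have [N hN] := h e e0; exists N => n hn.
by rewrite -astarB nrmS; exact: hN.
Qed.

Lemma cvto_ext (V : zmodType) (N : V -> R) (u u' : nat -> V) l :
  (forall n, u n = u' n) -> cvto N u l -> cvto N u' l.
Proof. by move=> h; have -> : u = u' by apply/funext. Qed.

Lemma cvto_nrm_le (u w : nat -> A) l m : cvto nrm u l -> cvto nrm w m ->
  (forall n, nrm (u n) <= nrm (w n)) -> nrm l <= nrm m.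
Proof.
move=> hu hw h; apply/ler_addgt0Pr => e e0.
have e2 : 0 < e / 2 by rewrite divr_gt0.
have [n0 h0] := hu _ e2; have [n1 h1] := hw _ e2.
have := h0 _ (leq_maxl n0 n1); have := h1 _ (leq_maxr n0 n1); move: (maxn n0 n1) => n.
have := h n; have := nrm_tri (u n) l 0; have := nrm_tri m (w n) 0.
by rewrite !subr0 (nrm_distC l); lra.
Qed.

Lemma cvto_nrm_bound (u : nat -> A) l M : cvto nrm u l ->
  (forall n, nrm (u n) <= M) -> nrm l <= M.
Proof.
move=> hu h; apply/ler_addgt0Pr => e e0; have [n0 /(_ n0 (leqnn _)) h0] := hu _ e0.
by have := h n0; have := nrm_tri (u n0) l 0; rewrite !subr0 nrm_distC; lra.
Qed.

Lemma psum_le_ip x n : dom x -> nrm (psum x x n) <= nrm (ip x x : A).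
Proof.
move=> dx; apply/ler_addgt0Pr => e e0; have [N hN] := ip_cvto dx dx e0.
have h1 := hN _ (leq_maxr n N); move: (leq_maxl n N) h1; move: (maxn n N) => m nm h1.
have h2 : nrm (psum x x n) <= nrm (psum x x m).
  rewrite /psum /index_iota !subn0 -(subnKC nm) seq.iotaD.
  exact: fip_mono.
have := nrm_tri (ip x x : A) (psum x x m) 0; rewrite !subr0; lra.
Qed.

Lemma inrm_l2 x : inrm x = Num.sqrt (nrm (ip x x : A)).
Proof. by []. Qed.

Lemma l2_ip0 x : dom x -> nrm (ip x x : A) = 0 -> x = 0.
Proof.
move=> dx h; apply/funext => n; apply: nrm0_eq0; apply/eqP.
rewrite -sqrf_eq0 -nrm_star eq_le nrm_ge0 andbT.
have := psum_le_ip n.+1 dx; rewrite h; apply: le_trans.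
rewrite /psum /index_iota subn0 -addn1 seq.iotaD add0n.
have -> : amul (astar (x n)) (x n) = fip (seq.iota n 1) x x by rewrite /fip big_seq1.
exact: fip_mono_r.
Qed.

Lemma psum_linr k x y z n : psum x (k *: y + z) n = k *: psum x y n + psum x z n.
Proof.
rewrite /psum /fip scaler_sumr -big_split; apply: eq_bigr => i _ /=.
by rewrite -[(k *: y + z) i]/(k *: y i + z i) amulDr amulZr.
Qed.

Lemma l2_domP' k x y : dom x -> dom y -> dom (k *: x + y).
Proof. by move=> dx dy; apply: l2_domD => //; exact: l2_domZ. Qed.

Lemma l2_ipP k x y z : dom x -> dom y -> dom z ->
  ip x (k *: y + z) = k *: (ip x y : A) + ip x z.
Proof.
move=> dx dy dz; apply: ip_eq_lim => //; first exact: l2_domP'.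
by apply: cvto_ext (cvto_lin k (ip_cvto dx dy) (ip_cvto dx dz)) => n; rewrite psum_linr.
Qed.

Lemma l2_ip_star x y : dom x -> dom y -> ip y x = astar (ip x y : A).
Proof.
move=> dx dy; apply: ip_eq_lim => //.
apply: cvto_ext (cvto_star (ip_cvto dx dy)) => n.
by rewrite /psum /fip astar_sum; apply: eq_bigr => i _; rewrite astarM astarK.
Qed.

Lemma l2_CS x y : dom x -> dom y ->
  nrm (ip x y : A) <= Num.sqrt (nrm (ip x x : A)) * Num.sqrt (nrm (ip y y : A)).
Proof.
move=> dx dy; rewrite -sqrtrM ?nrm_ge0//.
apply: (cvto_nrm_bound (ip_cvto dx dy)) => n.
rewrite -(ger0_norm (nrm_ge0 (psum x y n))) -sqrtr_sqr ler_wsqrtr//.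
apply: le_trans (fip_CS _ _ _) _.
by apply: ler_pM; rewrite ?nrm_ge0//; exact: psum_le_ip.
Qed.

Lemma hmodule_l2 : hmodule X.
Proof.
have ipPl k x y z : dom x -> dom y -> dom z ->
    ip (k *: x + y) z = Num.conj k *: (ip x z : A) + ip y z.
  move=> dx dy dz; rewrite l2_ip_star ?l2_ipP//; last exact: l2_domP'.
  by rewrite astarD astarZ -!l2_ip_star.
have ipZr k x y : dom x -> dom y -> ip x (k *: y) = k *: (ip x y : A).
  move=> dx dy; have := l2_ipP k dx dy l2_dom0.
  rewrite addr0 => ->; rewrite (_ : ip x 0 = 0 :> A) ?addr0//.
  have := l2_ipP 1 dx l2_dom0 l2_dom0.
  by rewrite !scale1r addr0 => /eqP; rewrite eq_sym -subr_eq0 addrK => /eqP.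
have ipZl k x y : dom x -> dom y -> ip (k *: x) y = Num.conj k *: (ip x y : A).
  move=> dx dy; rewrite l2_ip_star ?ipZr//; last exact: l2_domZ.
  by rewrite astarZ -l2_ip_star.
have tri x y : dom x -> dom y -> inrm (x + y) <= inrm x + inrm y.
  move=> dx dy; have dxy := l2_domD dx dy.
  have ip_add : ip (x + y) (x + y) = ip x x + ip x y + (ip y x + ip y y) :> A.
    have h z : dom z -> ip z (x + y) = ip z x + ip z y :> A.
      by move=> dz; have := l2_ipP 1 dz dx dy; rewrite !scale1r.
    have := ipPl 1 x y (x + y) dx dy dxy.
    by rewrite rmorph1 !scale1r !h.
  have := l2_CS dx dy; have := l2_CS dy dx; rewrite !inrm_l2 => h1 h2.
  have s0 z := sqrtr_ge0 (nrm (ip z z : A)).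
  rewrite -(@ler_pXn2r _ 2)// ?nnegrE ?addr_ge0 ?sqrtr_ge0//.
  rewrite sqr_sqrtr ?nrm_ge0// ip_add.
  have := nrmD (ip x x + ip x y : A) (ip y x + ip y y).
  have := nrmD (ip x x : A) (ip x y); have := nrmD (ip y x : A) (ip y y).
  have := sqr_sqrtr (nrm_ge0 (ip x x : A)); have := sqr_sqrtr (nrm_ge0 (ip y y : A)).
  nra.
split=> //.
- exact: l2_domP'.
- exact: l2_dom0.
- by move=> x y z dx dy dz; have := l2_ipP 1 dx dy dz; rewrite !scale1r.
- by move=> x y z dx dy dz; have := ipPl 1 x y z dx dy dz; rewrite rmorph1 !scale1r.
- by move=> k x y dx dy; rewrite ipZl// ipZr.
- by move=> k x y x' y' dx dy dx' dy' h; rewrite !ipZr// h.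
- by move=> x y x' y' dx dy dx' dy' h; rewrite (l2_ip_star dx dy) h -l2_ip_star.
- move=> x dx h; apply: l2_ip0 => //; apply/eqP.
  by rewrite -[nrm _]/(vnrm (ip x x)) -inrm_sq h expr0n.
- exact: l2_CS.
- move=> x y dx dy; apply: cvto_nrm_le (ip_cvto dx dx) _ _.
    have := cvto_lin 1 (ip_cvto dx dx) (ip_cvto dy dy); rewrite scale1r; exact.
  by move=> n; rewrite /= scale1r; apply: posA_mono_add; exact: posA_fip.
- move=> k x dx; rewrite !inrm_l2 ipZl ?ipZr//; last exact: l2_domZ.
  rewrite scalerA nrmZ cabsM cabsJ -expr2 sqrtrM ?sqr_ge0// sqrtr_sqr ger0_norm//.
  exact: cabs_ge0.
Qed.

End L2.

(** * Compact operators on l^2(N, A) *)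

Section L2Operators.
Context {R : realType} {A : cstarType R}.
Local Open Scope complex_scope.
Local Notation X := (l2mod A).
Local Notation hX := (@hmodule_l2 R A).
Implicit Types (x y z : X) (a b : A) (t : R) (T S : X -> X).

Lemma l2_inrm_sq x : inrm x ^+ 2 = nrm (ip x x : A).
Proof. exact: inrm_sq. Qed.

Lemma l2_inrm_le x M : 0 <= M -> nrm (ip x x : A) <= M * M -> inrm x <= M.
Proof.
move=> M0 h; rewrite -(@ler_pXn2r _ 2)// ?nnegrE ?inrm_ge0//.
by rewrite l2_inrm_sq expr2.
Qed.

Lemma coord_le x n : dom x -> nrm (x n) <= inrm x.
Proof.
move=> dx; rewrite -(@ler_pXn2r _ 2)// ?nnegrE ?inrm_ge0 ?nrm_ge0//.
rewrite l2_inrm_sq -nrm_star; apply: le_trans (psum_le_ip n.+1 dx).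
rewrite /psum /index_iota subn0 -addn1 seq.iotaD add0n.
have -> : amul (astar (x n)) (x n) = fip (seq.iota n 1) x x by rewrite /fip big_seq1.
exact: fip_mono_r.
Qed.

Lemma cvto_eventually (u : nat -> A) l N : (forall n, (N <= n)%N -> u n = l) ->
  cvto nrm u l.
Proof. by move=> h e e0; exists N => n /h ->; rewrite subrr nrm0. Qed.

Lemma cvto_succ (u : nat -> A) l : cvto nrm (fun n => u n.+1) l -> cvto nrm u l.
Proof.
move=> h e e0; have [N hN] := h e e0; exists N.+1 => -[//|n] hn.
exact: hN.
Qed.

Lemma cvto_succ' (u : nat -> A) l : cvto nrm u l -> cvto nrm (fun n => u n.+1) l.
Proof. by move=> h e e0; have [N hN] := h e e0; exists N => n hn; apply/hN/leqW. Qed.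

Lemma l2_dom_cvto x l : cvto nrm (psum x x) l -> dom x.
Proof. by move=> h; apply/cvg_ex; exists l; apply/cvto_cvg. Qed.

Definition single n a : X := fun k => if k == n then a else 0.

Lemma psum_single n a y m : (n < m)%N -> psum (single n a) y m = amul (astar a) (y n).
Proof.
move=> nm; rewrite /psum /fip (bigD1_seq n) ?mem_index_iota ?iota_uniq//=.
rewrite /single eqxx big1 ?addr0// => i /negbTE ->.
by rewrite astar0 amul0l.
Qed.

Lemma single_dom n a : dom (single n a).
Proof.
apply: (@l2_dom_cvto _ (amul (astar a) a)); apply: (@cvto_eventually _ _ n.+1) => m nm.
by rewrite psum_single// /single eqxx.
Qed.

Lemma ip_single n a y : dom y -> ip (single n a) y = amul (astar a) (y n).
Proof.
move=> dy; apply: ip_eq_lim => //; first exact: single_dom.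
by apply: (@cvto_eventually _ _ n.+1) => m nm; rewrite psum_single.
Qed.

Lemma ip_single' n a y : dom y -> ip y (single n a) = amul (astar (y n)) a.
Proof.
move=> dy; rewrite l2_ip_star ?ip_single//; last exact: single_dom.
by rewrite astarM astarK.
Qed.

Lemma inrm_single n a : inrm (single n a) = nrm a.
Proof.
rewrite inrm_l2 ip_single; last exact: single_dom.
rewrite /single eqxx nrm_star sqrtr_sqr ger0_norm//; exact: nrm_ge0.
Qed.

Definition trunc N x : X := fun k => if (k < N)%N then x k else 0.

Lemma truncS N x : trunc N.+1 x = trunc N x + single N (x N).
Proof.
apply/funext => k; rewrite -[RHS]/(trunc N x k + single N (x N) k) /trunc /single.
rewrite ltnS leq_eqVlt; case: eqP => [->|_] /=; first by rewrite ltnn add0r.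
by rewrite addr0.
Qed.

Lemma trunc0 x : trunc 0 x = 0.
Proof. by []. Qed.

Lemma trunc_dom N x : dom (trunc N x).
Proof.
elim: N => [|N IH]; first by rewrite trunc0; exact: hm_dom0 hX.
by rewrite truncS; apply: l2_domD => //; exact: single_dom.
Qed.

Lemma trunc_dense x (e : R) : dom x -> 0 < e -> exists N, inrm (x - trunc N x) <= e.
Proof.
move=> dx e0; have /l2_domP/(_ (e * e)) := dx.
rewrite mulr_gt0// => /(_ isT)[N hN]; exists N.
have dd : dom (x - trunc N x) by apply: (domB hX) => //; exact: trunc_dom.
apply: l2_inrm_le; first exact: ltW.
(* With the index [maxn N m] every partial sum is a segment of the series of [x] starting at [N],
   which the Cauchy criterion bounds. *)
have h : cvto nrm (fun m => psum (x - trunc N x) (x - trunc N x) (maxn N m))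
    (ip (x - trunc N x) (x - trunc N x)).
  move=> d d0; have [N' hN'] := ip_cvto dd dd d0; exists N' => m hm.
  by apply: hN'; rewrite leq_max hm orbT.
apply: (cvto_nrm_bound h) => m; have /ltW := hN N (maxn N m) (leqnn _) (leq_maxl _ _).
congr (nrm _ <= _); rewrite -psumB ?leq_maxl//.
rewrite /psum /fip !(@big_cat_nat _ _ _ N 0 (maxn N m)) ?leq_maxl//=.
rewrite addrAC subrr add0r big_nat [X in _ = X + _]big1_seq ?add0r.
  rewrite big_nat; apply: eq_bigr => i /andP[Ni _].
  by rewrite -[(x - _) i]/(x i - trunc N x i) /trunc ltnNge Ni subr0.
move=> i /=; rewrite mem_index_iota => /andP[_ iN].
by rewrite -[(x - _) i]/(x i - trunc N x i) /trunc iN subrr astar0 amul0l.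
Qed.

Lemma l2_adjoint (f g : X -> X) : (forall x, dom x -> dom (f x)) ->
  (forall x, dom x -> dom (g x)) ->
  (forall x y, dom x -> dom y -> ip (f x) y = ip x (g y)) ->
  is_adjoint (restr f) (restr g).
Proof.
move=> df dg h; split.
- by split=> x dx; [rewrite restrE//; exact: df | exact: restr_out].
- by split=> x dx; [rewrite restrE//; exact: dg | exact: restr_out].
- by move=> x y dx dy; rewrite !restrE// h.
Qed.

(** Both [pi_alpha alpha a] and the projection [p] have this form, with entrywise bounds in the
    order of [A]. *)
Definition diag (d : nat -> A -> A) : X -> X := restr (fun x k => d k (x k)).

Section Diagonal.
Variables (d d' : nat -> A -> A) (t : R).
Hypothesis t0 : 0 <= t.
Hypothesis hd : forall k a b, amul (astar (d k a)) b = amul (astar a) (d' k b).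
Hypothesis bd : forall k a, posA ((t * t)%:C *: amul (astar a) a
  - amul (astar (d k a)) (d k a)).

Lemma diag_dom x : dom x -> dom ((fun k => d k (x k)) : X).
Proof. by apply: l2_dom_le t0 _ => k; exact: bd. Qed.

Lemma bounded_by_diag : bounded_by (diag d) t.
Proof.
move=> x dx; rewrite /diag restrE//; apply: l2_inrm_le.
  by rewrite mulr_ge0 ?inrm_ge0.
have dd := diag_dom dx.
apply: (cvto_nrm_bound (ip_cvto dd dd)) => n.
apply: le_trans (@fip_dom _ _ _ x _ _ t0 _) _; first by move=> k; exact: bd.
rewrite mulrACA -[inrm x * _]expr2 l2_inrm_sq ler_wpM2l ?mulr_ge0//; exact: psum_le_ip.
Qed.

Hypothesis bd' : forall k a, posA ((t * t)%:C *: amul (astar a) a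
  - amul (astar (d' k a)) (d' k a)).

Lemma diag_adjoint : is_adjoint (diag d) (diag d').
Proof.
have dd' x : dom x -> dom ((fun k => d' k (x k)) : X).
  by apply: l2_dom_le t0 _ => k; exact: bd'.
apply: l2_adjoint => //; first exact: diag_dom.
move=> x y dx dy; apply: ip_eq_lim => //; first exact: diag_dom.
have h : cvto nrm (psum x (fun k => d' k (y k))) (ip x ((fun k => d' k (y k)) : X)).
  by apply: ip_cvto => //; exact: dd'.
by apply: cvto_ext h => n; apply: eq_bigr => k _; rewrite hd.
Qed.

End Diagonal.

Definition unshift : X -> X := restr (fun x k => x k.+1).

Lemma shiftE x k : dom x -> Defs.shift A x k = if k is j.+1 then x j else 0.
Proof. by move=> dx; rewrite /Defs.shift restrE//; case: k. Qed.

Lemma psum_recl x y n : psum x y n.+1 = amul (astar (x 0%N)) (y 0%N) +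
  psum (fun k => x k.+1) (fun k => y k.+1) n.
Proof. by rewrite /psum /fip big_nat_recl. Qed.

Lemma dom_unshift x : dom x -> dom ((fun k => x k.+1) : X).
Proof.
move=> dx; apply: (@l2_dom_cvto _ (-1 *: amul (astar (x 0%N)) (x 0%N) + ip x x)).
have := cvto_lin (-1) (@cvto_eventually (fun=> amul (astar (x 0%N)) (x 0%N)) _ 0 (fun _ _ => erefl))
  (cvto_succ' (ip_cvto dx dx)).
by apply: cvto_ext => n; rewrite psum_recl scaleN1r addKr.
Qed.

Lemma shift_adjoint : is_adjoint (Defs.shift A) unshift.
Proof.
apply: l2_adjoint => [x dx|x dx|x y dx dy].
- apply: (@l2_dom_cvto _ (ip x x)); apply: cvto_succ; apply: cvto_ext (ip_cvto dx dx) => n.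
  by rewrite psum_recl astar0 amul0l add0r.
- exact: dom_unshift.
- have dsx : dom ((fun n => if n is k.+1 then x k else 0) : X).
    apply: (@l2_dom_cvto _ (ip x x)); apply: cvto_succ.
    by apply: cvto_ext (ip_cvto dx dx) => n; rewrite psum_recl astar0 amul0l add0r.
  have dux : dom ((fun k => y k.+1) : X).
    by have := dom_unshift dy.
  rewrite /=; apply/esym; apply: (cvto_unique (ip_cvto dx dux)).
  apply: cvto_ext (cvto_succ' (ip_cvto dsx dy)) => n.
  by rewrite psum_recl astar0 amul0l add0r.
Qed.

Lemma shiftn0 : shiftn A 0 = idop X. Proof. by []. Qed.

Lemma shift_adjointable : adjointable X (Defs.shift A).
Proof. by exists unshift; exact: shift_adjoint. Qed.

Lemma shiftnS n : shiftn A n.+1 = Defs.shift A \o shiftn A n.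
Proof.
apply/funext => x /=; have [dx|dx] := pselect (dom x); first by rewrite /shiftn !restrE.
rewrite /shiftn !restr_out//.
by apply/esym; apply: (adjointable0r hX shift_adjointable).
Qed.

Lemma shiftn_adjoint n : is_adjoint (shiftn A n) (iter n (fun T => T \o unshift) (idop X)).
Proof.
elim: n => [|n IH]; first exact: is_adjoint_id.
by rewrite shiftnS iterS; apply: (is_adjoint_comp hX) => //; exact: shift_adjoint.
Qed.

Lemma shiftn_adjointable n : adjointable X (shiftn A n).
Proof. by eexists; exact: shiftn_adjoint. Qed.

Lemma adj_shiftn_adjointable n : adjointable X (adj (shiftn A n)).
Proof. exact: adj_adjointable hX _ (shiftn_adjointable n). Qed.

Lemma shiftn_coord n x k : dom x -> shiftn A n x k = if (k < n)%N then 0 else x (k - n)%N.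
Proof.
move=> dx; elim: n k => [|n IH] k; first by rewrite shiftn0 idopE// subn0.
rewrite shiftnS /= shiftE; last exact: adjointable_dom (shiftn_adjointable n) dx.
by case: k => [//|k]; rewrite IH ltnS subSS.
Qed.

Lemma adj_shiftn_coord n x k : dom x -> adj (shiftn A n) x k = x (n + k)%N.
Proof.
rewrite (adjE hX (shiftn_adjoint n)); elim: n x k => [|n IH] x k dx.
  by rewrite /= idopE.
rewrite iterS /= IH; last by rewrite /unshift restrE//; exact: dom_unshift.
by rewrite /unshift restrE// addSn.
Qed.

Lemma op_eq T S : adjointable X T -> adjointable X S ->
  (forall x k, dom x -> T x k = S x k) -> T = S.
Proof.
move=> hT hS h; have e x : dom x -> T x = S x by move=> dx; apply/funext => k; exact: h.
exact: adjointable_eq hT hS e.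
Qed.

(** The operator [e_mn(a)]; it has rank one as soon as [a] is a product ([rank1_single]). *)
Definition munit m n a : X -> X := restr (fun x => single m (amul a (x n))).

Lemma munitE m n a x : dom x -> munit m n a x = single m (amul a (x n)).
Proof. exact: restrE. Qed.

Lemma munit_adjoint m n a : is_adjoint (munit m n a) (munit n m (astar a)).
Proof.
apply: l2_adjoint => [x _|x _|x y dx dy]; try exact: single_dom.
by rewrite ip_single// ip_single'// astarM amulA.
Qed.

Lemma munit_adjointable m n a : adjointable X (munit m n a).
Proof. by eexists; exact: munit_adjoint. Qed.

Lemma bounded_munit m n a : bounded_by (munit m n a) (nrm a).
Proof.
move=> x dx; rewrite munitE// inrm_single; apply: le_trans (nrmM _ _) _.
by rewrite ler_wpM2l ?nrm_ge0//; exact: coord_le.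
Qed.

Lemma munitB m n a b : munit m n (a - b) = munit m n a - munit m n b.
Proof.
apply: op_eq => [||x k dx]; first exact: munit_adjointable.
  by apply: (adjointable_sub hX); exact: munit_adjointable.
rewrite op_subE -[RHS]/(munit m n a x k - munit m n b x k) !munitE// /single.
by case: eqP => _; rewrite ?subr0// amulBl.
Qed.

Definition rank1 x y : X -> X := rank_one (@l2_act R A) x y.

Lemma rank1E x y z : dom z -> rank1 x y z = l2_act x (ip y z).
Proof. exact: restrE. Qed.

Lemma psum_act x y a n : psum x (l2_act y a) n = amul (psum x y n) a.
Proof.
by rewrite /psum /fip amul_suml; apply: eq_bigr => k _; rewrite /l2_act amulA.
Qed.

Lemma cvto_mulr (u : nat -> A) l a : cvto nrm u l ->
  cvto nrm (fun n => amul (u n) a) (amul l a).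
Proof.
move=> h e e0; pose K := nrm a + 1; have K0 : 0 < K by have := nrm_ge0 a; rewrite /K; lra.
have [N hN] := h (e / K) ltac:(by rewrite divr_gt0); exists N => n /hN.
rewrite ltr_pdivlMr// -amulBl => h1; apply: le_lt_trans (nrmM _ _) _.
apply: le_lt_trans h1; rewrite ler_wpM2l ?nrm_ge0// /K; lra.
Qed.

Lemma act_dom x a : dom x -> dom (l2_act x a).
Proof.
move=> /l2_domP hx; apply/l2_domP => e e0.
pose K := nrm a * nrm a + 1.
have K0 : 0 < K by have := mulr_ge0 (nrm_ge0 a) (nrm_ge0 a); rewrite /K; lra.
have [N hN] := hx (e / K) ltac:(by rewrite divr_gt0).
exists N => m n hm mn; have := hN m n hm mn; rewrite ltr_pdivlMr//.
apply: le_lt_trans; set f := fip _ x x.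
have -> : fip (index_iota m n) (l2_act x a) (l2_act x a) = amul (astar a) (amul f a).
  rewrite /f /fip amul_suml amul_sumr; apply: eq_bigr => k _.
  by rewrite /l2_act astarM !amulA.
apply: le_trans (nrmM _ _) _; rewrite nrmS.
have := nrmM f a; have := nrm_ge0 a; have := nrm_ge0 f; rewrite /K; nra.
Qed.

Lemma ip_act x y a : dom x -> dom y -> ip x (l2_act y a) = amul (ip x y : A) a.
Proof.
move=> dx dy; apply: ip_eq_lim => //; first exact: act_dom.
by apply: cvto_ext (cvto_mulr a (ip_cvto dx dy)) => n; rewrite psum_act.
Qed.

Lemma ip_actl x y a : dom x -> dom y -> ip (l2_act x a) y = amul (astar a) (ip x y : A).
Proof.
move=> dx dy; rewrite l2_ip_star ?ip_act//; last exact: act_dom.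
by rewrite astarM -l2_ip_star.
Qed.

Lemma inrm_act x a : dom x -> inrm (l2_act x a) <= inrm x * nrm a.
Proof.
move=> dx; apply: l2_inrm_le; first by rewrite mulr_ge0 ?inrm_ge0 ?nrm_ge0.
rewrite ip_act ?ip_actl//; last exact: act_dom.
rewrite mulrACA -[inrm x * _]expr2 l2_inrm_sq.
apply: le_trans (nrmM _ _) _; have := nrmM (astar a) (ip x x : A); rewrite nrmS.
have := nrm_ge0 a; nra.
Qed.

Lemma adjointable_act T x a : adjointable X T -> dom x ->
  T (l2_act x a) = l2_act (T x) a.
Proof.
move=> hT dx; have dTx := adjointable_dom hT dx.
have dxa := act_dom dx (a := a); have dTxa := act_dom dTx (a := a).
apply: (ip_eq_right hX (adjointable_dom hT dxa) dTxa) => z dz.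
have dz' := adjointable_dom (adj_adjointable hX hT) dz.
by rewrite -(adj_ip' hX hT dz dxa) !ip_act// (adj_ip' hX hT dz dx).
Qed.

Lemma rank1_adjoint x y : dom x -> dom y -> is_adjoint (rank1 x y) (rank1 y x).
Proof.
move=> dx dy; apply: l2_adjoint => [z dz|z dz|z w dz dw]; try exact: act_dom.
by rewrite ip_act// ip_actl// -l2_ip_star.
Qed.

Lemma rank1_adjointable x y : dom x -> dom y -> adjointable X (rank1 x y).
Proof. by move=> dx dy; eexists; exact: rank1_adjoint. Qed.

Lemma bounded_rank1 x y : dom x -> dom y -> bounded_by (rank1 x y) (inrm x * inrm y).
Proof.
move=> dx dy z dz; rewrite rank1E//; apply: le_trans (inrm_act _ dx) _.
rewrite -mulrA ler_wpM2l ?inrm_ge0//; exact: (hm_CS hX dy dz).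
Qed.

Lemma comp_rank1 T x y : adjointable X T -> dom x -> dom y ->
  T \o rank1 x y = rank1 (T x) y.
Proof.
move=> hT dx dy; have dTx := adjointable_dom hT dx.
apply: adjointable_eq => [||z dz /=].
- by apply: (adjointable_comp hX) => //; exact: rank1_adjointable.
- exact: rank1_adjointable.
- by rewrite !rank1E// adjointable_act.
Qed.

Lemma rank1_comp T x y : adjointable X T -> dom x -> dom y ->
  rank1 x y \o T = rank1 x (adj T y).
Proof.
move=> hT dx dy; have dTy := adjointable_dom (adj_adjointable hX hT) dy.
apply: adjointable_eq => [||z dz /=].
- by apply: (adjointable_comp hX) => //; exact: rank1_adjointable.
- exact: rank1_adjointable.
- by rewrite !rank1E ?(adj_ip' hX hT)//; exact: adjointable_dom hT dz.
Qed.

Lemma rank1_single m n a b : rank1 (single m a) (single n b) = munit m n (amul a (astar b)).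
Proof.
apply: op_eq => [||x k dx]; first by apply: rank1_adjointable; exact: single_dom.
  exact: munit_adjointable.
rewrite rank1E// munitE// ip_single// /l2_act /single.
by case: eqP => _; [rewrite amulA | exact: amul0l].
Qed.

Lemma rank1Dl x y z : dom x -> dom y -> dom z -> rank1 (x + y) z = rank1 x z + rank1 y z.
Proof.
move=> dx dy dz; have dxy := l2_domD dx dy.
apply: op_eq => [||w k dw]; first exact: rank1_adjointable.
  by apply: (adjointable_add hX); exact: rank1_adjointable.
rewrite -[RHS]/(rank1 x z w k + rank1 y z w k) !rank1E// /l2_act.
by rewrite -amulDl.
Qed.

Lemma rank1Dr x y z : dom x -> dom y -> dom z -> rank1 z (x + y) = rank1 z x + rank1 z y.
Proof.
move=> dx dy dz; have dxy := l2_domD dx dy.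
apply: op_eq => [||w k dw]; first exact: rank1_adjointable.
  by apply: (adjointable_add hX); exact: rank1_adjointable.
rewrite -[RHS]/(rank1 z x w k + rank1 z y w k) !rank1E// /l2_act.
by rewrite (hm_ipDl hX)// amulDr.
Qed.

Definition munits : set (X -> X) := [set T | exists m n a, T = munit m n a].

Lemma munits_adjointable : munits `<=` adjointable X.
Proof. by move=> _ [m [n [a ->]]]; exact: munit_adjointable. Qed.

Lemma rank1_munits x y : dom x -> dom y -> op_closed_span munits (rank1 x y).
Proof.
move=> dx dy; apply/ocs_spanP; split=> [|e e0]; first exact: rank1_adjointable.
pose K := inrm x + inrm y + 1; have x0 := inrm_ge0 x; have y0 := inrm_ge0 y.
have K0 : 0 < K by rewrite /K; lra.
(* The bound 1 keeps the truncation of [x] within norm [inrm x + 1]; the other one makes the two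
   error terms add up to at most [e / 2]. *)
have e1 : 0 < Num.min 1 (e / (2 * K)) by rewrite lt_min ltr01 divr_gt0// mulr_gt0.
have [N hN] := trunc_dense dx e1; have [N' hN'] := trunc_dense dy e1.
have dx' : dom (trunc N x) by exact: trunc_dom.
have dy' : dom (trunc N' y) by exact: trunc_dom.
exists (rank1 (trunc N x) (trunc N' y)).
  elim: N {hN dx'} => [|N IH].
    rewrite trunc0 (_ : rank1 _ _ = 0); first exact: lspan0.
    apply/funext => z; have [dz|dz] := pselect (dom z); last exact: restr_out.
    by rewrite rank1E//; apply/funext => k; exact: amul0l.
  rewrite truncS rank1Dl//; [|exact: trunc_dom|exact: single_dom].
  apply: lspanD => // {IH}; elim: N' {hN' dy'} => [|N' IH].
    rewrite trunc0 (_ : rank1 _ _ = 0); first exact: lspan0.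
    apply/funext => z; have [dz|dz] := pselect (dom z); last exact: restr_out.
    by rewrite rank1E// (ip0l hX)//; apply/funext => k; exact: amul0r.
  rewrite truncS rank1Dr//; [|exact: trunc_dom|exact: single_dom|exact: single_dom].
  by apply: lspanD => //; apply: lspan_gen; rewrite rank1_single; exists N, N', (amul (x N) (astar (y N'))).
move: hN hN'; rewrite !le_min => /andP[h1 h2] /andP[h3 h4].
have ddx : dom (x - trunc N x) by exact: (domB hX).
have ddy : dom (y - trunc N' y) by exact: (domB hX).
have -> : rank1 x y - rank1 (trunc N x) (trunc N' y) =
    rank1 (x - trunc N x) y + rank1 (trunc N x) (y - trunc N' y).
  have ex : rank1 x y = rank1 (x - trunc N x) y + rank1 (trunc N x) y.
    by rewrite -rank1Dl// subrK.
  have ey : rank1 (trunc N x) y =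
      rank1 (trunc N x) (y - trunc N' y) + rank1 (trunc N x) (trunc N' y).
    by rewrite -rank1Dr// subrK.
  by rewrite ex ey addrA addrK.
have hx' : inrm (trunc N x) <= inrm x + 1.
  have -> : trunc N x = x - (x - trunc N x) by rewrite subKr.
  by apply: le_trans (inrmB hX dx ddx) _; rewrite lerD2l.
move=> z dz; rewrite -[(_ + _) z]/(rank1 (x - trunc N x) y z + rank1 (trunc N x) (y - trunc N' y) z).
have r1 := bounded_rank1 ddx dy dz; have r2 := bounded_rank1 dx' ddy dz.
apply: le_trans (hm_tri hX _ _) _; [| |].
- exact: adjointable_dom (rank1_adjointable ddx dy) dz.
- exact: adjointable_dom (rank1_adjointable dx' ddy) dz.
apply: le_trans (lerD r1 r2) _; rewrite -mulrDl ler_wpM2r ?inrm_ge0//.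
have t0 := inrm_ge0 (trunc N x).
move: h2 h4; rewrite !ler_pdivlMr ?mulr_gt0// /K.
have := inrm_ge0 (x - trunc N x); have := inrm_ge0 (y - trunc N' y).
nra.
Qed.

(** Without a unit, [a] need not be a product of the required form; it is approximated by [a u], for
    which [e_mn(a u)] has rank one. *)
Lemma munit_compact m n a : l2_compacts A (munit m n a).
Proof.
apply/ocs_spanP; split=> [|e e0]; first exact: munit_adjointable.
have [u [us u1 /(_ (astar a))]] := approx_unit [:: astar a] e0.
rewrite mem_seq1 eqxx => /(_ isT) hu.
exists (munit m n (amul a u)).
  apply: lspan_gen; exists (single m a), (single n (astar u)).
  by split; [exact: single_dom|exact: single_dom|rewrite -[RHS]/(rank1 _ _) rank1_single astarK].
rewrite -munitB => x dx; apply: le_trans (bounded_munit _ _ _ dx) _.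
rewrite ler_wpM2r ?inrm_ge0// nrm_distC.
by rewrite -nrmS astarB astarM us.
Qed.

Lemma compacts_adjointable :
  [set T | exists x y : X, [/\ dom x, dom y & T = rank_one (@l2_act R A) x y]]
    `<=` adjointable X.
Proof. by move=> _ [x [y [dx dy ->]]]; exact: rank1_adjointable. Qed.

Lemma l2_compactsE : l2_compacts A = op_closed_span munits.
Proof.
apply/seteqP; split.
- apply: (ocs_sub_span hX munits_adjointable) => _ [x [y [dx dy ->]]].
  exact: rank1_munits.
- apply: (ocs_sub_span hX compacts_adjointable) => _ [m [n [a ->]]].
  exact: munit_compact.
Qed.

Lemma compacts_bounded T : l2_compacts A T -> adjointable X T /\
  exists2 M, 0 <= M & bounded_by T M.
Proof.
move=> hT; split; first by case: hT.
apply: (ocs_bounded hX compacts_adjointable _ hT) => _ [x [y [dx dy ->]]].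
exists (inrm x * inrm y); first by rewrite mulr_ge0 ?inrm_ge0.
exact: (bounded_rank1 dx dy).
Qed.

Lemma compacts_compl S T M : 0 <= M -> adjointable X S -> bounded_by S M ->
  l2_compacts A T -> l2_compacts A (S \o T).
Proof.
move=> M0 hS bS; apply: (ocs_compl hX compacts_adjointable M0 compacts_adjointable hS bS).
move=> _ [x [y [dx dy ->]]]; rewrite -/(rank1 x y) comp_rank1//.
apply: (ocs_gen hX compacts_adjointable); exists (S x), y.
by split=> //; exact: adjointable_dom hS dx.
Qed.

Lemma compacts_compr S T M : 0 <= M -> adjointable X S -> bounded_by S M ->
  l2_compacts A T -> l2_compacts A (T \o S).
Proof.
move=> M0 hS bS; apply: (ocs_compr hX compacts_adjointable M0 compacts_adjointable hS bS).
move=> _ [x [y [dx dy ->]]]; rewrite -/(rank1 x y) rank1_comp//.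
apply: (ocs_gen hX compacts_adjointable); exists x, (adj S y).
by split=> //; exact: adjointable_dom (adj_adjointable hX hS) dy.
Qed.

Lemma compacts_adj T : l2_compacts A T -> l2_compacts A (adj T).
Proof.
apply: (ocs_adj hX compacts_adjointable compacts_adjointable) => _ [x [y [dx dy ->]]].
rewrite -/(rank1 x y) (adjE hX (rank1_adjoint dx dy)).
by apply: (ocs_gen hX compacts_adjointable); exists y, x.
Qed.

End L2Operators.

(** * The corner of the compact operators *)

Section System.
Context {R : realType} {A : cstarType R} {alpha : A -> A}.
Context {abar : nat -> (selfmod A -> selfmod A) -> selfmod A -> selfmod A}.
Hypothesis halpha : star_hom (S := alg_ops A) (S' := alg_ops A) setT setT alpha.
Hypothesis habar : forall n, strict_extension (iter n alpha) (abar n).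
Local Open Scope complex_scope.
Local Notation X := (l2mod A).
Local Notation hX := (@hmodule_l2 R A).
Local Notation hM := (hmodule_selfmod A).
Implicit Types (a b c u : A) (x y : X) (T S : X -> X).

Lemma iter_hom n : star_hom (S := alg_ops A) (S' := alg_ops A) setT setT (iter n alpha).
Proof.
elim: n => [|n IH]; first by split.
split=> // [k x y|x y|x] _; rewrite !iterS.
- by move=> _; rewrite (homP IH) (homP halpha).
- by move=> _; rewrite /= (homM IH) (homM halpha).
- by rewrite /= (homS IH) (homS halpha).
Qed.

(** The projection that is the [n]-th diagonal entry of [p]. *)
Definition eta n : selfmod A -> selfmod A := abar n (idop (selfmod A)).

Lemma eta_multiplier n : multiplier A (eta n).
Proof. by have [[h _ _ _] _ _] := habar n; apply: h; exact: adjointable_id. Qed.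

Lemma eta_idem n : eta n \o eta n = eta n.
Proof.
have [[_ _ h _] _ _] := habar n.
have := h _ _ (@adjointable_id R (selfmod A)) (@adjointable_id R (selfmod A)).
by rewrite /= (comp_id_r hM)//; exact: adjointable_id.
Qed.

Lemma eta_adj n : adj (eta n) = eta n.
Proof.
have [[_ _ _ h] _ _] := habar n.
by have := h _ (@adjointable_id R (selfmod A)); rewrite /= (adj_id hM).
Qed.

Lemma etaK n b : eta n (eta n b) = eta n b.
Proof. by rewrite -[LHS]/((eta n \o eta n) b) eta_idem. Qed.

Lemma eta_contractive n : contractive (eta n).
Proof.
apply: piso_contractive; split; first exact: eta_multiplier.
by rewrite eta_adj !eta_idem.
Qed.

Lemma eta_alpha n c : eta n (iter n alpha c) = iter n alpha c.
Proof.
have [[_ _ h _] _ e] := habar n.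
apply: lmul_inj; rewrite lmul_mult; last exact: eta_multiplier.
rewrite -e -[LHS](h _ _ (@adjointable_id R (selfmod A)) (lmul_multiplier c)) /=.
by rewrite (comp_id_l hM)//; exact: lmul_multiplier.
Qed.

Lemma eta_alphal n c b : eta n (amul (iter n alpha c) b) = amul (iter n alpha c) b.
Proof. by rewrite multM ?eta_alpha//; exact: eta_multiplier. Qed.

(* Strict continuity at 1, evaluated on an approximate unit. *)
Lemma eta_approx n b (e : R) : 0 < e -> exists u,
  nrm (amul (iter n alpha u) b - eta n b) <= e /\ nrm (amul u b - b) <= e.
Proof.
move=> e0; have [_ sc ext] := habar n.
have e0' : 0 < e%:C :> R[i] by rewrite ltcR.
have [G [d [d0 hG]]] := sc _ (@adjointable_id R (selfmod A)) [:: b] _ e0'.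
have [r r0 dr] : exists2 r : R, 0 < r & d = r%:C.
  exists (complex.Re d); last by rewrite RRe_real// ger0_real// ltW.
  by move: d0; rewrite ltcE => /andP[].
have m0 : 0 < Num.min e (r / 2) by rewrite lt_min e0 divr_gt0.
have [u [us _ hu]] := approx_unit (b :: G) m0.
exists u; split; last first.
  by have := hu b (mem_head _ _); rewrite le_min => /andP[].
have hb : strict_ball (idop (selfmod A)) G d (lmul u).
  split=> [|g gG]; first exact: lmul_multiplier.
  rewrite lmul_adj us (adj_id hM) idopE// /lmul nrmE dr ltcR.
  have := hu g; rewrite inE gG orbT => /(_ isT); rewrite le_min => /andP[_ h].
  by split; lra.
have [_ /(_ b (mem_head _ _))[]] := hG _ hb.
by rewrite ext /lmul nrmE ltcR => /ltW.
Qed.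

(** [abar 0] is only known to extend the identity of [A]; that it fixes 1 follows from strict
    continuity through [eta_approx]. *)
Lemma eta0 b : eta 0 b = b.
Proof.
apply/eqP; rewrite -subr_eq0; apply/eqP/nrm_small => e e0.
have e2 : 0 < e / 2 by rewrite divr_gt0.
have [u [/= h1 h2]] := eta_approx 0 b e2.
by apply: le_trans (nrm_tri (amul u b) _ _) _; rewrite nrm_distC; lra.
Qed.

(** No relation between [abar n] and [abar n.+1] is given. But [eta n.+1 b] is a limit of elements
    alpha^(n+1)(u) b = alpha^n(alpha u) b, each of which [eta n] fixes. *)
Lemma eta_succ n b : eta n (eta n.+1 b) = eta n.+1 b.
Proof.
apply/eqP; rewrite -subr_eq0; apply/eqP/nrm_small => e e0.
have e2 : 0 < e / 2 by rewrite divr_gt0.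
have [u [h _]] := eta_approx n.+1 b e2; set w := amul _ b in h.
have hw : eta n w = w by rewrite /w iterSr eta_alphal.
have h' : nrm (eta n (eta n.+1 b) - w) <= e / 2.
  rewrite -{1}hw -(multB _ _ (eta_multiplier n)).
  by apply: le_trans (contractive_nrm _ (eta_contractive n)) _; rewrite nrm_distC.
by apply: le_trans (nrm_tri w _ _) _; lra.
Qed.

Lemma eta_kill n b : (forall u, amul (iter n alpha u) b = 0) -> eta n b = 0.
Proof.
move=> h; apply: nrm_small => e e0; have [u [+ _]] := eta_approx n b e0.
by rewrite h sub0r nrmN.
Qed.

Lemma pi_alphaE a x : dom x -> pi_alpha alpha a x = (fun n => amul (iter n alpha a) (x n)).
Proof. exact: restrE. Qed.

Lemma pi_alpha_adjoint a : is_adjoint (pi_alpha alpha a) (pi_alpha alpha (astar a)).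
Proof.
have bd (c : A) k b : posA ((nrm c * nrm c)%:C *: amul (astar b) b -
    amul (astar (amul (iter k alpha c) b)) (amul (iter k alpha c) b)).
  by apply: posA_mul_le; exact: (hom_contractive (iter_hom k)).
apply: (@diag_adjoint _ _ (fun k => amul (iter k alpha a))
  (fun k => amul (iter k alpha (astar a))) (nrm a)); first exact: nrm_ge0.
- by move=> k b c; rewrite astarM (homS (iter_hom k)) amulA.
- exact: bd.
- by move=> k b; rewrite -{1 2}(nrmS a); exact: bd.
Qed.

Lemma pi_alpha_adjointable a : adjointable X (pi_alpha alpha a).
Proof. by eexists; exact: pi_alpha_adjoint. Qed.

Definition eta_op : X -> X := pi_alpha_bar abar (idop (selfmod A)).
Local Notation p := eta_op.

Lemma eta_opE x : dom x -> p x = (fun n => eta n (x n)).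
Proof. exact: restrE. Qed.

Lemma eta_contr1 k b : posA ((1 * 1)%:C *: amul (astar b) b - amul (astar (eta k b)) (eta k b)).
Proof. by rewrite mulr1 scale1r; exact: eta_contractive. Qed.

Lemma eta_op_adjoint : is_adjoint p p.
Proof.
apply: (@diag_adjoint _ _ eta eta 1 ler01 _ eta_contr1 eta_contr1) => k a b.
by rewrite -[in RHS]eta_adj mult_ip//; exact: eta_multiplier.
Qed.

Lemma eta_op_adjointable : adjointable X p.
Proof. by eexists; exact: eta_op_adjoint. Qed.

Lemma bounded_eta_op : bounded_by p 1.
Proof. exact: (bounded_by_diag ler01 eta_contr1). Qed.

Lemma eta_op_projection : Defs.projection p.
Proof.
split; [exact: eta_op_adjointable| |exact: (adjE hX eta_op_adjoint)].
apply: op_eq => [||x k dx /=]; [|exact: eta_op_adjointable|].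
  by apply: (adjointable_comp hX); exact: eta_op_adjointable.
have dpx := adjointable_dom eta_op_adjointable dx.
by rewrite eta_opE// eta_opE// etaK.
Qed.

Lemma eta_opK : p \o p = p. Proof. by case: eta_op_projection. Qed.

Lemma eta_opKE x : p (p x) = p x. Proof. by rewrite -[LHS]/((p \o p) x) eta_opK. Qed.

Lemma eta_op_single0 c : p (single 0 c) = single 0 c.
Proof.
rewrite eta_opE; last exact: single_dom; apply/funext => k; rewrite /single.
by case: eqP => [->|_]; [exact: eta0 | exact: mult0 (eta_multiplier k)].
Qed.

Lemma eta_op_kill y : dom y -> (forall u, pi_alpha alpha u y = 0) -> p y = 0.
Proof.
move=> dy h; rewrite eta_opE//; apply/funext => n; apply: eta_kill => u.
by have := congr1 (fun z : X => z n) (h u); rewrite pi_alphaE.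
Qed.

(** In each coordinate [p] is a limit of [pi_alpha alpha u] along approximate units, so a vector
    killed by all [pi_alpha alpha u] is killed by [p]. *)
Lemma cancel_pi_alpha T S : adjointable X T -> adjointable X S ->
  (forall u, pi_alpha alpha u \o T = pi_alpha alpha u \o S) -> p \o T = p \o S.
Proof.
move=> hT hS h; have hp := eta_op_adjointable.
apply: adjointable_eq => [||x dx /=]; try exact: (adjointable_comp hX).
have dT := adjointable_dom hT dx; have dS := adjointable_dom hS dx.
apply/eqP; rewrite -subr_eq0 -(adjointableB hX hp dT dS); apply/eqP.
apply: eta_op_kill => [|u]; first exact: (domB hX).
rewrite (adjointableB hX (pi_alpha_adjointable u) dT dS).
by rewrite -[X in X - _]/((pi_alpha alpha u \o T) x) h subrr.
Qed.

Lemma shiftn_single m c : shiftn A m (single 0 c) = single m c.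
Proof.
apply/funext => k; rewrite shiftn_coord /single; last exact: single_dom.
have [km|mk] := ltnP k m; first by rewrite ltn_eqF.
by rewrite subn_eq0 eqn_leq mk andbT.
Qed.

(** The factor [1 - S S^*] projects onto index 0, where [pi_alpha alpha a] is multiplication by [a]
    itself; the shifts then move this entry to position [(m, n)]. *)
Lemma corner_monomial m a n : p \o shiftn A m \o pi_alpha alpha a
    \o (idop X - (shiftn A 1 \o adj (shiftn A 1))) \o adj (shiftn A n) \o p =
  p \o munit m n a \o p.
Proof.
have hp := eta_op_adjointable.
have hS k := shiftn_adjointable (A := A) k; have hS' k := adj_shiftn_adjointable (A := A) k.
suff -> : p \o shiftn A m \o pi_alpha alpha a
    \o (idop X - (shiftn A 1 \o adj (shiftn A 1))) \o adj (shiftn A n) = p \o munit m n a by [].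
have hQ : adjointable X (idop X - (shiftn A 1 \o adj (shiftn A 1))).
  by apply: (adjointable_sub hX); [exact: adjointable_id | exact: (adjointable_comp hX)].
have ha := pi_alpha_adjointable a.
apply: adjointable_eq => [||x dx /=].
- by do 4!(apply: (adjointable_comp hX) => //).
- by apply: (adjointable_comp hX) => //; exact: munit_adjointable.
have dy := adjointable_dom (hS' n) dx; set y := adj (shiftn A n) x in dy *.
congr (p _); rewrite munitE// -shiftn_single; congr (shiftn A m _).
have dz := adjointable_dom (hS' 1%N) dy.
have dw := adjointable_dom (hS 1%N) dz.
have -> : (idop X - (shiftn A 1 \o adj (shiftn A 1))) y = y - shiftn A 1 (adj (shiftn A 1) y).
  rewrite -[LHS]/(idop X y - shiftn A 1 (adj (shiftn A 1) y)).
  by rewrite idopE.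
rewrite pi_alphaE; last exact: (domB hX).
apply/funext => k; rewrite -[(_ - _) k]/(y k - shiftn A 1 (adj (shiftn A 1) y) k).
rewrite shiftn_coord// /single; case: k => [|k] /=.
  by rewrite subr0 /y adj_shiftn_coord// addn0.
by rewrite adj_shiftn_coord// add1n subSS subn0 subrr amul0r.
Qed.

(** The concrete form of [1 - v^*v] on the range of [p]. At a positive index the inner [p]
    contributes [eta k] in front of an element fixed by [eta k.+1], and [eta_succ] absorbs it; so
    the terms cancel everywhere except at index 0. *)
Lemma corner_defect z a : dom z -> p z = z ->
  pi_alpha alpha a (z - (p \o shiftn A 1 \o p) ((p \o adj (shiftn A 1) \o p) z)) =
  single 0 (amul a (z 0%N)).
Proof.
move=> dz pz /=; have hp := eta_op_adjointable.
have d1 := adjointable_dom (adj_shiftn_adjointable 1) dz.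
have d2 := adjointable_dom hp d1; have d3 := adjointable_dom (shiftn_adjointable 1) d2.
rewrite pz eta_opKE pi_alphaE; last by apply: (domB hX) => //; exact: adjointable_dom hp d3.
apply/funext => k; set w := shiftn A 1 _ in d3 *.
rewrite -[(z - p w) k]/(z k - p w k) (eta_opE d3) /w shiftn_coord// /single.
case: k => [|k] /=; first by rewrite (mult0 (eta_multiplier 0)) subr0.
rewrite subSS subn0 eta_opE// adj_shiftn_coord// add1n.
have -> : z k.+1 = eta k.+1 (z k.+1) by rewrite -{1}pz eta_opE.
by rewrite eta_succ etaK subrr amul0r.
Qed.

(** Both monomials have the entry alpha^j(a) at position [(m + j, n + j)], the first for all [j],
    the second only for [j >= 1]. This is why the compact operators lie in the Toeplitz algebra. *)
Lemma munit_toeplitz m n a : munit m n a =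
  (shiftn A m \o pi_alpha alpha a \o adj (shiftn A n)) -
  (shiftn A m.+1 \o pi_alpha alpha (alpha a) \o adj (shiftn A n.+1)).
Proof.
have hS k := shiftn_adjointable (A := A) k; have hS' k := adj_shiftn_adjointable (A := A) k.
have hs i b j : adjointable X (shiftn A i \o pi_alpha alpha b \o adj (shiftn A j)).
  by do 2!(apply: (adjointable_comp hX) => //); exact: pi_alpha_adjointable.
apply: op_eq => [||x k dx]; [exact: munit_adjointable|exact: (adjointable_sub hX)|].
rewrite op_subE -[RHS]/((shiftn A m \o pi_alpha alpha a \o adj (shiftn A n)) x k -
  (shiftn A m.+1 \o pi_alpha alpha (alpha a) \o adj (shiftn A n.+1)) x k).
have co i b j : (shiftn A i \o pi_alpha alpha b \o adj (shiftn A j)) x k =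
    if (k < i)%N then 0 else amul (iter (k - i) alpha b) (x (j + (k - i))%N).
  have d1 := adjointable_dom (hS' j) dx.
  have d2 := adjointable_dom (pi_alpha_adjointable b) d1.
  rewrite /= shiftn_coord// pi_alphaE//; case: ltnP => // _.
  by rewrite adj_shiftn_coord.
rewrite !co munitE// /single ltnS; case: (ltngtP k m) => km.
- by rewrite subr0.
- by rewrite -iterSr addSn -addnS subnSK// subrr.
- by rewrite km subnn addn0 subr0.
Qed.

Lemma monomials_adjointable :
  [set T | exists m a n, T = shiftn A m \o pi_alpha alpha a \o adj (shiftn A n)]
    `<=` adjointable X.
Proof.
move=> _ [m [a [n ->]]]; apply: (adjointable_comp hX); last exact: adj_shiftn_adjointable.
by apply: (adjointable_comp hX); [exact: shiftn_adjointable | exact: pi_alpha_adjointable].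
Qed.

Lemma compacts_sub_toeplitz : l2_compacts A `<=` toeplitz alpha.
Proof.
rewrite l2_compactsE; apply: (ocs_sub_span hX monomials_adjointable) => _ [m [n [a ->]]].
rewrite munit_toeplitz addrC -scaleN1r; apply: (ocs_lin hX monomials_adjointable).
  by apply: (ocs_gen hX monomials_adjointable); exists m.+1, (alpha a), n.+1.
by apply: (ocs_gen hX monomials_adjointable); exists m, a, n.
Qed.

Local Notation K := (l2_compacts A).

Lemma compacts_eta T : K T -> K (p \o T) /\ K (T \o p).
Proof.
move=> hT; have hp := eta_op_adjointable; have bp := bounded_eta_op.
by split; [exact: compacts_compl ler01 hp bp hT | exact: compacts_compr ler01 hp bp hT].
Qed.

Lemma compacts_comp T S : K T -> K S -> K (T \o S).
Proof.
move=> /compacts_bounded[hT [M M0 bT]]; exact: compacts_compl M0 hT bT.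
Qed.

Lemma cornerP T : corner p K T <-> K T /\ p \o T \o p = T.
Proof.
split=> [[S hS <-]|[hT e]]; last by exists T.
have [/compacts_eta[_ h1] _] := compacts_eta hS.
split=> //; rewrite -[RHS]/(p \o S \o p).
by apply/funext => x; rewrite /= !eta_opKE.
Qed.

Definition corner_munits : set (X -> X) := [set T | exists m n a, T = p \o munit m n a \o p].

Lemma corner_munit_adjointable m n a : adjointable X (p \o munit m n a \o p).
Proof.
have hp := eta_op_adjointable; have hm := munit_adjointable m n a.
exact: (adjointable_comp hX (adjointable_comp hX hp hm) hp).
Qed.

Lemma corner_munits_adjointable : corner_munits `<=` adjointable X.
Proof. by move=> _ [m [n [a ->]]]; exact: corner_munit_adjointable. Qed.

Lemma corner_span T : corner p K T -> op_closed_span corner_munits T.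
Proof.
have hp := eta_op_adjointable; have bp := bounded_eta_op.
move=> [S hS <-]; rewrite l2_compactsE in hS.
pose G := [set T | exists m n a, T = p \o munit m n a].
have hG : G `<=` adjointable X.
  by move=> _ [m [n [a ->]]]; apply: (adjointable_comp hX) => //; exact: munit_adjointable.
have h1 : op_closed_span G (p \o S).
  apply: (ocs_compl hX hG ler01 munits_adjointable hp bp) hS => _ [m [n [a ->]]].
  by apply: (ocs_gen hX hG); exists m, n, a.
apply: (ocs_compr hX corner_munits_adjointable ler01 hG hp bp) h1 => _ [m [n [a ->]]].
by apply: (ocs_gen hX corner_munits_adjointable); exists m, n, a.
Qed.

Lemma compacts_sub_adjointable : K `<=` adjointable X.
Proof. by move=> T []. Qed.

Lemma corner0 : corner p K 0.
Proof.
apply/cornerP; split; first exact: (ocs0 hX compacts_adjointable).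
by apply/funext => z /=; rewrite (adjointable0r hX eta_op_adjointable).
Qed.

Lemma corner_lin (k : R[i]) T S : corner p K T -> corner p K S -> corner p K (k *: T + S).
Proof.
have hp := eta_op_adjointable.
move=> /cornerP[k1 e1] /cornerP[k2 e2]; apply/cornerP; split.
  exact: (ocs_lin hX compacts_adjointable).
have a1 := compacts_sub_adjointable k1; have a2 := compacts_sub_adjointable k2.
have a := adjointable_linop hX k a1 a2.
apply: adjointable_eq => [||z dz /=] //.
  exact: (adjointable_comp hX (adjointable_comp hX hp a) hp).
have dpz := adjointable_dom hp dz.
rewrite -[RHS]/(k *: T z + S z) -[(k *: T + S) (p z)]/(k *: T (p z) + S (p z)).
rewrite (adjointable_lin hX k hp (adjointable_dom a1 dpz) (adjointable_dom a2 dpz)).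
by rewrite -{2}e1 -{2}e2.
Qed.

(** Compression by [p] is continuous and fixes the span, so it fixes the limits, which remain in
    [K]. *)
Lemma corner_closed : op_closed_span (corner p K) `<=` corner p K.
Proof.
have hp := eta_op_adjointable; have bp := bounded_eta_op.
have cK : corner p K `<=` K by move=> T /cornerP[].
have ca : corner p K `<=` adjointable X by move=> T /cK; exact: compacts_sub_adjointable.
move=> T hT; have kT : K T.
  by apply: (ocs_sub_span hX compacts_adjointable _ hT).
apply/cornerP; split=> //; have aT := compacts_sub_adjointable kT.
apply: adjointable_eq => // [|x dx /=].
  exact: (adjointable_comp hX (adjointable_comp hX hp aT) hp).
have dpx := adjointable_dom hp dx; have dTpx := adjointable_dom aT dpx.
have dT := adjointable_dom aT dx; have dpTpx := adjointable_dom hp dTpx.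
apply/eqP; rewrite -subr_eq0; apply/eqP/(inrm_small hX); first exact: (domB hX).
move=> e e0; pose L := 2 * (inrm x + 1).
have x0 := inrm_ge0 x; have L0 : 0 < L by rewrite /L; lra.
have [_ /(_ (e / L))[|T0 sT0 bT0]] := (ocs_spanP _ _).1 hT; first by rewrite divr_gt0.
have [aT0 cT0] : adjointable X T0 /\ p \o T0 \o p = T0.
  have /cornerP[/compacts_sub_adjointable] // : corner p K T0.
  move: T0 sT0 {bT0}; apply: lspan_sub => //; first exact: corner0.
  exact: corner_lin.
have d0 := adjointable_dom aT0 dx; have d1 := adjointable_dom aT0 dpx.
have -> : p (T (p x)) - T x = p ((T - T0) (p x)) - (T - T0) x.
  rewrite !op_subE (adjointableB hX hp dTpx d1) opprB addrA; congr (_ - _).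
  by rewrite -[p (T0 (p x))]/((p \o T0 \o p) x) cT0 subrK.
have aD : adjointable X (T - T0) by exact: (adjointable_sub hX).
have dD := adjointable_dom aD dx; have dDp := adjointable_dom aD dpx.
apply: le_trans (inrmB hX (adjointable_dom hp dDp) dD) _.
have := bp _ dDp; have := bT0 _ dpx; have := bT0 _ dx; have := bp _ dx.
rewrite !mul1r => h1 h2 h3 h4.
have h5 : e / L * inrm (p x) <= e / L * inrm x by rewrite ler_wpM2l// ltW// divr_gt0.
have h6 : e / L * L = e by rewrite divfK// gt_eqF.
have h7 : 0 < e / L by rewrite divr_gt0.
move: h6; rewrite {2}/L; nra.
Qed.

Lemma corner_comp T S : corner p K T -> corner p K S -> corner p K (T \o S).
Proof.
move=> /cornerP[kT eT] /cornerP[kS eS]; apply/cornerP; split; first exact: compacts_comp.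
by rewrite -{2}eT -{2}eS; apply/funext => x /=; rewrite -{1}eT -{1}eS /= !eta_opKE.
Qed.

Lemma corner_adj T : corner p K T -> corner p K (adj T).
Proof.
move=> /cornerP[kT eT]; apply/cornerP; split; first exact: compacts_adj.
have hp := eta_op_adjointable; have hT := compacts_sub_adjointable kT.
have [_ _ sp] := eta_op_projection.
have hTp : adjointable X (p \o T) by exact: (adjointable_comp hX).
by rewrite -{2}eT (adj_comp hX hTp hp) (adj_comp hX hp hT) sp.
Qed.

Lemma corner_cstar : cstar_subalgebra (corner p K).
Proof.
split; [|exact: corner_closed|exact: corner_comp|exact: corner_adj].
by move=> T /cornerP[/compacts_sub_adjointable].
Qed.

(* [e_mn(bc) = e_m0(b) p e_0n(c)] since [p] is the identity at index 0. *)
Lemma full_corner_compacts : full_corner p K.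
Proof.
split; [exact: eta_op_projection|exact: compacts_eta|].
have hp := eta_op_adjointable.
set G := (G in op_closed_span G).
have GK : G `<=` K.
  move=> _ [T1 [T2 [k1 k2 ->]]]; apply: compacts_comp k2.
  by have [] := compacts_eta k1.
have hG : G `<=` adjointable X by move=> T /GK; exact: compacts_sub_adjointable.
apply/seteqP; split; first exact: (ocs_sub_span hX compacts_adjointable).
rewrite l2_compactsE; apply: (ocs_sub_span hX hG) => _ [m [n [a ->]]].
apply/ocs_spanP; split=> [|e e0]; first exact: munit_adjointable.
have [u [us u1 /(_ a)]] := approx_unit [:: a] e0.
rewrite mem_seq1 eqxx => /(_ isT) hu.
exists (munit m n (amul u a)).
  apply: lspan_gen; exists (munit m 0 u), (munit 0 n a).
  split; [exact: munit_compact|exact: munit_compact|].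
  have h0 := munit_adjointable 0 n a; have h1 := munit_adjointable m 0 u.
  apply: adjointable_eq => [||x dx /=]; first exact: munit_adjointable.
    exact: (adjointable_comp hX (adjointable_comp hX h1 hp) h0).
  rewrite (munitE 0 n a dx) eta_op_single0 !munitE//; last exact: single_dom.
  by rewrite /single eqxx amulA.
rewrite -munitB => x dx; apply: le_trans (bounded_munit _ _ _ dx) _.
by rewrite ler_wpM2r ?inrm_ge0// nrm_distC.
Qed.

End System.

(** * The kernel of the quotient map *)

Section KernelOfQuotient.
Context {R : realType} {A : cstarType R} {alpha : A -> A}.
Context {B : cstarType R} {iA : A -> B} {v : nat -> selfmod B -> selfmod B}.
Context {D : cstarType R} {jA : A -> D} {T : nat -> selfmod D -> selfmod D}.
Context {phi : B -> D}.
Local Open Scope complex_scope.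

Hypothesis hphi : star_hom (S := alg_ops B) (S' := alg_ops D) setT setT phi.
Hypothesis hcov : covariant_piso alpha (X := selfmod B) (fun a => lmul (iA a)) v.
Hypothesis hiso : iso_crossed_product alpha jA T.
Hypothesis hphi_gen : forall m a n,
  phi (monomial iA v m a n) = monomial jA T m a n.

Lemma covariant_iso_piso (X : ipspace R) (hX : hmodule X) (pi : A -> X -> X)
    (V : nat -> X -> X) :
  covariant_iso alpha pi V -> covariant_piso alpha pi V.
Proof.
move=> [hpi hV hD hc]; have ra a := rep_adjointable hpi.1 a.
split=> // n; have [aV iV] := hV n.
  split=> //; rewrite -[LHS]/(V n \o (adj (V n) \o V n)) iV.
  exact: (comp_id_r hX).
move=> a; rewrite iV -[RHS]/(pi a \o (adj (V n) \o V n)) iV.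
by rewrite (comp_id_l hX)// (comp_id_r hX).
Qed.

(** Covariance and the commutation of [v^*v] with [iA a] give [v^* i(alpha a) v = v^*v i(a) v^*v =
    i(a) v^*v]. *)
Lemma defect_monomialE m a n : defect_monomial iA v m a n =
  monomial iA v m a n - monomial iA v m.+1 (alpha a) n.+1.
Proof.
have [_ _ _ hc _] := hcov; have mV := multV hcov; have mV' := multV' hcov.
apply: lmul_inj; rewrite (lmul_defect_monomial hcov).
apply/funext => b.
rewrite -[RHS]/(amul (_ - _) b) amulBl.
rewrite -[amul (monomial iA v m a n) b]/(lmul (monomial iA v m a n) b).
rewrite -[amul (monomial iA v m.+1 _ _) b]/(lmul (monomial iA v m.+1 (alpha a) n.+1) b).
rewrite !(lmul_monomial hcov) (adjVS' hcov) (hc 1%N a) /=.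
rewrite -(VD hcov 1 n) /= defectE /lmul amulBr (multB _ _ (mV' m)); congr (_ - adj (v m) _).
set c := v n b.
have := congr1 (fun S => S (adj (v 1%N) (v 1%N c))) (Vcomm hcov 1 a) => /= ->.
have [_ e] := pisoV hcov 1.
by rewrite -[v 1%N (adj (v 1%N) (v 1%N c))]/((v 1%N \o adj (v 1%N) \o v 1%N) c) e.
Qed.

Lemma phi_defect m a n : phi (defect_monomial iA v m a n) = 0.
Proof.
rewrite defect_monomialE (homB hphi) !hphi_gen.
have [_ hc _ _] := hiso; have hM := hmodule_selfmod D.
have hp := covariant_iso_piso hM hc; have [_ hV _ hcv] := hc.
apply/eqP; rewrite subr_eq0; apply/eqP; apply: lmul_inj.
rewrite !(lmul_monomial hp) (adjVS' hp) (hcv 1%N a) -(VD hp 1 n).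
have [a1 e1] := hV 1%N.
apply/funext => d /=.
have i1 c : adj (T 1%N) (T 1%N c) = c by rewrite -[LHS]/((adj (T 1%N) \o T 1%N) c) e1 idopE.
by rewrite !i1.
Qed.

Lemma ker_closed_ideal_sub : closure (ker phi) `<=` ker phi.
Proof.
move=> b /closure_nrm hb; apply: nrm_small => e /hb[c pc hc].
rewrite -[phi b]subr0 -[X in _ - X]pc -(homB hphi).
by apply: le_trans (hom_contractive hphi _) hc.
Qed.

Lemma defects_sub_ker :
  closed_span [set b | exists m a n, b = defect_monomial iA v m a n] `<=` ker phi.
Proof.
move=> b hb; apply: ker_closed_ideal_sub; move: b hb; apply: closure_subset.
apply: lspan_sub => [|k x y px py|_ [m [a [n ->]]]].
- exact: (hom0 hphi).
- by rewrite /ker /= (homP hphi) px py scaler0 addr0.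
- exact: phi_defect.
Qed.

Lemma phi_surjective : phi @` setT = setT.
Proof.
apply/seteqP; split=> // d _; have [_ _ _ hs] := hiso.
apply: (hom_image_closed hphi); have : closed_span
  [set b | exists m a n, b = monomial jA T m a n] d by rewrite hs.
apply: closure_subset; apply: lspan_sub => [|k x y [b _ <-] [c _ <-]|_ [m [a [n ->]]]].
- by exists 0 => //; exact: (hom0 hphi).
- by exists (k *: b + c) => //; rewrite (homP hphi).
- by exists (monomial iA v m a n).
Qed.

End KernelOfQuotient.

(** * The isomorphism onto the corner of the Toeplitz algebra *)

Section Toeplitz.
Context {R : realType} {A : cstarType R} {alpha : A -> A}.
Context {abar : nat -> (selfmod A -> selfmod A) -> selfmod A -> selfmod A}.
Context {B : cstarType R} {iA : A -> B} {v : nat -> selfmod B -> selfmod B}.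
Context {psi : B -> l2mod A -> l2mod A}.
Local Open Scope complex_scope.
Local Notation X := (l2mod A).
Local Notation hX := (@hmodule_l2 R A).
Local Notation p := (@eta_op R A abar).
Local Notation K := (l2_compacts A).

Hypothesis halpha : star_hom (S := alg_ops A) (S' := alg_ops A) setT setT alpha.
Hypothesis habar : forall n, strict_extension (iter n alpha) (abar n).
Hypothesis hcov : covariant_piso alpha (X := selfmod B) (fun a => lmul (iA a)) v.
Hypothesis hpsi : star_iso (S := alg_ops B) (S' := op_ops X)
  setT (corner p (toeplitz alpha)) psi.
Hypothesis hiA : star_hom (S := alg_ops A) (S' := alg_ops B) setT setT iA.
Hypothesis hpsi_iA : forall a, psi (iA a) = pi_alpha alpha a.
Hypothesis hpsi_v : forall n, extension_at psi (v n) (p \o adj (shiftn A n) \o p).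

Let hp := eta_op_adjointable habar.
Let pK := eta_opKE habar.

Lemma toeplitz_corner_adjointable : corner p (toeplitz alpha) `<=` adjointable X.
Proof.
by move=> _ [S [aS _] <-]; exact: (adjointable_comp hX (adjointable_comp hX hp aS) hp).
Qed.

Lemma psi_rep : representation psi.
Proof.
have [[h1 h2 h3 h4] _ _] := hpsi; split=> // b _.
exact/toeplitz_corner_adjointable/h1.
Qed.

Lemma psi_inj : injective psi.
Proof. by have [_ h _] := hpsi; move=> b c; apply: h; rewrite inE. Qed.

Let ra := rep_adjointable psi_rep.

Lemma psi_corner b : p \o psi b \o p = psi b.
Proof.
have [[/(_ b I)[S _ <-] _ _ _] _ _] := hpsi.
by apply/funext => x /=; rewrite !pK.
Qed.

Lemma psi_etal b x : p (psi b x) = psi b x.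
Proof. by rewrite -psi_corner /= pK. Qed.

Lemma psi_etar b x : psi b (p x) = psi b x.
Proof. by rewrite -psi_corner /= pK. Qed.

Lemma psi_v n b x : psi (v n b) x = p (adj (shiftn A n) (psi b x)).
Proof. by have [_ ->] := hpsi_v n; rewrite /= psi_etal. Qed.

(** The hypothesis gives the extension of [psi] at [v n] only. After multiplication by [iA u] on the
    left, the adjoint can be moved onto [v n (astar (iA u))], where that hypothesis applies;
    [cancel_pi_alpha] removes the factor again. *)
Lemma psi_adjv n b x : dom x -> psi (adj (v n) b) x = p (shiftn A n (psi b x)).
Proof.
move=> dx; have hS := shiftn_adjointable (A := A) n.
have [hV _] := hpsi_v n; have hS' := adj_shiftn_adjointable (A := A) n.
have ap : adj p = p by exact: (adjE hX (eta_op_adjoint habar)).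
have adjV : adj (p \o adj (shiftn A n) \o p) = p \o shiftn A n \o p.
  have h : adjointable X (p \o adj (shiftn A n)) by exact: (adjointable_comp hX).
  by rewrite (adj_comp hX h hp) (adj_comp hX hp hS') ap (adjK hX hS).
have aR : adjointable X (p \o shiftn A n \o p \o psi b).
  exact: (adjointable_comp hX (adjointable_comp hX (adjointable_comp hX hp hS) hp) (ra b)).
suff e : p \o psi (adj (v n) b) = p \o (p \o shiftn A n \o p \o psi b).
  by have := congr1 (fun S => S x) e; rewrite /= !psi_etal pK.
apply: (cancel_pi_alpha halpha habar) => // u.
rewrite -hpsi_iA -(repM psi_rep).
have -> : amul (iA u) (adj (v n) b) = amul (astar (v n (astar (iA u)))) b.
  by rewrite (mult_ip _ _ (multV hcov n)) astarK.
rewrite (repM psi_rep) (repS psi_rep); have [_ ->] := hpsi_v n.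
rewrite (adj_comp hX hV (ra _)) adjV -(repS psi_rep) astarK.
by [].
Qed.

Lemma psi_defect_monomial m a n :
  psi (defect_monomial iA v m a n) = p \o munit m n a \o p.
Proof.
set d := defect_monomial iA v m a n.
have aE := munit_adjointable m n a.
have aR : adjointable X (p \o munit m n a \o p).
  exact: (adjointable_comp hX (adjointable_comp hX hp aE) hp).
(* On vectors [psi b x] the operator can be computed, since [d b] is obtained by applying
   multipliers to [b] one after the other. *)
have key b x : dom x -> psi d (psi b x) = p (munit m n a (p (psi b x))).
  move=> dx; rewrite psi_etal.
  rewrite -[LHS]/((psi d \o psi b) x) -(repM psi_rep).
  rewrite -[amul d b]/(lmul d b) (lmul_defect_monomial hcov) /= psi_adjv//.
  set y := psi b x; have dy : dom y by exact: (rep_dom psi_rep).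
  set z := p (adj (shiftn A n) y).
  have dS := adjointable_dom (adj_shiftn_adjointable n) dy.
  have dz : dom z by exact: (adjointable_dom hp dS).
  have e : psi (amul (iA a) (defect (v := v) (v n b))) x = single 0 (amul a (z 0%N)).
    transitivity (pi_alpha alpha a (psi (defect (v := v) (v n b)) x)).
      by rewrite (repM psi_rep) hpsi_iA.
    rewrite -(corner_defect habar a dz); last exact: pK.
    congr (pi_alpha alpha a _).
    transitivity (psi (v n b) x - psi (adj (v 1%N) (v 1%N (v n b))) x).
      by rewrite defectE (repB psi_rep).
    by rewrite psi_adjv// !psi_v /z /= !pK.
  rewrite /lmul e shiftn_single munitE//.
  congr (p _); congr single; rewrite /z (eta_opE dS) (eta0 habar).
  by rewrite adj_shiftn_coord// addn0.
have ad : adjointable X (psi d) by exact: ra.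
have [_ _ ap] := eta_op_projection habar.
(* For [b = iA u] the computation above determines [psi d \o pi_alpha alpha u]. Taking adjoints puts
   this factor on the left, where [cancel_pi_alpha] can remove it. *)
suff e : adj (psi d) = adj (p \o munit m n a \o p).
  by rewrite -(adjK hX ad) e (adjK hX aR).
have pe : p \o adj (psi d) = p \o adj (p \o munit m n a \o p).
  apply: (cancel_pi_alpha halpha habar) => [||u]; [exact: (adj_adjointable hX)..|].
  rewrite -[u]astarK; set w := astar u.
  rewrite -hpsi_iA (homS hiA) (repS psi_rep) -!(adj_comp hX)//.
  congr adj; apply: adjointable_eq => [||x dx /=]; [exact: (adjointable_comp hX)..|].
  exact: key.
have e1 S : adjointable X S -> S \o p = S -> p \o adj S = adj S.
  by move=> aS eS; rewrite -{1}ap -(adj_comp hX)// eS.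
rewrite -[LHS]e1// ?pe ?e1//.
  by apply/funext => x /=; rewrite pK.
by apply/funext => x /=; rewrite psi_etar.
Qed.

Definition compact_part : set B := [set b | corner p K (psi b)].

Lemma compact_part_spanE :
  closed_span [set b | exists m a n, b = defect_monomial iA v m a n] = compact_part.
Proof.
apply/seteqP; split=> b.
  move=> /closure_nrm hb; apply: (corner_closed habar); apply/ocs_spanP.
  split=> [|e /hb[c sc hc]]; first exact: ra.
  exists (psi c).
    move: c sc {hc}; apply: lspan_ind => [|k x y [m [a [n ->]]] hy].
      by rewrite (rep0 psi_rep); exact: lspan0.
    rewrite (rep_lin psi_rep); apply: lspanD => //; apply/lspanZ/lspan_gen.
    rewrite psi_defect_monomial; exists (munit m n a) => //; exact: munit_compact.
  rewrite -(repB psi_rep) => x dx.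
  apply: le_trans (rep_contractive hX psi_rep _ dx) _.
  by rewrite ler_wpM2r ?inrm_ge0.
move=> /(corner_span habar)/ocs_spanP[_ h]; apply/closure_nrm => e e0.
have [S sS bS] := h e e0.
have [c sc ec] : exists2 c, linear_span
    [set b | exists m a n, b = defect_monomial iA v m a n] c & psi c = S.
  move: S sS {bS}; apply: lspan_ind.
    by exists 0; [exact: lspan0 | exact: (rep0 psi_rep)].
  move=> k _ _ [m [n [a ->]]] [c sc <-].
  exists (k *: defect_monomial iA v m a n + c).
    by apply: lspanD => //; apply/lspanZ/lspan_gen; exists m, a, n.
  by rewrite (rep_lin psi_rep) psi_defect_monomial.
exists c => //; apply: (rep_isometric hX psi_rep psi_inj (ltW e0)).
by rewrite (repB psi_rep) ec.
Qed.

Lemma compact_part_ideal : closed_ideal compact_part.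
Proof.
have bd b : exists2 M : R, 0 <= M & bounded_by (psi b) M.
  by exists (nrm b); [exact: nrm_ge0 | exact: (rep_contractive hX psi_rep)].
split; rewrite /compact_part /=.
- by rewrite (rep0 psi_rep); exact: (corner0 habar).
- move=> x y hx hy; rewrite (repD psi_rep) -[psi x]scale1r.
  exact: (corner_lin habar).
- move=> k x hx; rewrite (repZ psi_rep) -[_ *: _]addr0.
  by apply: (corner_lin habar) => //; exact: (corner0 habar).
- move=> x y /(cornerP habar)[kx ex]; have [M M0 bM] := bd y.
  apply/(cornerP habar); split; last exact: psi_corner.
  by rewrite (repM psi_rep); exact: (compacts_compr M0 (ra y) bM kx).
- move=> x y /(cornerP habar)[ky ey]; have [M M0 bM] := bd x.
  apply/(cornerP habar); split; last exact: psi_corner.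
  by rewrite (repM psi_rep); exact: (compacts_compl M0 (ra x) bM ky).
- by move=> x hx; rewrite (repS psi_rep); exact: (corner_adj habar).
- move=> b; rewrite -/compact_part -compact_part_spanE => hb.
  by apply: closed_closure hb.
Qed.

End Toeplitz.

(** * The inverse of the isomorphism on the corner of the compacts *)

Section ExactSequence.
Context {R : realType} {A : cstarType R} {alpha : A -> A}.
Context {abar : nat -> (selfmod A -> selfmod A) -> selfmod A -> selfmod A}.
Context {B : cstarType R} {iA : A -> B} {v : nat -> selfmod B -> selfmod B}.
Context {psi : B -> l2mod A -> l2mod A}.
Local Notation X := (l2mod A).
Local Notation p := (@eta_op R A abar).
Local Notation K := (l2_compacts A).

Hypothesis halpha : star_hom (S := alg_ops A) (S' := alg_ops A) setT setT alpha.
Hypothesis habar : forall n, strict_extension (iter n alpha) (abar n).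
Hypothesis hpsi : star_iso (S := alg_ops B) (S' := op_ops X)
  setT (corner p (toeplitz alpha)) psi.

Let rep := psi_rep habar hpsi.
Let inj := psi_inj hpsi.

Lemma corner_compacts_psi S : corner p K S -> exists b, psi b = S.
Proof.
move=> [S' kS <-]; have [_ _ e] := hpsi.
have : (psi @` setT) (p \o S' \o p) by rewrite e; exists S' => //; exact: compacts_sub_toeplitz halpha _ kS.
by move=> [b _ eb]; exists b.
Qed.

(** The inverse has to be total on operators; the default 0 is taken off the range of [psi], which
    contains the corner. *)
Definition psi_inv (S : X -> X) : B := xget 0 [set b | psi b = S].

Lemma psiK b : psi_inv (psi b) = b.
Proof. by apply: inj; exact: (@xgetI _ 0 [set c | psi c = psi b] b). Qed.

Lemma psi_star_iso (I : set B) : I = compact_part (abar := abar) (psi := psi) ->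
  star_iso (S := alg_ops B) (S' := op_ops X) I (corner p K) psi.
Proof.
move=> ->; have [[_ h2 h3 h4] hi _] := hpsi; split; first split=> //.
- by move=> k x y _ _; exact: h2.
- by move=> x y _ _; exact: h3.
- by move=> x _; exact: h4.
- by move=> x y _ _; exact: inj.
apply/seteqP; split=> [_ [b hb <-] //|S kS].
by have [b eb] := corner_compacts_psi kS; exists b => //; rewrite /compact_part /= eb.
Qed.

Lemma psi_inv_star_hom :
  star_hom (S := op_ops X) (S' := alg_ops B) (corner p K) setT psi_inv.
Proof.
have [[_ h2 h3 h4] _ _] := hpsi; split=> //.
- move=> k S S' /corner_compacts_psi[b <-] /corner_compacts_psi[c <-].
  by rewrite !psiK -[RHS]psiK; congr psi_inv; rewrite h2.
- move=> S S' /corner_compacts_psi[b <-] /corner_compacts_psi[c <-].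
  by rewrite !psiK -[RHS]psiK; congr psi_inv; rewrite h3.
- move=> S /corner_compacts_psi[b <-].
  by rewrite psiK -[RHS]psiK; congr psi_inv; rewrite h4.
Qed.

End ExactSequence.

Theorem theorem4p1 (R : realType)
    (A : cstarType R) (alpha : A -> A)
    (halpha : star_hom (S := alg_ops A) (S' := alg_ops A) setT setT alpha)
    (abar : nat -> (selfmod A -> selfmod A) -> (selfmod A -> selfmod A))
    (habar : forall n, strict_extension (iter n alpha) (abar n))
    (B : cstarType R) (iA : A -> B) (v : nat -> selfmod B -> selfmod B)
    (hB : piso_crossed_product alpha iA v)
    (D : cstarType R) (jA : A -> D) (T : nat -> selfmod D -> selfmod D)
    (hD : iso_crossed_product alpha jA T)
    (phi : B -> D)
    (hphi : star_hom (S := alg_ops B) (S' := alg_ops D) setT setT phi)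
    (hphi_gen : forall m a n,
       phi (monomial iA v m a n) = monomial jA T m a n)
    (p : l2mod A -> l2mod A)
    (hp : p = pi_alpha_bar abar (idop (selfmod A)))
    (psi : B -> l2mod A -> l2mod A)
    (hpsi : star_iso (S := alg_ops B) (S' := op_ops (l2mod A))
       setT (corner p (toeplitz alpha)) psi)
    (hpsi_iA : forall a, psi (iA a) = pi_alpha alpha a)
    (hpsi_v : forall n, extension_at psi (v n) (p \o adj (shiftn A n) \o p)) :
  [/\ ker phi =
        closed_span [set b | exists m a n, b = defect_monomial iA v m a n],
      star_iso (S := alg_ops B) (S' := op_ops (l2mod A))
        (ker phi) (corner p (l2_compacts A)) psi,
      full_corner p (l2_compacts A) &
      exists Psi : (l2mod A -> l2mod A) -> B,
        short_exact (corner p (l2_compacts A)) Psi phi /\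
        forall m a n,
          let T0 := p \o shiftn A m \o pi_alpha alpha a
                    \o (idop (l2mod A) - (shiftn A 1 \o adj (shiftn A 1)))
                    \o adj (shiftn A n) \o p in
          corner p (l2_compacts A) T0 /\
          Psi T0 = defect_monomial iA v m a n].
Proof.
case: hB => hiA hcov _ hspan.
have {}hp : p = eta_op (abar := abar) by [].
subst p.
have hI := compact_part_ideal halpha habar hcov hpsi hiA hpsi_iA hpsi_v.
have hE := compact_part_spanE halpha habar hcov hpsi hiA hpsi_iA hpsi_v.
have hd := psi_defect_monomial halpha habar hcov hpsi hiA hpsi_iA hpsi_v.
have hc m a n : corner (eta_op (abar := abar)) (l2_compacts A) (psi (defect_monomial iA v m a n)).
  by rewrite hd; exists (munit m n a) => //; exact: munit_compact.
have kerE : ker phi = compact_part (abar := abar) (psi := psi).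
  apply/seteqP; split=> b.
    exact: (hom_ker_sub hiA hcov hspan hD hphi hphi_gen hI).
  by rewrite -hE; exact: (defects_sub_ker hphi hcov hD hphi_gen).
split.
- by rewrite kerE hE.
- exact: (psi_star_iso halpha hpsi).
- exact: (full_corner_compacts habar).
exists (psi_inv (psi := psi)); split; last first.
  move=> m a n /=; rewrite (corner_monomial halpha habar) -hd; split=> //.
  exact: (psiK hpsi).
split; [exact: (corner_cstar habar)|split=> //; exact: (psi_inv_star_hom halpha hpsi)| | |].
- move=> S S'; rewrite !inE => /(corner_compacts_psi halpha hpsi)[b <-].
  by move=> /(corner_compacts_psi halpha hpsi)[c <-]; rewrite !(psiK hpsi) => ->.
- rewrite kerE; apply/seteqP; split=> [_ [S kS <-]|b kb].
    have [b eb] := corner_compacts_psi halpha hpsi kS.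
    by rewrite -eb (psiK hpsi) /compact_part /= eb.
  by exists (psi b) => //; exact: (psiK hpsi).
- exact: (phi_surjective hphi hD hphi_gen).
Qed.
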